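(* Let $H$ be a Hilbert space and let $E$ be a Hilbert $\mathcal{K}(H)$-module. With respect to the gap topology, the space $FredSR(E)$ of selfadjoint regular Fredholm operators on $E$ is path-connected, and the space $FredR(E)$ of regular Fredholm operators on $E$ is not path-connected.
   Context: $\mathcal{K}(H)$ is the C*-algebra of compact operators on $H$. Hilbert $\mathcal{K}(H)$-modules are left modules with $\mathcal{K}(H)$-valued inner product that is linear in the first variable. $B(E)$ is the C*-algebra of bounded adjointable operators on $E$, and $K(E)\subseteq B(E)$ is the closed linear span of the maps $z\mapsto\langle z,x\rangle y$, $x,y\in E$. A regular operator on $E$ is a closed $\mathcal{K}(H)$-linear operator $t$ with dense domain $Dom(t)\subseteq E$, densely defined adjoint $t^*$, and $1+t^*t$ of dense range; it is selfadjoint if $t^*=t$. A regular operator $t$ is Fredholm if there is $G\in B(E)$ such that $Gt$ is closable with closure $\overline{Gt}\in B(E)$ and $\overline{Gt}-1\in K(E)$, and there is $G'\in B(E)$ such that $tG'$ is closable with $\overline{tG'}\in B(E)$ and $\overline{tG'}-1\in K(E)$. $FredR(E)$ is the set of regular Fredholm operators on $E$ and $FredSR(E)$ its subset of selfadjoint ones, both with the gap topology, i.e. the topology of the metric $d(t,s)=\|P_{G(t)}-P_{G(s)}\|$, where $P_{G(t)}$ is the orthogonal projection of $E\oplus E$ onto the graph $G(t)=\{(x,tx):x\in Dom(t)\}$.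
   Formalization: The claim that FredR(E) is not path-connected is proved when the identity of E is not in K(E); otherwise (e.g. E = 0 or E = C^n over H = C) every regular operator is bounded and Fredholm, FredR(E) = B(E) is path-connected, and the claim fails. *)

(* Defs.v *)
From HB Require Import structures.
From mathcomp Require Import all_boot all_order all_algebra.
From mathcomp Require Import complex.
From mathcomp Require Import all_classical all_reals all_analysis.
From mathcomp Require Import ring lra.

Set Implicit Arguments.
Unset Strict Implicit.
Unset Printing Implicit Defensive.

Import Order.TTheory GRing.Theory Num.Theory.
Import numFieldNormedType.Exports.

Local Open Scope classical_set_scope.
Local Open Scope ring_scope.
Local Open Scope complex_scope.

(* Hilbert spaces; hdot is linear in its first variable and antilinear in the
   second one. *)
HB.mixin Record isHilbert (R : realType) H of CompleteNormedModule R[i] H := {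
  hdot : {dot H for (@Num.conj R[i])} ;
  hdot_norm : forall x : H, `|x| ^+ 2 = hdot x x }.

#[short(type="hilbertType")]
HB.structure Definition Hilbert (R : realType) :=
  {H of CompleteNormedModule R[i] H & isHilbert R H}.

(* The norm of a normed module over R[i] takes values in R[i]; this is the same
   number, seen in R. *)
Definition rnorm (R : realType) (V : normedModType R[i]) (x : V) : R :=
  complex.Re `|x|.

(* Operator norm relative to norms N on V and N' on W; it is extended
   real-valued so as to be +oo on unbounded maps. *)
Definition opnorm (R : realType) (V W : Type) (N : V -> R) (N' : W -> R)
    (f : V -> W) : \bar R :=
  ereal_sup [set (N' (f x))%:E | x in [set x | N x <= 1]].

Section RealNorm.
Context (R : realType) (V : normedModType R[i]).
Implicit Types x y : V.

Lemma rnormE x : (rnorm x)%:C = `|x|.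
Proof. by rewrite /rnorm RRe_real// normr_real. Qed.

Lemma rnorm_ge0 x : 0 <= rnorm x.
Proof. by rewrite -ler0c rnormE. Qed.

Lemma rnorm_le1 x : (rnorm x <= 1) = (`|x| <= 1).
Proof. by rewrite -lecR rnormE. Qed.

Lemma rnormD x y : rnorm (x + y) <= rnorm x + rnorm y.
Proof. by rewrite -lecR rmorphD /= !rnormE ler_normD. Qed.

Lemma rnorm0 : rnorm (0 : V) = 0.
Proof. by rewrite /rnorm normr0. Qed.

Lemma rnorm_eq0 x : rnorm x = 0 -> x = 0.
Proof. by move=> h; apply/eqP; rewrite -normr_eq0 -rnormE h. Qed.

Lemma rnormZ (c : R) x : 0 <= c -> rnorm (c%:C *: x) = c * rnorm x.
Proof.
move=> c0; apply: (@complexI R); rewrite rnormE normrZ rmorphM /= rnormE.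
by rewrite ger0_norm// ler0c.
Qed.

Lemma rnorm_distl x y : `|rnorm x - rnorm y| <= rnorm (x - y).
Proof.
have h (u v : V) : rnorm u - rnorm v <= rnorm (u - v).
  by have := rnormD (u - v) v; rewrite subrK lerBlDr.
rewrite ler_norml h andbT lerNl opprB (le_trans (h _ _))//.
by rewrite -lecR !rnormE distrC.
Qed.

Lemma rnorm_continuous : continuous (@rnorm R V).
Proof.
move=> x; apply/cvgrPdist_lt => e e0.
near=> y.
rewrite (le_lt_trans (rnorm_distl _ _))// -ltcR rnormE.
near: y; apply: cvgr_dist_lt; last by rewrite ltcR.
exact: cvg_id.
Unshelve. all: by end_near. Qed.

Lemma precompact_bounded (A : set V) :
  precompact A -> exists2 M : R, 0 < M & forall x, A x -> rnorm x <= M.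
Proof.
move=> [B AB [cB _]].
have /compact_bounded[M [_ hM]] : compact (@rnorm R V @` B).
  apply: continuous_compact => //.
  by apply: continuous_subspaceT; exact: rnorm_continuous.
exists (`|M| + 1) => [|x Ax]; first by rewrite ltr_wpDl.
rewrite -(ger0_norm (rnorm_ge0 x)); apply: (hM (`|M| + 1)) => //.
  by rewrite (le_lt_trans (ler_norm _))// ltrDl.
by exists x => //; apply: AB.
Qed.

End RealNorm.

Section CompactOperators.
Context (R : realType) (H : hilbertType R).

Definition compact_operator : {pred H -> H} :=
  [pred a : H -> H |
    `[< linear a /\ precompact (a @` [set x : H | `|x| <= 1]) >]].

Lemma compact_operatorP (a : H -> H) :
  reflect (linear a /\ precompact (a @` [set x : H | `|x| <= 1]))
          (a \in compact_operator).
Proof. exact: asboolP. Qed.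

Lemma compact_operator_submod : submod_closed compact_operator.
Proof.
split=> [|c a b].
  apply/compact_operatorP; split=> [c x y|]; first by rewrite /= scaler0 addr0.
  apply: (@precompact_subset _ _ [set 0]); first by move=> _ [x _ <-].
  apply: compact_precompact; last exact: compact_set1.
  exact: norm_hausdorff.
move=> /compact_operatorP[la [A aA [cA _]]] /compact_operatorP[lb [B bB [cB _]]].
apply/compact_operatorP; split=> [d x y|].
  rewrite -![(_ + _ : H -> H) _]/(_ + _) -![(_ *: _ : H -> H) _]/(_ *: _).
  by rewrite la lb !scalerDr addrACA !scalerA [c * d]mulrC.
apply: (@precompact_subset _ _
  ((fun z : H * H => c *: z.1 + z.2) @` (A `*` B))).
  move=> _ [x x1 <-]; exists (a x, b x) => //.
  by split; [apply: aA|apply: bB]; exists x.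
apply: compact_precompact; first exact: norm_hausdorff.
apply: continuous_compact; last exact: compact_setX.
apply: continuous_subspaceT => z; apply: cvgD; last exact: cvg_snd.
by apply: cvgZr; exact: cvg_fst.
Qed.

HB.instance Definition _ :=
  GRing.isSubmodClosed.Build R[i] (H -> H) compact_operator
    compact_operator_submod.

Record compop := Compop {
  compop_fun :> H -> H ;
  compop_compact : compop_fun \in compact_operator }.

HB.instance Definition _ := [isSub for compop_fun].
HB.instance Definition _ := [Choice of compop by <:].
HB.instance Definition _ := [SubChoice_isSubLmodule of compop by <:].

Lemma compop_linear (a : compop) : linear a.
Proof. by case: a => a /= /compact_operatorP[]. Qed.

Lemma compact_operator_comp (a b : H -> H) :
  a \in compact_operator -> b \in compact_operator ->
  a \o b \in compact_operator.
Proof.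
move=> /compact_operatorP[la [A aA [cA _]]] /compact_operatorP[lb pb].
have [M M0 bM] := precompact_bounded pb.
apply/compact_operatorP; split=> [c x y|]; first by rewrite /= lb la.
apply: (@precompact_subset _ _ ((fun x : H => M%:C *: x) @` A)).
  move=> _ [x x1 <-] /=; exists (a (M^-1%:C *: b x)).
    apply: aA; exists (M^-1%:C *: b x) => //=.
    rewrite -rnorm_le1 rnormZ ?invr_ge0 ?(ltW M0)//.
    by rewrite ler_pdivrMl// mulr1 bM//; exists x.
  have la0 : a 0 = 0.
    by have := la (-1) 0 0; rewrite scaleN1r addNr scaleN1r addNr.
  rewrite -[_ *: b x]addr0 la la0 addr0 scalerA -rmorphM /= divff ?scale1r//.
  by rewrite gt_eqF.
apply: compact_precompact; first exact: norm_hausdorff.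
apply: continuous_compact => //; apply: continuous_subspaceT => x.
exact: scaler_continuous.
Qed.

Definition kcomp (a b : compop) : compop :=
  Compop (compact_operator_comp (compop_compact a) (compop_compact b)).

End CompactOperators.

(* Hilbert K(H)-modules. The last axiom says that the norm of E is
   ||x|| = ||<x, x>||^(1/2); in particular <x, x> = 0 implies x = 0, and
   completeness is part of CompleteNormedModule. *)
HB.mixin Record isHilbertMod (R : realType) (H : hilbertType R) E
    of CompleteNormedModule R[i] E := {
  kact : compop H -> E -> E ;
  kinner : E -> E -> compop H ;
  kactDl : forall a b x, kact (a + b) x = kact a x + kact b x ;
  kactDr : forall a x y, kact a (x + y) = kact a x + kact a y ;
  kactZl : forall (c : R[i]) a x, kact (c *: a) x = c *: kact a x ;
  kactZr : forall (c : R[i]) a x, kact a (c *: x) = c *: kact a x ;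
  kactM : forall a b x, kact (kcomp a b) x = kact a (kact b x) ;
  kinnerDl : forall x y z, kinner (x + y) z = kinner x z + kinner y z ;
  kinnerZl : forall (c : R[i]) x z, kinner (c *: x) z = c *: kinner x z ;
  kinner_act : forall a x y, kinner (kact a x) y = kcomp a (kinner x y) ;
  (* <y, x> is the adjoint of <x, y> *)
  kinnerC : forall x y (h k : H),
    hdot (kinner x y h) k = hdot h (kinner y x k) ;
  kinner_ge0 : forall x (h : H), 0 <= hdot (kinner x x h) h ;
  kinner_norm : forall x,
    opnorm (@rnorm R H) (@rnorm R H) (kinner x x) = (rnorm x ^+ 2)%:E }.

#[short(type="hilbertModType")]
HB.structure Definition HilbertMod (R : realType) (H : hilbertType R) :=
  {E of CompleteNormedModule R[i] E & @isHilbertMod R H E}.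

Section Operators.
Context (R : realType) (H : hilbertType R) (E : hilbertModType H).
Implicit Types (T : set (E * E)) (f : E -> E).

(* B(E); the existence of g makes f linear over R[i] and over K(H). *)
Definition adjointable f :=
  (opnorm (@rnorm R E) (@rnorm R E) f < +oo)%E /\
  exists g : E -> E, forall x y, kinner (f x) y = kinner x (g y) :> compop H.

Definition rank1 (x y : E) : E -> E := fun z => kact (kinner z x : compop H) y.

Definition finite_rank f := exists n (c : 'I_n -> R[i]) (x y : 'I_n -> E),
  forall z, f z = \sum_(i < n) c i *: rank1 (x i) (y i) z.

(* K(E): the closure in operator norm of the span of the maps
   z |-> <z, x> y. *)
Definition compact_adjointable f :=
  adjointable f /\ forall e : R, 0 < e -> exists2 g, finite_rank g &
    (opnorm (@rnorm R E) (@rnorm R E) (fun x => (f x - g x)%R) < e%:E)%E.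

(* An unbounded operator t on E is represented by its graph
   G(t) = {(x, t x) : x in Dom(t)}, a subset of E * E. *)
Definition dom T : set E := [set x | exists y, T (x, y)].

Definition graph_of f : set (E * E) := [set xy | xy.2 = f xy.1].

Definition klinear_operator T :=
  [/\ T (0, 0),
      forall u v, T u -> T v -> T (u + v),
      forall (c : R[i]) u, T u -> T (c *: u),
      forall (a : compop H) u, T u -> T (kact a u.1, kact a u.2) &
      forall y, T (0, y) -> y = 0].

Definition adjoint T : set (E * E) :=
  [set yz | forall x tx, T (x, tx) ->
     kinner tx yz.1 = kinner x yz.2 :> compop H].

Definition regular T :=
  [/\ klinear_operator T, closed T, dense (dom T), dense (dom (adjoint T)) &
      dense [set w | exists x y z, [/\ T (x, y), adjoint T (y, z) & w = x + z]]].

(* The first set is the graph of G t and the second one that of t G'; that they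
   are closable, with a closure b in B(E), means that their closures are the
   graph of such a b. *)
Definition fredholm T :=
  (exists2 G, adjointable G & exists2 b,
     closure [set xy | exists2 y, T (xy.1, y) & xy.2 = G y] = graph_of b &
     adjointable b /\ compact_adjointable (fun x => b x - x)) /\
  (exists2 G', adjointable G' & exists2 b,
     closure [set xy | T (G' xy.1, xy.2)] = graph_of b &
     adjointable b /\ compact_adjointable (fun x => b x - x)).

End Operators.

Record regop (R : realType) (H : hilbertType R) (E : hilbertModType H) := Regop {
  graph : set (E * E) ;
  graph_regular : regular graph }.

Section DirectSum.
Context (R : realType) (H : hilbertType R) (E : hilbertModType H).
Implicit Types (u v : (E * E)%type) (S : set (E * E)).

(* The Hilbert K(H)-module E (+) E; its norm differs from (but is equivalent
   to) the norm that the library puts on the product E * E. *)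
Definition kinner2 u v : compop H := kinner u.1 v.1 + kinner u.2 v.2.

Definition norm2 u : R :=
  Num.sqrt (fine (opnorm (@rnorm R H) (@rnorm R H) (kinner2 u u))).

Definition is_orthoproj S (P : E * E -> E * E) :=
  forall u, S (P u) /\ forall v, S v -> kinner2 (u - P u) v = 0.

(* Such a P is unique when it exists, and exists for the graph of a regular
   operator; otherwise this is the junk value 0. *)
Definition orthoproj S : E * E -> E * E :=
  xget (fun=> 0) [set P | is_orthoproj S P].

Definition gap (t s : regop E) : \bar R :=
  opnorm norm2 norm2 (fun u => orthoproj (graph t) u - orthoproj (graph s) u).

End DirectSum.

Lemma psd_cauchy_schwarz (C : numClosedFieldType) (V : lmodType C)
    (f : V -> V -> C) (fD : forall x y z, f (x + y) z = f x z + f y z)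
    (fZ : forall c x z, f (c *: x) z = c * f x z)
    (fC : forall x y, f x y = ((f y x)^*)%R) (f0 : forall x, 0 <= f x x) x y :
  `|f x y| ^+ 2 <= f x x * f y y.
Proof.
have fDr z u v : f z (u + v) = f z u + f z v.
  by rewrite fC fD rmorphD /= -!fC.
have fZr c z u : f z (c *: u) = (c^*)%R * f z u by rewrite fC fZ rmorphM /= -fC.
have key s : s \is Num.real ->
    0 <= f x x - (s + s) * `|f x y| ^+ 2 + s ^+ 2 * `|f x y| ^+ 2 * f y y.
  move=> sr; have := f0 (x + (- (s * f x y)) *: y).
  rewrite fD !fDr !fZ !fZr [f y x]fC rmorphN rmorphM /= (CrealP sr) normCK.
  by move=> h; apply: (le_trans h); rewrite le_eqVlt; apply/orP; left;
    apply/eqP; ring.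
have [fy|fy] := eqVneq (f y y) 0; last first.
  have yr : f y y \is Num.real by rewrite ger0_real.
  have y0 : 0 < f y y by rewrite lt0r fy f0.
  have := key (f y y)^-1; rewrite realV yr => /(_ isT).
  move=> /mulr_ge0/(_ (ltW y0)) h; rewrite -subr_ge0; apply: (le_trans h).
  rewrite le_eqVlt; apply/orP; left; apply/eqP; field; exact: fy.
rewrite fy mulr0; have [->//|c0] := eqVneq (`|f x y| ^+ 2) 0.
have cp : 0 < `|f x y| ^+ 2 by rewrite lt0r c0 exprn_ge0.
have := key ((f x x + 1) / (`|f x y| ^+ 2 *+ 2)).
rewrite ger0_real; last first.
  by rewrite divr_ge0 ?addr_ge0 ?f0 ?ler01// mulrn_wge0// ltW.
move=> /(_ isT); rewrite fy mulr0 addr0.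
set N := `|f x y| ^+ 2 in c0 cp *; set a := f x x.
have -> : a - ((a + 1) / (N *+ 2) + (a + 1) / (N *+ 2)) * N = -1.
  by rewrite mulr2n; field; rewrite -mulr2n mulrn_eq0 negb_or c0.
by rewrite ler0N1.
Qed.

Section DirectSumNorm.
Context (R : realType) (H : hilbertType R) (E : hilbertModType H).
Implicit Types (u v w : (E * E)%type) (h k : H) (a b : compop H).

Let nrm a : \bar R := opnorm (@rnorm R H) (@rnorm R H) a.

Let dotDl h k l : hdot (h + k) l = hdot h l + hdot k l.
Proof. by rewrite linearDl. Qed.

Let dotZl (c : R[i]) h l : hdot (c *: h) l = c * hdot h l.
Proof. by rewrite linearZl_LR. Qed.

Let dotC h k : hdot h k = (hdot k h)^*%R.
Proof. by rewrite hermitian_subproof expr0 mul1r. Qed.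

Let dotDr h k l : hdot l (h + k) = hdot l h + hdot l k.
Proof. by rewrite linearDr. Qed.

Let dot_ge0 h : 0 <= hdot h h.
Proof. by rewrite -hdot_norm exprn_ge0. Qed.

Let kD a b h : (a + b) h = a h + b h. Proof. by []. Qed.
Let kZ (c : R[i]) a h : (c *: a) h = c *: a h. Proof. by []. Qed.

Let ka0 a : a 0 = 0.
Proof.
by have := compop_linear a (-1) 0 0; rewrite scaleN1r addNr scaleN1r addNr.
Qed.

Let kDr a h k : a (h + k) = a h + a k.
Proof. by have := compop_linear a 1 h k; rewrite !scale1r. Qed.

Let kZr a (c : R[i]) h : a (c *: h) = c *: a h.
Proof. by have := compop_linear a c h 0; rewrite ka0 !addr0. Qed.

Let kinner2D u v w : kinner2 (u + v) w = kinner2 u w + kinner2 v w.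
Proof. by rewrite /kinner2 !kinnerDl addrACA. Qed.

Let kinner2Z (c : R[i]) u w : kinner2 (c *: u) w = c *: kinner2 u w.
Proof. by rewrite /kinner2 !kinnerZl scalerDr. Qed.

Let kinner2C u v h k : hdot (kinner2 u v h) k = hdot h (kinner2 v u k).
Proof. by rewrite /kinner2 !kD dotDl dotDr !kinnerC. Qed.

Let kinner2_ge0 u h : 0 <= hdot (kinner2 u u h) h.
Proof. by rewrite /kinner2 kD dotDl addr_ge0// kinner_ge0. Qed.

Let q h u : R := complex.Re (hdot (kinner2 u u h) h).

Let qE h u : (q h u)%:C = hdot (kinner2 u u h) h.
Proof. by rewrite /q RRe_real// ger0_real. Qed.

Let q_ge0 h u : 0 <= q h u.
Proof. by rewrite -ler0c qE. Qed.

Let opnorm_ge h a : `|h| <= 1 -> ((rnorm (a h))%:E <= nrm a)%E.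
Proof.
by move=> h1; apply: ereal_sup_ubound; exists h => //=; rewrite rnorm_le1.
Qed.

Let opnorm_fin u : nrm (kinner2 u u) \is a fin_num.
Proof.
rewrite fin_numElt (lt_le_trans (ltNyr 0)) /=; last first.
  by apply: le_trans (@opnorm_ge 0 _ _); rewrite ?lee_fin ?rnorm_ge0 ?normr0.
apply: (@le_lt_trans _ _ (rnorm u.1 ^+ 2 + rnorm u.2 ^+ 2)%:E); last exact: ltry.
apply: ge_ereal_sup => ? [h /=]; rewrite rnorm_le1 => h1 <-.
rewrite EFinD -!kinner_norm.
apply: (@le_trans _ _ (rnorm (kinner u.1 u.1 h) + rnorm (kinner u.2 u.2 h))%:E).
  by rewrite lee_fin rnormD.
by rewrite EFinD leeD// opnorm_ge.
Qed.

Let dot_cs h k : `|hdot h k| <= `|h| * `|k|.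
Proof.
rewrite -(@ler_pXn2r _ 2)// ?nnegrE ?mulr_ge0// exprMn !hdot_norm.
exact: (psd_cauchy_schwarz dotDl dotZl dotC dot_ge0).
Qed.

Let norm2_ge0 u : 0 <= norm2 u. Proof. exact: sqrtr_ge0. Qed.

Let norm2_sqr u : (norm2 u ^+ 2)%:E = nrm (kinner2 u u).
Proof.
rewrite sqr_sqrtr; first by rewrite fineK// opnorm_fin.
rewrite -lee_fin fineK ?opnorm_fin//.
by apply: le_trans (@opnorm_ge 0 _ _); rewrite ?lee_fin ?rnorm_ge0 ?normr0.
Qed.

Let q_le h u : `|h| <= 1 -> q h u <= norm2 u ^+ 2.
Proof.
move=> h1; rewrite -lee_fin norm2_sqr (le_trans _ (opnorm_ge _ h1))// lee_fin.
rewrite -lecR qE rnormE -(ger0_norm (kinner2_ge0 u h)) (le_trans (dot_cs _ _))//.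
by rewrite ler_piMr.
Qed.

Let form_cs u h k :
  `|hdot (kinner2 u u h) k| ^+ 2 <= (q h u)%:C * (q k u)%:C.
Proof.
rewrite !qE.
apply: (@psd_cauchy_schwarz _ _ (fun h k => hdot (kinner2 u u h) k)); cbv beta.
- by move=> x y z; rewrite kDr dotDl.
- by move=> c x z; rewrite kZr dotZl.
- by move=> x y; rewrite dotC kinner2C.
- exact: kinner2_ge0.
Qed.

Let norm2_le u (M : R) : 0 <= M ->
  (forall h, `|h| <= 1 -> q h u <= M ^+ 2) -> norm2 u <= M.
Proof.
move=> M0 qM; rewrite -(@ler_pXn2r _ 2)// ?nnegrE// -lee_fin norm2_sqr.
apply: ge_ereal_sup => ? [h /=]; rewrite rnorm_le1 => h1 <-; rewrite lee_fin.
set k := kinner2 u u h; have [k0|k0] := eqVneq (rnorm k) 0.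
  by rewrite k0 exprn_ge0.
have kp : 0 < rnorm k by rewrite lt0r k0 rnorm_ge0.
pose l := (rnorm k)^-1%:C *: k.
have l1 : `|l| <= 1.
  by rewrite -rnorm_le1 /l rnormZ ?invr_ge0 ?(ltW kp)// mulVf.
have kl : hdot k l = (rnorm k)%:C.
  rewrite dotC dotZl -hdot_norm -rnormE -rmorphXn -rmorphM /=.
  have -> : (rnorm k)^-1 * rnorm k ^+ 2 = rnorm k by field; exact: k0.
  by rewrite conj_Creal// ger0_real// ler0c ltW.
have := form_cs u h l; rewrite -/k kl ger0_norm ?ler0c ?(ltW kp)//.
rewrite -rmorphXn -rmorphM /= lecR => hk.
rewrite -(@ler_pXn2r _ 2)// ?nnegrE ?exprn_ge0 ?(ltW kp)//.
by rewrite (le_trans hk)// [leRHS]expr2 ler_pM ?q_ge0 ?qM.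
Qed.

Lemma norm20 : norm2 (0 : E * E) = 0.
Proof.
apply/eqP; rewrite eq_le norm2_ge0 andbT; apply: norm2_le => // h _.
rewrite -lecR qE -[X in kinner2 X _](scale0r (0 : E * E)) kinner2Z kZ.
by rewrite dotZl mul0r expr0n.
Qed.

Lemma norm2N u : norm2 (- u) = norm2 u.
Proof.
suff h v : norm2 (- v) <= norm2 v by apply/eqP; rewrite eq_le h -{1}[u]opprK h.
apply: norm2_le => // h h1; rewrite (le_trans _ (q_le v h1))// -lecR !qE.
rewrite -scaleN1r kinner2Z kZ dotZl kinner2C dotC kinner2Z kZ dotZl.
rewrite rmorphM rmorphN1 -[X in _ * (_ * X)]dotC mulrA mulrNN !mul1r.
by rewrite -kinner2C.
Qed.

Lemma norm2D u v : norm2 (u + v) <= norm2 u + norm2 v.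
Proof.
apply: norm2_le => [|h h1]; first by rewrite addr_ge0.
have cs : `|hdot (kinner2 u v h) h| ^+ 2 <= (q h u)%:C * (q h v)%:C.
  rewrite !qE.
  apply: (@psd_cauchy_schwarz _ _ (fun u v => hdot (kinner2 u v h) h)); cbv beta.
  - by move=> x y z; rewrite kinner2D kD dotDl.
  - by move=> c x z; rewrite kinner2Z kZ dotZl.
  - by move=> x y; rewrite dotC kinner2C.
  - by move=> x; exact: kinner2_ge0.
set r := complex.Re (hdot (kinner2 u v h) h).
have qD : q h (u + v) = q h u + q h v + 2 * r.
  have ReD (z w : R[i]) : complex.Re (z + w) = complex.Re z + complex.Re w.
    by case: z w => [? ?] [? ?].
  have e (x y z : E * E) : hdot (kinner2 z (x + y) h) h =
      hdot (kinner2 z x h) h + hdot (kinner2 z y h) h.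
    rewrite !(kinner2C z) ![hdot h _]dotC kinner2D kD dotDl rmorphD /=.
    by [].
  rewrite {1}/q kinner2D kD dotDl !e !ReD.
  have -> : complex.Re (hdot (kinner2 v u h) h) = r.
    by rewrite kinner2C dotC /r; case: (hdot _ _) => ? ?.
  by rewrite /q /r; ring.
have rr : r ^+ 2 <= q h u * q h v.
  move: cs; rewrite -add_Re2_Im2 -rmorphM lecR -/r; apply: le_trans.
  by rewrite lerDl sqr_ge0.
have qu := q_le u h1; have qv := q_le v h1.
have rle : r <= norm2 u * norm2 v.
  rewrite (le_trans (ler_norm _))// -(@ler_pXn2r _ 2)// ?nnegrE ?mulr_ge0//.
  rewrite real_normK ?num_real// exprMn (le_trans rr)//.
  by rewrite ler_pM ?q_ge0.
by rewrite qD sqrrD; lra.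
Qed.

End DirectSumNorm.

Section GapTopology.
Context (R : realType) (H : hilbertType R) (E : hilbertModType H).
Implicit Types t s r : regop E.

HB.instance Definition _ := gen_eqMixin (regop E).
HB.instance Definition _ := gen_choiceMixin (regop E).

Lemma gapxx t : gap t t = 0%E.
Proof.
rewrite /gap /opnorm (_ : [set _ | _ in _] = [set 0%E]) ?ereal_sup1//.
apply/seteqP; split=> [_ [u _ <-]|_ ->]; first by rewrite /= subrr norm20.
by exists 0 => /=; rewrite ?subrr norm20.
Qed.

Lemma gapC t s : gap t s = gap s t.
Proof.
rewrite /gap /opnorm; congr ereal_sup; apply: eq_imagel => u _.
by rewrite -norm2N opprB.
Qed.

Lemma gap_triangle s t r : (gap t r <= gap t s + gap s r)%E.
Proof.
apply: ge_ereal_sup => ? [u /= u1 <-].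
apply: (@le_trans _ _
  ((norm2 (orthoproj (graph t) u - orthoproj (graph s) u)%R)%:E +
   (norm2 (orthoproj (graph s) u - orthoproj (graph r) u)%R)%:E)%E).
  rewrite -EFinD lee_fin -[X in norm2 X <= _](subrKA (orthoproj (graph s) u)).
  exact: norm2D.
by rewrite leeD//; apply: ereal_sup_ubound; exists u.
Qed.

Let gap_ball t (e : R) : set (regop E) := [set s | (gap t s < e%:E)%E].

Let gap_ball_center t (e : R) : 0 < e -> gap_ball t e t.
Proof. by move=> e0; rewrite /gap_ball /= gapxx lte_fin. Qed.

Let gap_ball_sym t s (e : R) : gap_ball t e s -> gap_ball s e t.
Proof. by rewrite /gap_ball /= gapC. Qed.

Let gap_ball_triangle t s r (d e : R) :
  gap_ball t d s -> gap_ball s e r -> gap_ball t (d + e) r.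
Proof.
rewrite /gap_ball /= => td se; apply: (le_lt_trans (gap_triangle s _ _)).
by rewrite EFinD lteD.
Qed.

HB.instance Definition _ :=
  hasNbhs.Build (regop E) (nbhs_ (entourage_ gap_ball)).

HB.instance Definition _ :=
  @Nbhs_isPseudoMetric.Build R (regop E) (entourage_ gap_ball) erefl gap_ball
    gap_ball_center gap_ball_sym gap_ball_triangle erefl.

Lemma gap_ballE t (e : R) : ball t e = [set s | (gap t s < e%:E)%E].
Proof. by []. Qed.

End GapTopology.

Definition path_connected (R : realType) (T : topologicalType) (A : set T) :=
  forall x y, A x -> A y -> exists p : R -> T,
    [/\ {within `[0, 1], continuous p}, p 0 = x, p 1 = y &
        p @` `[0, 1] `<=` A].

Section Fredholm.
Context (R : realType) (H : hilbertType R) (E : hilbertModType H).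

Definition FredR : set (regop E) := [set t | fredholm (graph t)].

Definition FredSR : set (regop E) :=
  [set t | FredR t /\ adjoint (graph t) = graph t].

End Fredholm.

Arguments FredR {R H} E.
Arguments FredSR {R H} E.

(* Main.v *)
Require Import Defs.
From HB Require Import structures.
From mathcomp Require Import all_boot all_order all_algebra.
From mathcomp Require Import complex finmap.
From mathcomp Require Import all_classical all_reals all_analysis.
From mathcomp Require Import ring lra.

Set Implicit Arguments.
Unset Strict Implicit.
Unset Printing Implicit Defensive.

Import Order.TTheory GRing.Theory Num.Theory.
Import numFieldNormedType.Exports.

Import Defs.

Local Open Scope classical_set_scope.
Local Open Scope ring_scope.
Local Open Scope complex_scope.

(* Closed submodules of E are orthogonally complemented: this holds in the
   Hilbert space pE, where p is a rank-one projection of K(H), and pE generates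
   E. Hence every regular t has a graph {(g x, f x)} with g = (1 + t* t)^(-1/2)
   and f = t g bounded adjointable.

   Selfadjoint operators. If t = t*, then f and g commute, and for a symmetry J
   with J f g = |f g| the operators (t + s J) / (1 + s |t|), with graphs
   {((g + s J f) x, (f + s J g) x)}, are invertible for s > 0 and lead from t
   to J. Up to a finite-rank projection, along which eigenvalues may cross 0,
   the negative subspace of J carries a bounded selfadjoint operator b without
   eigenvalues, an orthogonal sum of operators S + S* with unilateral shifts S,
   provided by Zorn's lemma. The inverse of J then moves to 1 through
   operators (1 - s) (-1) + s b and (1 - s) b + s, which have dense range; their
   inverses are invertible selfadjoint regular operators, and the flip of
   graphs is isometric for the gap.

   Index. Call t of index zero if f is an invertible operator plus a compact
   one. If s is close to t in the gap, the projection onto the graph of s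
   identifies the two graphs, so that f_s X is close to f_t for an invertible X.
   With a right parametrix b of f_t, both f_t b and f_s X b are invertible plus
   compact, hence s and t have index zero if and only if b does. Index zero is
   thus locally constant on FredR(E). It holds for the identity, and it fails
   for a non-unitary isometric shift by the Fredholm alternative. *)

(** * Real estimates in complex normed modules *)

(** The norm of [E] is a supremum of seminorms rather than a Hilbert norm, and over a general
    C*-algebra closed submodules need not be complemented. A unit vector [e] of [H], carried through
    most sections, overcomes both: [theta e e] cuts a Hilbert space out of [E], and [theta e h]
    transports the seminorm of any [h] to it. If [H] has no unit vector, then [E] is zero. No
    functional calculus beyond square roots is used: the bounded transform comes from the root of a
    resolvent, the sign of [a] from the root of [a^2]. Operators without eigenvalues enter for the
    following reason. A bounded selfadjoint [g] with dense range is injective, and its inverse is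
    regular, selfadjoint and boundedly invertible, hence Fredholm, even if 0 lies in the spectrum of
    [g]. The spectrum of [g] may thus cross 0 along a path as long as 0 never becomes an eigenvalue.
    Continuity for the gap is always obtained in the same way: operators are written as quotients
    [f / g] of bounded operators affine in the parameter, and the gap is at most a multiple of the
    square root of the parameter distance. *)

Section RealEpsilon.
Context (R : realType).
Implicit Types V W : normedModType R[i].

Lemma ReD (z w : R[i]) : complex.Re (z + w) = complex.Re z + complex.Re w.
Proof. by case: z w => [? ?] [? ?]. Qed.

Lemma ReN (z : R[i]) : complex.Re (- z) = - complex.Re z.
Proof. by case: z. Qed.

Lemma ReZ (c : R) (z : R[i]) : complex.Re (c%:C * z) = c * complex.Re z.
Proof. by case: z => a b /=; rewrite mul0r subr0. Qed.

Lemma ReJ (z : R[i]) : complex.Re (z^*)%R = complex.Re z.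
Proof. by case: z. Qed.

Lemma Re_le_norm (z : R[i]) : complex.Re z <= complex.Re `|z|.
Proof. by case: z => a b /=; rewrite (le_trans (ler_norm _))// -sqrtr_sqr ler_wsqrtr// lerDl sqr_ge0. Qed.

Lemma rnormN V (x : V) : rnorm (- x) = rnorm x.
Proof. by rewrite /rnorm normrN. Qed.

Lemma rnormBC V (x y : V) : rnorm (x - y) = rnorm (y - x).
Proof. by rewrite -rnormN opprB. Qed.

Lemma rnormB V (x y : V) : rnorm (x - y) <= rnorm x + rnorm y.
Proof. by rewrite (le_trans (rnormD _ _))// rnormN. Qed.

Lemma rnorm_tri V (x y z : V) : rnorm (x - z) <= rnorm (x - y) + rnorm (y - z).
Proof. by rewrite (le_trans _ (rnormD _ _))// subrKA. Qed.

Lemma rnormZC V (c : R[i]) (x : V) : rnorm (c *: x) = complex.Re `|c| * rnorm x.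
Proof.
apply: (@complexI R); rewrite rnormE normrZ rmorphM /= rnormE.
by congr (_ * _); rewrite RRe_real// normr_real.
Qed.

Lemma pos_complexP (d : R[i]) : 0 < d -> exists2 e : R, 0 < e & e%:C = d.
Proof.
move=> d0; have rd : (complex.Re d)%:C = d by rewrite RRe_real// gtr0_real.
by exists (complex.Re d) => //; rewrite -ltcR rd.
Qed.

Lemma nbhs_rnorm V (x : V) (B : set V) :
  nbhs x B <-> exists2 e : R, 0 < e & forall y, rnorm (x - y) < e -> B y.
Proof.
split.
  move=> /nbhs_ballP[d /= /pos_complexP[e e0 <-]] h; exists e => // y xy.
  by apply: h; rewrite -ball_normE /= -rnormE ltcR.
move=> [e e0 h]; apply/nbhs_ballP; exists e%:C => /=; first by rewrite ltcR.
by move=> y; rewrite -ball_normE /= -rnormE ltcR => /h.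
Qed.

Lemma closure_rnorm V (A : set V) x :
  closure A x <-> forall e : R, 0 < e -> exists2 y, A y & rnorm (x - y) < e.
Proof.
split=> [h e e0|h B /nbhs_rnorm[e e0 eB]].
  have [|y [Ay xy]] := h [set y | rnorm (x - y) < e]; last by exists y.
  by apply/nbhs_rnorm; exists e.
by have [y Ay xy] := h _ e0; exists y; split => //; apply: eB.
Qed.

Lemma closure_rnorm2 V W (A : set (V * W)) x y :
  closure A (x, y) <-> forall e : R, 0 < e ->
    exists u v, [/\ A (u, v), rnorm (x - u) < e & rnorm (y - v) < e].
Proof.
split=> [h e e0|h B [[B1 B2] [/= /nbhs_rnorm[e e0 eB] /nbhs_rnorm[d d0 dB]] sB]].
  have [|[u v] [Auv [/= xu yv]]] :=
      h ([set y | rnorm (x - y) < e] `*` [set z | rnorm (y - z) < e]).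
    exists ([set y | rnorm (x - y) < e], [set z | rnorm (y - z) < e]) => //.
    by split; apply/nbhs_rnorm; exists e.
  by exists u, v; split.
have [|u [v [Auv xu yv]]] := h (Num.min e d); first by rewrite lt_min e0.
exists (u, v); split => //; apply: sB; split => /=.
  by apply: eB; rewrite (lt_le_trans xu)// ge_min lexx.
by apply: dB; rewrite (lt_le_trans yv)// ge_min lexx orbT.
Qed.

Lemma dense_rnorm V (A : set V) :
  dense A <-> forall x (e : R), 0 < e -> exists2 y, A y & rnorm (x - y) < e.
Proof.
split=> [h x|h O [x Ox] oO].
  apply/closure_rnorm => B /= xB.
  have [|y [Oy Ay]] := h B^°%classic _ (@open_interior _ B).
    by exists x; exact: nbhs_singleton (nbhs_interior xB).
  by exists y; split => //; exact: (@interior_subset _ B).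
have /nbhs_rnorm[e e0 eO] : nbhs x O by exact: open_nbhs_nbhs.
by have [y Ay xy] := h x e e0; exists y; split => //; exact: eO.
Qed.

(** Convergence with real epsilons, although the norms of the modules are valued in [R[i]];
    estimates then take place in an ordered field. *)
Definition lim_to V (u : nat -> V) (l : V) : Prop :=
  forall e : R, 0 < e -> exists N, forall n, (N <= n)%N -> rnorm (l - u n) < e.

Lemma lim_to_uniq V (u : nat -> V) l l' : lim_to u l -> lim_to u l' -> l = l'.
Proof.
move=> h h'; apply/eqP; rewrite -subr_eq0; apply/eqP/rnorm_eq0/eqP.
rewrite eq_le rnorm_ge0 andbT; apply/ler_addgt0Pr => e e0; rewrite add0r.
have [N hN] := h _ (divr_gt0 e0 (ltr0n _ 2)).
have [M hM] := h' _ (divr_gt0 e0 (ltr0n _ 2)).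
have := hN _ (leq_maxl N M); have := hM _ (leq_maxr N M).
move: (maxn N M) => n; have := rnorm_tri l (u n) l'.
by rewrite [rnorm (u n - l')]rnormBC; lra.
Qed.

Lemma small_invn (e : R) : 0 < e ->
  exists N, forall n, (N <= n)%N -> n.+1%:R^-1 < e.
Proof.
move=> e0; have [N hN] := @ltr_add_invr R 0 e e0; exists N => n Nn.
rewrite add0r in hN; rewrite (le_lt_trans _ hN)// lef_pV2 ?posrE ?ltr0n//.
by rewrite ler_nat ltnS.
Qed.

Lemma closure_lim V (A : set V) x :
  closure A x -> exists u, (forall n, A (u n)) /\ lim_to u x.
Proof.
move=> /closure_rnorm h.
have /choice[u hu] n : exists y, A y /\ rnorm (x - y) < n.+1%:R^-1.
  have n0 : (0 : R) < n.+1%:R^-1 by rewrite invr_gt0 ltr0n.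
  by have [y Ay xy] := h _ n0; exists y.
exists u; split=> [n|e e0]; first by case: (hu n).
have [N hN] := small_invn e0; exists N => n /hN; apply: lt_trans.
by have [] := hu n.
Qed.

Lemma complete_rnorm (V : completeNormedModType R[i]) (u : nat -> V) :
  (forall e : R, 0 < e -> exists N, forall m n, (N <= m)%N -> (N <= n)%N ->
     rnorm (u m - u n) < e) -> exists l, lim_to u l.
Proof.
move=> h; have /cvg_ex[l ul] : cvg (u @ \oo).
  apply/cauchy_cvgP/cauchy_ballP => d /pos_complexP[e e0 <-].
  have [N hN] := h _ e0.
  near=> x y => /=.
  rewrite -ball_normE /= -rnormE ltcR.
  have [Nx Ny] : [set z | exists2 n, (N <= n)%N & z = u n] x /\ [set z | exists2 n, (N <= n)%N & z = u n] y.
    by split; [near: x|near: y]; exists N => // n Nn; exists n.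
  by case: Nx Ny => m Nm -> [n Nn ->]; apply: hN.
exists l => e e0.
have : nbhs l [set y | rnorm (l - y) < e] by apply/nbhs_rnorm; exists e.
by move=> /ul [N _ hN]; exists N => n Nn; exact: hN.
Unshelve. all: by end_near. Qed.

End RealEpsilon.

(** * Limits of sequences and extension by density *)

Section LimitAlgebra.
Context (R : realType).
Implicit Types V W : normedModType R[i].

Lemma lim_toD V (u v : nat -> V) x y :
  lim_to u x -> lim_to v y -> lim_to (fun n => u n + v n) (x + y).
Proof.
move=> hu hv e e0; have e2 := divr_gt0 e0 (ltr0n R 2).
have [N hN] := hu _ e2; have [M hM] := hv _ e2.
exists (maxn N M) => n; rewrite geq_max => /andP[/hN h1 /hM h2].
by rewrite opprD addrACA (le_lt_trans (rnormD _ _))//; lra.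
Qed.

Lemma lim_to_bounded V W (f : V -> W) (C : R) (u : nat -> V) x :
  (forall y z, rnorm (f y - f z) <= C * rnorm (y - z)) ->
  lim_to u x -> lim_to (f \o u) (f x).
Proof.
(* [C] may be zero or negative, so the division is by [|C| + 1]. *)
move=> fC hu e e0; have C0 : 0 < `|C| + 1 by rewrite ltr_wpDl.
have [N hN] := hu _ (divr_gt0 e0 C0); exists N => n /hN h /=.
rewrite (le_lt_trans (fC _ _))//.
rewrite (@le_lt_trans _ _ ((`|C| + 1) * rnorm (x - u n)))//.
  by rewrite ler_wpM2r ?rnorm_ge0// (le_trans (ler_norm _))// lerDl.
by rewrite mulrC -ltr_pdivlMr.
Qed.

Lemma lim_toZ V (c : R[i]) (u : nat -> V) x :
  lim_to u x -> lim_to (fun n => c *: u n) (c *: x).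
Proof.
apply: (@lim_to_bounded _ _ _ (complex.Re `|c|)) => y z.
by rewrite -scalerBr rnormZC.
Qed.

Lemma lim_toB V (u v : nat -> V) x y :
  lim_to u x -> lim_to v y -> lim_to (fun n => u n - v n) (x - y).
Proof.
move=> hu hv; apply: lim_toD => // e e0; have [N hN] := hv _ e0.
by exists N => n /hN; rewrite -opprD rnormN.
Qed.

Lemma lim_to_cst V (x : V) : lim_to (fun=> x) x.
Proof. by move=> e e0; exists 0%N => n _; rewrite subrr rnorm0. Qed.

Lemma lim_to_norm_le V (u : nat -> V) x (M : R) :
  lim_to u x -> (forall n, rnorm (u n) <= M) -> rnorm x <= M.
Proof.
move=> hu uM; apply/ler_addgt0Pr => e e0; have [N hN] := hu _ e0.
have := hN _ (leqnn N); have := uM N; have := rnormD (x - u N) (u N).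
by rewrite subrK; lra.
Qed.

Lemma lim_to_norm_le2 V W (u : nat -> V) (v : nat -> W) x y (C : R) : 0 <= C ->
  lim_to u x -> lim_to v y -> (forall n, rnorm (v n) <= C * rnorm (u n)) ->
  rnorm y <= C * rnorm x.
Proof.
move=> C0 hu hv uv; apply/ler_addgt0Pr => e e0.
have C1 : 0 < C + 1 by rewrite ltr_wpDl.
have [N hN] := hu _ (divr_gt0 e0 (mulr_gt0 (ltr0n R 2) C1)).
have [M hM] := hv _ (divr_gt0 e0 (ltr0n R 2)).
have := hN _ (leq_maxl N M); have := hM _ (leq_maxr N M).
move: (maxn N M) => n h1 h2; have := rnormD (y - v n) (v n); rewrite subrK => h3.
have := rnormD x (u n - x); rewrite addrC subrK [rnorm (u n - x)]rnormBC => h4.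
have h5 : C * rnorm (u n) <= C * rnorm x + C * rnorm (x - u n).
  by rewrite -mulrDr ler_wpM2l.
have h6 : C * rnorm (x - u n) <= e / 2.
  rewrite (@le_trans _ _ ((C + 1) * rnorm (x - u n)))//.
    by rewrite ler_wpM2r ?rnorm_ge0// lerDl.
  by rewrite mulrC -ler_pdivlMr// -mulrA -invfM ltW.
by have := uv n; lra.
Qed.

Lemma lim_to_closed V (A : set V) (u : nat -> V) x :
  closed A -> lim_to u x -> (forall n, A (u n)) -> A x.
Proof.
move=> cA hu uA; apply: cA; apply/closure_rnorm => e e0.
by have [N hN] := hu _ e0; exists (u N) => //; exact: hN.
Qed.

Lemma lim_to_closed2 V W (A : set (V * W)) (u : nat -> V) (v : nat -> W) x y :
  closed A -> lim_to u x -> lim_to v y -> (forall n, A (u n, v n)) -> A (x, y).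
Proof.
move=> cA hu hv uA; apply: cA; apply/closure_rnorm2 => e e0.
have [N hN] := hu _ e0; have [M hM] := hv _ e0.
exists (u (maxn N M)), (v (maxn N M)); split => //.
  exact/hN/leq_maxl.
exact/hM/leq_maxr.
Qed.

Lemma closure_lim2 V W (A : set (V * W)) x y :
  closure A (x, y) ->
  exists u v, [/\ forall n, A (u n, v n), lim_to u x & lim_to v y].
Proof.
move=> /closure_rnorm2 h.
have /choice[w hw] n : exists w : V * W,
    [/\ A w, rnorm (x - w.1) < n.+1%:R^-1 & rnorm (y - w.2) < n.+1%:R^-1].
  have n0 : (0 : R) < n.+1%:R^-1 by rewrite invr_gt0 ltr0n.
  by have [u [v [? ? ?]]] := h _ n0; exists (u, v).
exists (fun n => (w n).1), (fun n => (w n).2); split=> [n|e e0|e e0].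
- by have [] := hw n; case: (w n).
- have [N hN] := small_invn e0; exists N => n /hN; apply: lt_trans.
  by have [] := hw n.
- have [N hN] := small_invn e0; exists N => n /hN; apply: lt_trans.
  by have [] := hw n.
Qed.

(* The values come in pairs so that [x] and [T x] are obtained together when
   [(1 + T^* T) x = w] is solved for a closed [T]. *)
Lemma total_of_dense (V : normedModType R[i]) (W W' : completeNormedModType R[i])
    (D : V -> W -> W' -> Prop) (C : R) :
  (forall x y z x' y' z', D x y z -> D x' y' z' ->
     D (x - x') (y - y') (z - z')) ->
  (forall x y z, D x y z -> rnorm y <= C * rnorm x /\ rnorm z <= C * rnorm x) ->
  dense [set x | exists y z, D x y z] ->
  forall x, exists y z u v w, [/\ lim_to u x, lim_to v y, lim_to w z &
    forall n, D (u n) (v n) (w n)].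
Proof.
move=> DB DC dD x.
have /closure_lim[u [Du ux]] : closure [set x | exists y z, D x y z] x.
  by apply/closure_rnorm; have /dense_rnorm := dD; apply.
have /choice[vw hvw] n : exists vw : W * W', D (u n) vw.1 vw.2.
  by have [v [w ?]] := Du n; exists (v, w).
have C0 : 0 < `|C| + 1 by rewrite ltr_wpDl.
have cau (X : normedModType R[i]) (s : nat -> X) :
    (forall m n, rnorm (s m - s n) <= C * rnorm (u m - u n)) ->
    forall e : R, 0 < e -> exists N, forall m n, (N <= m)%N -> (N <= n)%N ->
     rnorm (s m - s n) < e.
  move=> hs e e0; have e2 : 0 < e / (`|C| + 1) / 2 by rewrite !divr_gt0.
  have [N hN] := ux _ e2; exists N => m n /hN hm /hN hn.
  rewrite (le_lt_trans (hs _ _))//.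
  rewrite (@le_lt_trans _ _ ((`|C| + 1) * rnorm (u m - u n)))//.
    by rewrite ler_wpM2r ?rnorm_ge0// (le_trans (ler_norm _))// lerDl.
  rewrite mulrC -ltr_pdivlMr// (le_lt_trans (rnorm_tri _ x _))//.
  by rewrite rnormBC; move: hm hn; lra.
have [y vy] : exists l, lim_to (fun n => (vw n).1) l.
  apply/complete_rnorm/cau => m n.
  by have [] := DC _ _ _ (DB _ _ _ _ _ _ (hvw m) (hvw n)).
have [z wz] : exists l, lim_to (fun n => (vw n).2) l.
  apply/complete_rnorm/cau => m n.
  by have [] := DC _ _ _ (DB _ _ _ _ _ _ (hvw m) (hvw n)).
by exists y, z, u, (fun n => (vw n).1), (fun n => (vw n).2); split.
Qed.

End LimitAlgebra.

(** * Hilbert spaces and rank-one compact operators *)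

Section HilbertSpace.
Context (R : realType) (H : hilbertType R).
Implicit Types (h k l : H) (a b : compop H).

Lemma hdotDl h k l : hdot (h + k) l = hdot h l + hdot k l.
Proof. by rewrite linearDl. Qed.

Lemma hdotZl (c : R[i]) h l : hdot (c *: h) l = c * hdot h l.
Proof. by rewrite linearZl_LR. Qed.

Lemma hdotC h k : hdot h k = (hdot k h)^*%R.
Proof. by rewrite hermitian_subproof expr0 mul1r. Qed.

Lemma hdotDr h k l : hdot l (h + k) = hdot l h + hdot l k.
Proof. by rewrite linearDr. Qed.

Lemma hdotZr (c : R[i]) h l : hdot l (c *: h) = c^*%R * hdot l h.
Proof. by rewrite hdotC hdotZl rmorphM /= -hdotC. Qed.

Lemma hdotBl h k l : hdot (h - k) l = hdot h l - hdot k l.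
Proof. by rewrite hdotDl -scaleN1r hdotZl mulN1r. Qed.

Lemma hdot0l k : hdot 0 k = 0.
Proof. by rewrite -(scale0r (0 : H)) hdotZl mul0r. Qed.

Lemma hdot0r k : hdot k 0 = 0.
Proof. by rewrite hdotC hdot0l rmorph0. Qed.

Lemma hdot_ge0 h : 0 <= hdot h h.
Proof. by rewrite -hdot_norm exprn_ge0. Qed.

Lemma hdot_rnorm h : hdot h h = (rnorm h ^+ 2)%:C.
Proof. by rewrite -hdot_norm -rnormE rmorphXn. Qed.

Lemma hdot_cs h k : `|hdot h k| <= `|h| * `|k|.
Proof.
rewrite -(@ler_pXn2r _ 2)// ?nnegrE ?mulr_ge0// exprMn !hdot_norm.
exact: (psd_cauchy_schwarz hdotDl hdotZl hdotC hdot_ge0).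
Qed.

Lemma hdot_eq0 h : hdot h h = 0 -> h = 0.
Proof.
by rewrite -hdot_norm => /eqP; rewrite expf_eq0 /= normr_eq0 => /eqP.
Qed.

Lemma compopD a b h : (a + b) h = a h + b h. Proof. by []. Qed.
Lemma compopZ (c : R[i]) a h : (c *: a) h = c *: a h. Proof. by []. Qed.
Lemma compopN a h : (- a) h = - a h. Proof. by []. Qed.
Lemma compop0 h : (0 : compop H) h = 0. Proof. by []. Qed.
Lemma kcompE a b h : kcomp a b h = a (b h). Proof. by []. Qed.

Lemma compop_0 a : a 0 = 0.
Proof.
by have := compop_linear a (-1) 0 0; rewrite scaleN1r addNr scaleN1r addNr.
Qed.

Lemma compop_Dr a h k : a (h + k) = a h + a k.
Proof. by have := compop_linear a 1 h k; rewrite !scale1r. Qed.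

Lemma compop_Zr a (c : R[i]) h : a (c *: h) = c *: a h.
Proof. by have := compop_linear a c h 0; rewrite compop_0 !addr0. Qed.

Lemma compopP a b : (forall h, a h = b h) -> a = b.
Proof. by move=> ab; apply: val_inj; apply: funext. Qed.

Lemma compop_form_le_opnorm a (M : R) h :
  (opnorm (@rnorm R H) (@rnorm R H) a <= M%:E)%E ->
  complex.Re (hdot (a h) h) <= M * rnorm h ^+ 2.
Proof.
move=> aM; have [h0|h0] := eqVneq (rnorm h) 0.
  by rewrite (rnorm_eq0 h0) hdot0r rnorm0 expr0n mulr0.
have hp : 0 < rnorm h by rewrite lt0r h0 rnorm_ge0.
have : rnorm (a ((rnorm h)^-1%:C *: h)) <= M.
  rewrite -lee_fin (le_trans _ aM)//; apply: ereal_sup_ubound.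
  exists ((rnorm h)^-1%:C *: h) => //=.
  by rewrite rnormZ ?mulVf// invr_ge0 ltW.
rewrite compop_Zr rnormZ ?invr_ge0 ?(ltW hp)// ler_pdivrMl// => ah.
rewrite (le_trans (Re_le_norm _))// -lecR RRe_real ?normr_real//.
rewrite (le_trans (hdot_cs _ _))// -!rnormE -rmorphM lecR expr2 mulrA.
by rewrite ler_wpM2r ?rnorm_ge0// [M * _]mulrC.
Qed.

(** Cauchy-Schwarz for the semi-inner product [hdot (a h) k], tested at the normalized vector
    [k = a h], bounds [|a h|^2] by a product of two values of the quadratic form. Norms of positive
    operators can therefore be read off from their forms. *)
Lemma opnorm_psd_le a (M : R) : 0 <= M ->
  (forall h k, hdot (a h) k = hdot h (a k)) -> (forall h, 0 <= hdot (a h) h) ->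
  (forall h, rnorm h <= 1 -> complex.Re (hdot (a h) h) <= M) ->
  (opnorm (@rnorm R H) (@rnorm R H) a <= M%:E)%E.
Proof.
move=> M0 aC a0 aM.
have reE h : (complex.Re (hdot (a h) h))%:C = hdot (a h) h.
  by rewrite RRe_real// ger0_real.
apply: ge_ereal_sup => _ [h /= h1 <-]; rewrite lee_fin.
set k := a h; have [->|k0] := eqVneq (rnorm k) 0; first by [].
have kp : 0 < rnorm k by rewrite lt0r k0 rnorm_ge0.
pose l := (rnorm k)^-1%:C *: k.
have l1 : rnorm l <= 1 by rewrite /l rnormZ ?invr_ge0 ?(ltW kp)// mulVf.
have kl : hdot k l = (rnorm k)%:C.
  rewrite hdotC hdotZl hdot_rnorm -rmorphM /=.
  have -> : (rnorm k)^-1 * rnorm k ^+ 2 = rnorm k by field; exact: k0.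
  by rewrite conj_Creal// ger0_real// ler0c ltW.
have : `|hdot (a h) l| ^+ 2 <= hdot (a h) h * hdot (a l) l.
  apply: (@psd_cauchy_schwarz _ _ (fun h k => hdot (a h) k)) => //=.
  - by move=> x y z; rewrite compop_Dr hdotDl.
  - by move=> c x z; rewrite compop_Zr hdotZl.
  - by move=> x y; rewrite hdotC aC.
rewrite -/k kl ger0_norm ?ler0c ?(ltW kp)// -[hdot (a l) l]reE -[hdot k h](reE h).
rewrite -rmorphXn -rmorphM /= lecR => hk.
rewrite -(@ler_pXn2r _ 2)// ?nnegrE ?(ltW kp)//.
rewrite (le_trans hk)// expr2 ler_pM ?aM//.
  by rewrite -ler0c reE.
by rewrite -ler0c reE.
Qed.

Definition theta_fun h k : H -> H := fun l => hdot l k *: h.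

Lemma theta_compact h k : theta_fun h k \in @compact_operator R H.
Proof.
apply/compact_operatorP; split=> [c x y|].
  by rewrite /theta_fun hdotDl hdotZl scalerDl scalerA.
have cts (l : H) : continuous (fun s : R => s%:C *: l).
  move=> s B /nbhs_rnorm[e e0 eB]; apply/nbhs_ballP.
  have l0 : 0 < rnorm l + 1 by rewrite ltr_wpDl// rnorm_ge0.
  exists (e / (rnorm l + 1)) => /=; first by rewrite divr_gt0.
  move=> t; rewrite -ball_normE /= ltr_pdivlMr// => st; apply: eB.
  rewrite -scalerBl -rmorphB /= rnormZC (le_lt_trans _ st)//.
  rewrite (_ : complex.Re `|(s - t)%:C| = `|s - t|).
    by rewrite ler_wpM2l// lerDl.
  by rewrite normc_def /= expr0n addr0 sqrtr_sqr.
pose M := rnorm k.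
(* The coefficient [hdot l k] has real and imaginary part in [[- M, M]], so the image of the ball
   lies in a continuous image of a compact square. *)
apply: (@precompact_subset _ _
  ((fun z : R * R => z.1%:C *: h + z.2%:C *: ('i *: h)) @`
     (`[- M, M] `*` `[- M, M]))).
  move=> _ [l /= l1 <-]; rewrite /theta_fun.
  have : `|hdot l k| <= M%:C.
    by rewrite (le_trans (hdot_cs _ _))// rnormE ler_piMl.
  rewrite normc_def lecR; case: (hdot l k) => a b /= abM.
  have aM : `|a| <= M.
    by rewrite (le_trans _ abM)// -sqrtr_sqr ler_wsqrtr// lerDl sqr_ge0.
  have bM : `|b| <= M.
    by rewrite (le_trans _ abM)// -sqrtr_sqr ler_wsqrtr// lerDr sqr_ge0.
  exists (a, b) => /=; first by rewrite !in_itv /= -!ler_norml.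
  by rewrite scalerA -scalerDl; congr (_ *: _); simpc.
apply: compact_precompact; first exact: norm_hausdorff.
apply: continuous_compact; last by apply: compact_setX; exact: segment_compact.
apply: continuous_subspaceT => z; apply: cvgD.
  apply: (@continuous_comp _ _ _ fst (fun s : R => s%:C *: h)).
    exact: cvg_fst.
  exact: cts.
apply: (@continuous_comp _ _ _ snd (fun s : R => s%:C *: ('i *: h))).
  exact: cvg_snd.
exact: cts.
Qed.

Definition theta h k : compop H := Compop (theta_compact h k).

Lemma thetaE h k l : theta h k l = hdot l k *: h. Proof. by []. Qed.

End HilbertSpace.

(** * Inner products of Hilbert modules *)

Section Module.
Context (R : realType) (H : hilbertType R) (E : hilbertModType H).
Implicit Types (x y z : E) (h k : H) (a b : compop H).

Lemma Re_normE (z : R[i]) : (complex.Re `|z|)%:C = `|z|.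
Proof. by rewrite RRe_real// normr_real. Qed.

Lemma hdot_ext (h k : H) : (forall l, hdot h l = hdot k l) -> h = k.
Proof.
move=> hk; apply/eqP; rewrite -subr_eq0; apply/eqP/hdot_eq0.
by rewrite hdotBl hk subrr.
Qed.

Lemma kinnerDr x y z : kinner x (y + z) = kinner x y + kinner x z :> compop H.
Proof.
apply: compopP => h; apply: hdot_ext => k.
by rewrite kinnerC kinnerDl !compopD hdotDr hdotDl -!kinnerC.
Qed.

Lemma kinnerZr (c : R[i]) x y :
  kinner x (c *: y) = c^*%R *: kinner x y :> compop H.
Proof.
apply: compopP => h; apply: hdot_ext => k.
by rewrite kinnerC kinnerZl !compopZ hdotZr hdotZl -!kinnerC.
Qed.

Lemma kinner0l x : kinner 0 x = 0 :> compop H.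
Proof. by rewrite -(scale0r (0 : E)) kinnerZl scale0r. Qed.

Lemma kinnerNl x y : kinner (- x) y = - kinner x y :> compop H.
Proof. by rewrite -scaleN1r kinnerZl scaleN1r. Qed.

Lemma kinnerNr x y : kinner x (- y) = - kinner x y :> compop H.
Proof. by rewrite -scaleN1r kinnerZr rmorphN1 scaleN1r. Qed.

Lemma kinner0r x : kinner x 0 = 0 :> compop H.
Proof. by rewrite -(scale0r (0 : E)) kinnerZr rmorph0 scale0r. Qed.

Lemma kinnerBl x y z : kinner (x - y) z = kinner x z - kinner y z :> compop H.
Proof. by rewrite kinnerDl kinnerNl. Qed.

Lemma kinnerBr x y z : kinner x (y - z) = kinner x y - kinner x z :> compop H.
Proof. by rewrite kinnerDr kinnerNr. Qed.

Lemma kinner_swap0 x y : kinner x y = 0 :> compop H -> kinner y x = 0 :> compop H.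
Proof.
move=> xy; apply: compopP => h; apply: hdot_ext => k.
by rewrite kinnerC xy !compop0 hdot0l hdot0r.
Qed.

Lemma kact0 x : kact (0 : compop H) x = 0.
Proof. by rewrite -(scale0r (0 : compop H)) kactZl scale0r. Qed.

Lemma kactr0 a : kact a (0 : E) = 0.
Proof. by rewrite -(scale0r (0 : E)) kactZr !scale0r. Qed.

Lemma kactNr a x : kact a (- x) = - kact a x.
Proof. by rewrite -scaleN1r kactZr scaleN1r. Qed.

Lemma kactBr a x y : kact a (x - y) = kact a x - kact a y.
Proof. by rewrite kactDr kactNr. Qed.

Lemma kinner_eq0 x : kinner x x = 0 :> compop H -> x = 0.
Proof.
move=> x0; apply: rnorm_eq0; apply/eqP; rewrite -sqrf_eq0 eq_le sqr_ge0 andbT.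
rewrite -lee_fin -(kinner_norm x) x0; apply: ge_ereal_sup => _ [h _ <-].
by rewrite rnorm0.
Qed.

Lemma kinner_ext x y :
  (forall z, kinner x z = kinner y z :> compop H) -> x = y.
Proof.
move=> xy; apply/eqP; rewrite -subr_eq0; apply/eqP/kinner_eq0.
by rewrite kinnerBl xy subrr.
Qed.

(* The norm of [x] is the supremum of [sn h x] over the unit ball of [H], so
   that estimates can be made in each of these semi-inner products. *)
Definition form h x y : R[i] := hdot ((kinner x y : compop H) h) h.

Definition qf h x : R := complex.Re (form h x x).

Definition sn h x : R := Num.sqrt (qf h x).

Lemma formDl h x y z : form h (x + y) z = form h x z + form h y z.
Proof. by rewrite /form kinnerDl hdotDl. Qed.

Lemma formZl h (c : R[i]) x z : form h (c *: x) z = c * form h x z.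
Proof. by rewrite /form kinnerZl hdotZl. Qed.

Lemma formC h x y : form h x y = (form h y x)^*%R.
Proof. by rewrite /form -hdotC kinnerC. Qed.

Lemma formDr h x y z : form h z (x + y) = form h z x + form h z y.
Proof. by rewrite /form kinnerDr hdotDl. Qed.

Lemma formZr h (c : R[i]) x z : form h z (c *: x) = c^*%R * form h z x.
Proof. by rewrite /form kinnerZr hdotZl. Qed.

Lemma formNl h x z : form h (- x) z = - form h x z.
Proof. by rewrite -scaleN1r formZl mulN1r. Qed.

Lemma formNr h x z : form h z (- x) = - form h z x.
Proof. by rewrite formC formNl rmorphN /= -formC. Qed.

Lemma form0l h z : form h 0 z = 0.
Proof. by rewrite /form kinner0l hdot0l. Qed.

Lemma form_ge0 h x : 0 <= form h x x.
Proof. exact: kinner_ge0. Qed.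

Lemma qfE h x : (qf h x)%:C = form h x x.
Proof. by rewrite /qf RRe_real// ger0_real// form_ge0. Qed.

Lemma qf_ge0 h x : 0 <= qf h x.
Proof. by rewrite -ler0c qfE form_ge0. Qed.

Lemma sn_ge0 h x : 0 <= sn h x.
Proof. exact: sqrtr_ge0. Qed.

Lemma sn_sqr h x : sn h x ^+ 2 = qf h x.
Proof. by rewrite sqr_sqrtr// qf_ge0. Qed.

Lemma form_cs2 h x y : `|form h x y| ^+ 2 <= form h x x * form h y y.
Proof.
exact: (psd_cauchy_schwarz (formDl h) (formZl h) (formC h) (form_ge0 h)).
Qed.

Lemma form_cs h x y : complex.Re `|form h x y| <= sn h x * sn h y.
Proof.
have := form_cs2 h x y; rewrite -[ `|_|]Re_normE -!qfE -rmorphXn -rmorphM lecR.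
move=> xy; rewrite -(@ler_pXn2r _ 2)// ?nnegrE ?mulr_ge0 ?sn_ge0//.
  by rewrite exprMn !sn_sqr.
by rewrite -ler0c Re_normE.
Qed.

Lemma Re_form_cs h x y : complex.Re (form h x y) <= sn h x * sn h y.
Proof. by rewrite (le_trans (Re_le_norm _))// form_cs. Qed.

Lemma Re_formC h x y : complex.Re (form h x y) = complex.Re (form h y x).
Proof. by rewrite formC ReJ. Qed.

Lemma qfD h x y :
  qf h (x + y) = qf h x + qf h y + 2 * complex.Re (form h x y).
Proof.
rewrite /qf formDl !formDr !ReD (Re_formC h y x) mulr2n mulrDl !mul1r.
by ring.
Qed.

Lemma qfN h x : qf h (- x) = qf h x.
Proof. by rewrite /qf formNl formNr opprK. Qed.

Lemma qfZ h (c : R) x : qf h (c%:C *: x) = c ^+ 2 * qf h x.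
Proof.
rewrite /qf formZl formZr conj_Creal; last by rewrite complex_real.
by rewrite !ReZ expr2 mulrA.
Qed.

Lemma qfB h x y :
  qf h (x - y) = qf h x + qf h y - 2 * complex.Re (form h x y).
Proof. by rewrite qfD qfN formNr ReN mulrN. Qed.

Lemma snD h x y : sn h (x + y) <= sn h x + sn h y.
Proof.
rewrite -(@ler_pXn2r _ 2)// ?nnegrE ?addr_ge0 ?sn_ge0// sn_sqr qfD sqrrD !sn_sqr.
by have := Re_form_cs h x y; rewrite -mulr_natl; lra.
Qed.

Lemma snN h x : sn h (- x) = sn h x.
Proof. by rewrite /sn qfN. Qed.

Lemma snZ h (c : R) x : sn h (c%:C *: x) = `|c| * sn h x.
Proof. by rewrite /sn qfZ sqrtrM ?sqr_ge0// sqrtr_sqr. Qed.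

Lemma sn0 h : sn h 0 = 0.
Proof. by rewrite /sn /qf form0l sqrtr0. Qed.

Lemma sn_le h x (M : R) : 0 <= M -> qf h x <= M ^+ 2 -> sn h x <= M.
Proof. by move=> M0 xM; rewrite -(@ler_pXn2r _ 2)// ?nnegrE ?sn_ge0// sn_sqr. Qed.

Lemma qf_le_rnorm h x : qf h x <= rnorm x ^+ 2 * rnorm h ^+ 2.
Proof. by apply: compop_form_le_opnorm; rewrite kinner_norm. Qed.

Lemma sn_le_rnorm h x : sn h x <= rnorm x * rnorm h.
Proof.
by rewrite sn_le ?mulr_ge0 ?rnorm_ge0// exprMn qf_le_rnorm.
Qed.

Lemma sn_le_rnorm1 h x : rnorm h <= 1 -> sn h x <= rnorm x.
Proof.
by move=> h1; rewrite (le_trans (sn_le_rnorm _ _))// ler_piMr// rnorm_ge0.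
Qed.

Lemma rnorm_le_sn x (M : R) : 0 <= M ->
  (forall h, rnorm h <= 1 -> sn h x <= M) -> rnorm x <= M.
Proof.
move=> M0 xM; rewrite -(@ler_pXn2r _ 2)// ?nnegrE ?rnorm_ge0//.
rewrite -lee_fin -kinner_norm; apply: opnorm_psd_le.
- exact: exprn_ge0.
- by move=> h k; rewrite kinnerC.
- exact: kinner_ge0.
move=> h /xM; rewrite -/(form h x x) -/(qf h x) -sn_sqr.
by move=> xh; rewrite ler_pXn2r// ?nnegrE ?sn_ge0.
Qed.

Lemma rnorm_le_sn_mul x y (C : R) : 0 <= C ->
  (forall h, sn h x <= C * sn h y) -> rnorm x <= C * rnorm y.
Proof.
move=> C0 xy; apply: rnorm_le_sn => [|h h1]; first by rewrite mulr_ge0 ?rnorm_ge0.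
by rewrite (le_trans (xy h))// ler_wpM2l// sn_le_rnorm1.
Qed.

Lemma rnorm_ge_sn_mul x y (C : R) : 0 <= C ->
  (forall h, C * sn h x <= sn h y) -> C * rnorm x <= rnorm y.
Proof.
move=> C0 xy; rewrite -[C in C * _](ger0_norm C0) -(ger0_norm (rnorm_ge0 x)).
rewrite -normrM ger0_norm ?mulr_ge0 ?rnorm_ge0// -rnormZ//.
apply: rnorm_le_sn => [|h h1]; first exact: rnorm_ge0.
by rewrite snZ ger0_norm// (le_trans (xy h))// sn_le_rnorm1.
Qed.

Lemma sn_eq0 x : (forall h, sn h x = 0) -> x = 0.
Proof.
move=> x0; apply: rnorm_eq0; apply/eqP; rewrite eq_le rnorm_ge0 andbT.
by apply: rnorm_le_sn => // h _; rewrite x0.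
Qed.

Lemma form_kinner h x y z w : kinner x y = kinner z w :> compop H ->
  form h x y = form h z w.
Proof. by rewrite /form => ->. Qed.

Lemma qf_perp h x y : kinner x y = 0 :> compop H -> qf h (x + y) = qf h x + qf h y.
Proof. by move=> xy; rewrite qfD /form xy hdot0l mulr0 addr0. Qed.

Lemma rnorm_perp x y : kinner x y = 0 :> compop H -> rnorm x <= rnorm (x + y).
Proof.
move=> xy; rewrite -[leRHS]mul1r; apply: rnorm_le_sn_mul => // h.
by rewrite mul1r ler_sqrt ?qf_ge0// qf_perp// lerDl qf_ge0.
Qed.

(** The second variable sees adjoints, and [theta k h] is the adjoint of [theta h k]. *)
Lemma kinner_thetar x y h k :
  kinner x (kact (theta h k) y) = kcomp (kinner x y) (theta k h) :> compop H.
Proof.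
apply: compopP => l; apply: hdot_ext => m.
rewrite kinnerC kinner_act !kcompE !thetaE compop_Zr hdotZl hdotZr kinnerC.
by rewrite -hdotC mulrC.
Qed.

End Module.

(** * Reduction to a Hilbert space by a rank-one projection *)

Section UnitVector.
Context (R : realType) (H : hilbertType R) (E : hilbertModType H).
Context (e : H) (e1 : rnorm e = 1).
Implicit Types (x y z : E) (h k : H) (a b : compop H).

Lemma hdot_e : hdot e e = 1.
Proof. by rewrite hdot_rnorm e1 expr1n. Qed.

(** Acting by [theta e h] carries the form of [h] to the form of the fixed vector [e], so that one
    semi-inner product sees all the others. *)
Lemma form_theta x y h k :
  form e (kact (theta e k) x) (kact (theta e h) y) = hdot ((kinner x y : compop H) h) k.
Proof.
rewrite /form kinner_act kinner_thetar !kcompE !thetaE hdot_e scale1r hdotZl.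
by rewrite hdot_e mulr1.
Qed.

Lemma qf_theta x h : qf e (kact (theta e h) x) = qf h x.
Proof. by rewrite /qf form_theta. Qed.

Lemma kinner_cs x y h k :
  complex.Re `|hdot ((kinner x y : compop H) h) k| <= sn k x * sn h y.
Proof. by rewrite -form_theta (le_trans (form_cs _ _ _))// /sn !qf_theta. Qed.

Lemma kinner_le x y h :
  rnorm ((kinner x y : compop H) h) <= rnorm x * (rnorm y * rnorm h).
Proof.
set k := _ h; have [->|k0] := eqVneq (rnorm k) 0.
  by rewrite !mulr_ge0 ?rnorm_ge0.
have kp : 0 < rnorm k by rewrite lt0r k0 rnorm_ge0.
rewrite -(ler_pM2r kp) -expr2.
have := kinner_cs x y h k; rewrite -/k hdot_rnorm ger0_norm; last first.
  by rewrite ler0c sqr_ge0.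
move=> /= hk; rewrite (le_trans hk)// [rnorm x * _]mulrC -mulrA.
by rewrite mulrC ler_pM ?sn_ge0 ?sn_le_rnorm.
Qed.

Lemma theta_eq0 x : (forall h, kact (theta e h) x = 0) -> x = 0.
Proof.
by move=> x0; apply: sn_eq0 => h; rewrite /sn -qf_theta x0 /qf form0l sqrtr0.
Qed.

(* The range of the rank-one projection [theta e e] is a Hilbert space for
   [form e], on which the norms agree, and it generates [E]. *)
Definition ran_e x : Prop := kact (theta e e) x = x.

Lemma theta_theta h k l m :
  kcomp (theta h k) (theta l m) = hdot l k *: theta h m.
Proof.
apply: compopP => z; rewrite kcompE compopZ !thetaE hdotZl.
by rewrite scalerA mulrC.
Qed.

Lemma ran_e_theta h x : ran_e (kact (theta e h) x).
Proof. by rewrite /ran_e -kactM theta_theta hdot_e scale1r. Qed.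

Lemma kinner_ran_e x y : ran_e x -> ran_e y ->
  kinner x y = form e x y *: theta e e :> compop H.
Proof.
move=> ex ey; apply: compopP => h.
rewrite compopZ thetaE /form -{1}ex -{1}ey.
rewrite kinner_act kinner_thetar !kcompE !thetaE compop_Zr hdotZl.
by rewrite scalerA mulrC.
Qed.

Lemma rnorm_ran_e x : ran_e x -> rnorm x = sn e x.
Proof.
move=> ex; apply/eqP; rewrite eq_le sn_le_rnorm1 ?e1// andbT.
apply: rnorm_le_sn => [|h h1]; first exact: sn_ge0.
apply: sn_le; first exact: sn_ge0.
rewrite sn_sqr /qf {1}/form (kinner_ran_e ex ex) compopZ thetaE !hdotZl -qfE ReZ.
rewrite -[leRHS]mulr1 ler_wpM2l ?qf_ge0// (hdotC e) -normCK.
rewrite (le_trans (Re_le_norm _))// -lecR RRe_real ?normr_real//.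
rewrite ger0_norm ?exprn_ge0// expr_le1// (le_trans (hdot_cs _ _))//.
by rewrite -!rnormE e1 mulr1 lecR.
Qed.

End UnitVector.

(** * Orthogonal complements of closed submodules *)

Section FiniteApproximation.
Context (R : realType) (H : hilbertType R) (E : hilbertModType H).
Implicit Types (x y z : E) (h k : H) (s : seq H).

Definition hproj s h : H := \sum_(v <- s) hdot h v *: v.

Definition eproj s x : E := \sum_(v <- s) kact (theta v v) x.

Lemma hproj_cons v s h : hproj (v :: s) h = hdot h v *: v + hproj s h.
Proof. by rewrite /hproj big_cons. Qed.

Lemma hprojB s h k : hproj s (h - k) = hproj s h - hproj s k.
Proof.
elim: s => [|v s IH]; first by rewrite /hproj !big_nil subrr.
by rewrite !hproj_cons IH hdotBl scalerBl opprD addrACA.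
Qed.

Lemma exists_hproj (ys : seq H) : exists s,
  (forall h k, hdot (h - hproj s h) (hproj s k) = 0) /\
  (forall h, h \in ys -> hproj s h = h).
Proof.
elim: ys => [|y ys [s [sP sy]]].
  by exists [::]; split=> // h k; rewrite /hproj !big_nil hdot0r.
have [yy|ny] := eqVneq (hproj s y) y.
  by exists s; split=> // z; rewrite inE => /predU1P[->//|/sy].
pose w := y - hproj s y; pose r := rnorm w.
have r0 : 0 < r.
  rewrite lt0r rnorm_ge0 andbT; apply: contraNneq ny => /rnorm_eq0/eqP.
  by rewrite subr_eq0 eq_sym.
pose v := r^-1%:C *: w.
have vv : hdot v v = 1.
  rewrite hdot_rnorm rnormZ ?invr_ge0 ?(ltW r0)// -/r mulVf ?gt_eqF//.
  by rewrite expr1n.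
have vs k : hdot v (hproj s k) = 0 by rewrite hdotZl sP mulr0.
have sv k : hdot (hproj s k) v = 0 by rewrite hdotC vs rmorph0.
have rv : r%:C *: v = y - hproj s y.
  by rewrite scalerA -rmorphM /= mulfV ?gt_eqF// scale1r.
clearbody v.
exists (v :: s); split=> [h k|z].
  have hk : hdot h (hproj s k) = hdot (hproj s h) (hproj s k).
    by apply/eqP; rewrite -subr_eq0 -hdotBl sP.
  rewrite !hproj_cons !(hdotBl, hdotDl, hdotDr, hdotZl, hdotZr) vv vs sv hk.
  by ring.
rewrite inE hproj_cons => /predU1P[->|/sy zz]; last first.
  by rewrite -{1}zz sv scale0r add0r.
have -> : hdot y v = r%:C.
  by rewrite -[y in LHS](subrK (hproj s y)) -rv hdotDl sv hdotZl vv mulr1 addr0.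
by rewrite rv subrK.
Qed.

(** Pythagoras for the decomposition of [h] into its projection and the remainder. *)
Lemma hproj_contr s : (forall h k, hdot (h - hproj s h) (hproj s k) = 0) ->
  forall h, rnorm (h - hproj s h) <= rnorm h.
Proof.
move=> sP h; rewrite -(@ler_pXn2r _ 2)// ?nnegrE ?rnorm_ge0//.
rewrite -lecR -!hdot_rnorm; set w := h - hproj s h.
have wh : hdot w (hproj s h) = 0 by exact: sP.
have hw : w + hproj s h = h by rewrite subrK.
clearbody w; rewrite -{1 2}hw.
rewrite hdotDl !hdotDr [hdot (hproj s h) w]hdotC wh rmorph0 add0r addr0.
by rewrite lerDl hdot_ge0.
Qed.

Lemma kinner_eproj s x z h :
  (kinner (eproj s x) z : compop H) h = hproj s ((kinner x z : compop H) h).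
Proof.
rewrite /eproj /hproj; elim: s => [|v s IH].
  by rewrite !big_nil kinner0l.
by rewrite !big_cons kinnerDl kinner_act compopD IH kcompE thetaE.
Qed.

Lemma kinner_eprojr s x z h :
  (kinner z (eproj s x) : compop H) h = (kinner z x : compop H) (hproj s h).
Proof.
rewrite /eproj /hproj; elim: s => [|v s IH].
  by rewrite !big_nil kinner0r compop_0.
rewrite !big_cons kinnerDr kinner_thetar compopD IH kcompE thetaE.
by rewrite compop_Dr compop_Zr.
Qed.

Lemma finite_net (A : set H) (d : R) : precompact A -> 0 < d ->
  exists ys : seq H, forall h, A h -> exists2 k, k \in ys & rnorm (h - k) < d.
Proof.
move=> [B AB [cB _]] d0; move: cB; rewrite compact_cover => cB.
have [|h Bh|D' _ BD] := cB H setT (fun y : H => [set z | rnorm (y - z) < d]).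
- move=> y _; rewrite openE => z /= yz; apply/nbhs_rnorm.
  exists (d - rnorm (y - z)); first by rewrite subr_gt0.
  move=> w zw /=; rewrite (le_lt_trans (rnorm_tri _ z _))//.
  by rewrite addrC -ltrBrDr.
- by exists h => //=; rewrite subrr rnorm0.
exists (enum_fset D') => h /AB/BD [y /= yD yh].
by exists y => //; rewrite rnormBC.
Qed.

(** For a projection [P], the inner square of [x - P x] is [(1 - P) k (1 - P)] with [k] the inner
    square of [x]. As [k] is compact, it suffices that [P] fixes a finite net of the image of the
    unit ball under [k]. *)
Lemma eproj_dense x (d : R) : 0 < d -> exists s, rnorm (x - eproj s x) < d.
Proof.
move=> d0; pose k : compop H := kinner x x.
have /compact_operatorP[_ pk] := compop_compact k.
(* The form is the square of a norm, hence the scale [(d / 2)^2] of the net. *)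
have d2 : 0 < (d / 2) ^+ 2 by rewrite exprn_gt0// divr_gt0.
have [ys hys] := finite_net pk d2.
have [s [sP sy]] := exists_hproj ys; exists s.
rewrite (@le_lt_trans _ _ (d / 2))//; last by rewrite ltr_pdivrMr// mulr_natr mulr2n ltrDr.
apply: rnorm_le_sn => [|h h1]; first by rewrite divr_ge0 ?ltW.
apply: sn_le; first by rewrite divr_ge0 ?ltW.
pose h' := h - hproj s h.
have h'1 : rnorm h' <= 1 by rewrite (le_trans (hproj_contr sP _)).
have [y yys ky] : exists2 y : H, y \in ys & rnorm (k h' - y) < (d / 2) ^+ 2.
  by apply: hys; exists h' => //=; rewrite -rnorm_le1.
have kE : (kinner (x - eproj s x) (x - eproj s x) : compop H) h =
    (k h' - y) - hproj s (k h' - y).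
  rewrite kinnerBl compopD compopN kinner_eproj kinnerBr compopD compopN.
  rewrite kinner_eprojr -/k -[_ - k _](_ : k h' = _).
    by rewrite hprojB (sy _ yys) opprB subrKA.
  by rewrite /h' -scaleN1r compop_Dr compop_Zr scaleN1r.
rewrite /qf /form kE (le_trans (Re_le_norm _))// -lecR Re_normE.
rewrite (le_trans (hdot_cs _ _))// -!rnormE -rmorphM lecR.
rewrite (le_trans _ (ltW ky))// (le_trans _ (hproj_contr sP _))//.
by rewrite ler_piMr// rnorm_ge0.
Qed.

End FiniteApproximation.

Section Complement.
Context (R : realType) (H : hilbertType R) (E : hilbertModType H).
Implicit Types (x y z : E) (h k : H) (N : set E).

Definition ksubmod N :=
  [/\ N 0, forall x y, N x -> N y -> N (x + y),
      forall (c : R[i]) x, N x -> N (c *: x) &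
      forall (a : compop H) x, N x -> N (kact a x)].

Definition perp N x := forall m, N m -> kinner x m = 0 :> compop H.

Lemma qf_project h x y (t : R) :
  qf h (x - (form h x y * t%:C) *: y) =
  qf h x - (2 * t - t ^+ 2 * qf h y) * complex.Re `|form h x y| ^+ 2.
Proof.
rewrite qfB {2}/qf formZl !formZr -qfE.
case: (form h x y) => a b; rewrite normc_def /= sqr_sqrtr ?addr_ge0 ?sqr_ge0//.
rewrite !(mul0r, mulr0, subr0, addr0, oppr0).
by ring.
Qed.

Context (e : H) (e1 : rnorm e = 1).

Lemma form_theta_l x y : form e (kact (theta e e) x) y = form e x y.
Proof.
by rewrite /form kinner_act kcompE thetaE hdotZl (hdot_e e1) mulr1.
Qed.

Lemma lim_kinnerl (u : nat -> E) x y h : lim_to u x ->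
  lim_to (fun n => (kinner (u n) y : compop H) h) ((kinner x y : compop H) h).
Proof.
apply: (@lim_to_bounded _ _ _ (fun z => (kinner z y : compop H) h)
  (rnorm y * rnorm h)) => w z.
rewrite -compopN -compopD -kinnerBl [leRHS]mulrC.
exact: (kinner_le e1).
Qed.

Lemma lim_kinnerr (u : nat -> E) x y h : lim_to u x ->
  lim_to (fun n => (kinner y (u n) : compop H) h) ((kinner y x : compop H) h).
Proof.
apply: (@lim_to_bounded _ _ _ (fun z => (kinner y z : compop H) h)
  (rnorm y * rnorm h)) => w z.
rewrite -compopN -compopD -kinnerBr (le_trans (kinner_le e1 _ _ _))//.
by rewrite [X in _ * X]mulrC mulrA.
Qed.

(** A near-minimizer [n] of the distance from [x] to [N] is nearly orthogonal: subtracting a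
    multiple of [m] could lower [qf e (x - n)] by the square of the inner product divided by
    [qf e m], but less than [d^2] is left above the infimum. *)
Lemma near_projection N x (d : R) : ksubmod N -> 0 < d ->
  exists n, [/\ N n, ran_e e n & (ran_e e x -> forall m, N m -> ran_e e m ->
    complex.Re `|form e (x - n) m| <= d * sn e m)].
Proof.
move=> [N0 ND NZ NK] d0.
pose A : set R := [set qf e (x - n) | n in [set n | N n /\ ran_e e n]].
have A0 : has_inf A.
  split; last by exists 0 => _ [n _ <-]; exact: qf_ge0.
  by exists (qf e (x - 0)), 0 => //; split=> //; rewrite /ran_e kactr0.
have [_ [n [Nn en] <-] nA] := inf_adherent (exprn_gt0 2 d0) A0.
exists n; split=> // ex m Nm em.
have [m0|m0] := eqVneq (qf e m) 0.
  by rewrite (le_trans (form_cs _ _ _))// /sn m0 sqrtr0 !mulr0.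
have mp : 0 < qf e m by rewrite lt0r m0 qf_ge0.
(* The coefficient of the projection of [x - n] onto [m], which makes the competitor [n + c *: m]
   optimal in this direction. *)
pose c := form e (x - n) m * ((qf e m)^-1)%:C.
have : inf A <= qf e (x - n - c *: m).
  apply: ge_inf; first by exists 0 => _ [? _ <-]; exact: qf_ge0.
  exists (n + c *: m); last by rewrite opprD addrA.
  split; first by apply: ND => //; apply: NZ.
  by rewrite /ran_e kactDr kactZr en em.
rewrite qf_project.
have -> : 2 * (qf e m)^-1 - (qf e m)^-1 ^+ 2 * qf e m = (qf e m)^-1 by field.
set r := complex.Re _ => hr.
have r0 : 0 <= r by rewrite -ler0c Re_normE.
rewrite -(@ler_pXn2r _ 2)// ?nnegrE ?mulr_ge0 ?sn_ge0 ?(ltW d0)//.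
rewrite exprMn sn_sqr -ler_pdivrMr// mulrC.
by move: hr nA; lra.
Qed.

Lemma rank_one_projection N x : ksubmod N -> closed N -> ran_e e x ->
  exists2 n, N n & perp N (x - n).
Proof.
move=> sN cN ex; have [N0 ND NZ NK] := sN.
have /choice[u hu] (k : nat) : exists n, [/\ N n, ran_e e n &
    (ran_e e x -> forall m, N m -> ran_e e m ->
    complex.Re `|form e (x - n) m| <= k.+1%:R^-1 * sn e m)].
  by apply: near_projection => //; rewrite invr_gt0 ltr0n.
have u_ran (k l : nat) : N (u k - u l) /\ ran_e e (u k - u l).
  have [Nk ek _] := hu k; have [Nl el _] := hu l; split.
    by apply: ND => //; rewrite -scaleN1r; exact: NZ.
  by rewrite /ran_e kactBr ek el.
(* The difference [m] of two approximations lies in [N], and its square is a difference of two inner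
   products with [m], both small by construction. *)
have u_near (k l : nat) : rnorm (u k - u l) <= k.+1%:R^-1 + l.+1%:R^-1.
  have [Nm em] := u_ran k l; set m := u k - u l in Nm em *.
  rewrite (rnorm_ran_e e1 em); have [_ _ /(_ ex _ Nm em) hk] := hu k.
  have [_ _ /(_ ex _ Nm em) hl] := hu l.
  have [->|m0] := eqVneq (sn e m) 0; first by rewrite addr_ge0 ?invr_ge0 ?ler0n.
  have mp : 0 < sn e m by rewrite lt0r m0 sn_ge0.
  rewrite -(ler_pM2r mp) -expr2 sn_sqr mulrDl.
  have -> : qf e m = complex.Re (form e (x - u l) m) + complex.Re (- form e (x - u k) m).
    have mE : m = (x - u l) - (x - u k) by rewrite opprB addrC subrKA.
    by rewrite /qf {1}mE formDl formNl ReD.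
  rewrite addrC lerD// (le_trans (Re_le_norm _))// ?normrN//.
have [n nu] : exists n, lim_to u n.
  apply: complete_rnorm => d d0.
  have [K hK] := small_invn (divr_gt0 d0 (ltr0n _ 2)).
  exists K => k l /hK hk /hK hl; rewrite (le_lt_trans (u_near _ _))//.
  by rewrite [d]splitr ltrD.
have Nn : N n by apply: (lim_to_closed cN nu) => k; have [] := hu k.
have n_orth m : N m -> ran_e e m -> form e (x - n) m = 0.
  move=> Nm em; apply/eqP; rewrite -normr_eq0 -Re_normE; apply/eqP.
  congr (_%:C); apply/eqP; rewrite eq_le -[X in _ && X]ler0c Re_normE normr_ge0 andbT.
  apply/ler_addgt0Pr => d d0; rewrite add0r.
  have s0 : 0 < sn e m + 1 by rewrite ltr_wpDl// sn_ge0.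
  have d2 : 0 < d / (sn e m + 1) / 2 by rewrite !divr_gt0.
  have [K hK] := nu _ d2; have [L hL] := small_invn d2.
  have := hK _ (leq_maxl K L); have := hL _ (leq_maxr K L).
  move: (maxn K L) => k hk1 hk2; have [_ _ /(_ ex _ Nm em) hk] := hu k.
  have -> : x - n = (x - u k) - (n - u k) by rewrite opprB addrA subrK.
  rewrite formDl formNl.
  rewrite (@le_trans _ _ (complex.Re `|form e (x - u k) m| +
      complex.Re `|form e (n - u k) m|))//.
    by rewrite -lecR rmorphD /= !Re_normE (le_trans (ler_normB _ _)).
  have h3 := form_cs e (n - u k) m.
  have h4 : sn e (n - u k) <= rnorm (n - u k) by rewrite sn_le_rnorm1// e1.
  have d3 : d = (d / (sn e m + 1) / 2 + d / (sn e m + 1) / 2) * (sn e m + 1).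
    by field; rewrite gt_eqF.
  set D := d / _ / 2 in d2 hk1 hk2 d3; have s1 := sn_ge0 e m.
  rewrite d3 mulrDl lerD//.
    rewrite (le_trans hk)// ler_pM ?invr_ge0 ?ler0n ?lerDl// ltW//.
  rewrite (le_trans h3)// ler_pM ?sn_ge0 ?lerDl// (le_trans h4)// ltW//.
(* Cutting the limit down by [theta e e] keeps it in [N], and the remainder then lies in [ran_e e],
   where its inner products are decided by [form e]. *)
exists (kact (theta e e) n); first exact: NK.
move=> m Nm; apply: compopP => h; rewrite compop0.
have xn : ran_e e (x - kact (theta e e) n).
  by rewrite /ran_e kactBr ex (ran_e_theta e1).
rewrite -xn kinner_act kcompE thetaE.
suff -> : hdot ((kinner (x - kact (theta e e) n) m : compop H) h) e = 0.
  by rewrite scale0r.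
rewrite -(form_theta e1) form_theta_l formDl formNl form_theta_l -formNl -formDl.
by apply: n_orth; [exact: NK|exact: ran_e_theta].
Qed.

(** The decomposable vectors are stable under sums and under [K(H)]. Writing [theta v v] as
    [theta v e] times [theta e v] reduces each summand of [eproj] to the rank-one case, so these
    vectors are dense. The component in [N] depends contractively on [x], which allows the passage
    to the limit; the third entry of [D] is a dummy 0. *)
Lemma complement N x : ksubmod N -> closed N ->
  exists2 n, N n & perp N (x - n).
Proof.
move=> sN cN; have [N0 ND NZ NK] := sN; rename x into x0.
pose D u n (z : E) := [/\ N n, perp N (u - n) & z = 0].
have DA x y z x' y' z' : D x y z -> D x' y' z' -> D (x + x') (y + y') (z + z').
  move=> [Ny py ->] [Ny' py' ->]; split; first exact: ND.
    by move=> m Nm; rewrite opprD addrACA kinnerDl py// py'// addr0.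
  by rewrite addr0.
have DN x y z : D x y z -> D (- x) (- y) (- z).
  move=> [Ny py ->]; split; first by rewrite -scaleN1r; exact: NZ.
    by move=> m Nm; rewrite -opprD kinnerNl py// oppr0.
  by rewrite oppr0.
have DK a x y z : D x y z -> D (kact a x) (kact a y) (kact a z).
  move=> [Ny py ->]; split; [exact: NK| |by rewrite kactr0].
  move=> m Nm; rewrite -kactBr kinner_act py//.
  by apply: compopP => h; rewrite kcompE !compop0 compop_0.
have [|||y [z [u [v [w [ux vy wz hD]]]]]] := @total_of_dense _ _ _ _ D 1 _ _ _ x0.
- by move=> *; apply: DA => //; apply: DN.
- move=> x y z [Ny py ->]; rewrite rnorm0 !mul1r rnorm_ge0; split=> //.
  rewrite -[x in leRHS](subrK y) addrC; apply: rnorm_perp.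
  by apply: kinner_swap0; exact: py.
- apply/dense_rnorm => y d d0; have [s sd] := eproj_dense y d0.
  exists (eproj s y) => //=; elim: s {sd} => [|v s [n [z Dn]]].
    exists 0, 0; rewrite /eproj big_nil; split=> // m _.
    by rewrite subr0 kinner0l.
  have [n' Nn' pn'] := rank_one_projection sN cN (ran_e_theta e1 v y).
  exists (kact (theta v e) n' + n), z; rewrite /eproj big_cons.
  have -> : kact (theta v v) y = kact (theta v e) (kact (theta e v) y).
    by rewrite -kactM theta_theta (hdot_e e1) scale1r.
  rewrite -[z]add0r; apply: DA => //.
  by rewrite -(kactr0 _ (theta v e)); apply: DK; split.
exists y; first by apply: (lim_to_closed cN vy) => k; have [] := hD k.
move=> m Nm; apply: compopP => h; rewrite compop0.
apply: lim_to_uniq (lim_kinnerl m h (lim_toB ux vy)) _.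
by move=> d d0; exists 0%N => k _; have [_ -> //] := hD k; rewrite compop0 subrr rnorm0.
Qed.

End Complement.

(** * The ring of bounded adjointable operators *)

Section BoundedAdjointable.
Context (R : realType) (H : hilbertType R) (E : hilbertModType H).
Implicit Types (x y z : E) (f g : E -> E).

Local Notation opn := (opnorm (@rnorm R E) (@rnorm R E)).

Lemma opnorm_le f (M : R) : 0 <= M ->
  (forall x, rnorm (f x) <= M * rnorm x) -> (opn f <= M%:E)%E.
Proof.
move=> M0 fM; apply: ge_ereal_sup => _ [x /= x1 <-]; rewrite lee_fin.
by rewrite (le_trans (fM x))// ler_piMr.
Qed.

Lemma opnorm_ub f (M : R) :
  (forall (c : R) x, 0 <= c -> rnorm (f (c%:C *: x)) = c * rnorm (f x)) ->
  (opn f <= M%:E)%E -> forall x, rnorm (f x) <= M * rnorm x.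
Proof.
move=> fZ fM x; have [x0|x0] := eqVneq (rnorm x) 0.
  rewrite (rnorm_eq0 x0) rnorm0 mulr0 -[X in f X](scale0r 0).
  by rewrite (_ : 0 = 0%:C)// fZ// mul0r.
have xp : 0 < rnorm x by rewrite lt0r x0 rnorm_ge0.
rewrite -ler_pdivrMr// mulrC -fZ ?invr_ge0 ?(ltW xp)//.
rewrite -lee_fin (le_trans _ fM)//; apply: ereal_sup_ubound.
exists ((rnorm x)^-1%:C *: x) => //=.
by rewrite rnormZ ?invr_ge0 ?(ltW xp)// mulVf.
Qed.

Definition is_adjoint f g := forall x y, kinner (f x) y = kinner x (g y) :> compop H.

Lemma is_adjointC f g : is_adjoint f g -> is_adjoint g f.
Proof.
move=> fg x y; apply: compopP => h; apply: hdot_ext => k.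
by rewrite kinnerC -fg -kinnerC.
Qed.

Lemma is_adjointD f g : is_adjoint f g -> forall x y, f (x + y) = f x + f y.
Proof.
by move=> fg x y; apply: kinner_ext => z; rewrite fg !kinnerDl !fg.
Qed.

Lemma is_adjointZ f g : is_adjoint f g ->
  forall (c : R[i]) x, f (c *: x) = c *: f x.
Proof.
by move=> fg c x; apply: kinner_ext => z; rewrite fg !kinnerZl !fg.
Qed.

Lemma is_adjointK f g : is_adjoint f g ->
  forall (a : compop H) x, f (kact a x) = kact a (f x).
Proof.
by move=> fg c x; apply: kinner_ext => z; rewrite fg !kinner_act !fg.
Qed.

Lemma adjointableI f g (C : R) : is_adjoint f g ->
  (forall x, rnorm (f x) <= C * rnorm x) -> adjointable f.
Proof.
move=> fg fC; split; last by exists g.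
apply: (@le_lt_trans _ _ `|C|%:E); last exact: ltry.
apply: opnorm_le => // x; rewrite (le_trans (fC x))//.
by rewrite ler_wpM2r ?rnorm_ge0// ler_norm.
Qed.

Lemma adjointable_bound f : adjointable f ->
  exists2 C : R, 0 <= C & forall x, rnorm (f x) <= C * rnorm x.
Proof.
move=> [foo [g fg]]; pose C := fine (opn f).
have f0 : (0 <= opn f)%E.
  apply: (@le_trans _ _ (rnorm (f 0))%:E); first by rewrite lee_fin rnorm_ge0.
  by apply: ereal_sup_ubound; exists 0 => //=; rewrite rnorm0.
have fC : opn f = C%:E by rewrite fineK// fin_numElt foo (lt_le_trans (ltNyr 0)).
exists C; first by rewrite -lee_fin -fC.
apply: opnorm_ub; last by rewrite fC.
by move=> c x c0; rewrite (is_adjointZ fg) rnormZ.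
Qed.

Definition adjointable_op : {pred E -> E} := [pred f : E -> E | `[< adjointable f >]].

Lemma adjointable_opP f : reflect (adjointable f) (f \in adjointable_op).
Proof. exact: asboolP. Qed.

Lemma adjointable_submod : submod_closed adjointable_op.
Proof.
split=> [|c f g]; first apply/adjointable_opP.
  apply: (@adjointableI _ (fun=> 0) 0) => [x y|x]; first by rewrite kinner0l kinner0r.
  by rewrite rnorm0 mul0r.
move=> /adjointable_opP af /adjointable_opP ag; apply/adjointable_opP.
have [_ [f' ff]] := af; have [_ [g' gg]] := ag.
have [C C0 fC] := adjointable_bound af; have [D D0 gD] := adjointable_bound ag.
apply: (@adjointableI _ (fun x => c^*%R *: f' x + g' x)
  (complex.Re `|c| * C + D)) => [x y|x].
  rewrite -![(_ + _ : E -> E) _]/(_ + _) -![(_ *: _ : E -> E) _]/(_ *: _).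
  by rewrite kinnerDl kinnerZl kinnerDr kinnerZr conjCK ff gg.
rewrite -![(_ + _ : E -> E) _]/(_ + _) -![(_ *: _ : E -> E) _]/(_ *: _).
rewrite (le_trans (rnormD _ _))// mulrDl lerD// rnormZC -mulrA ler_wpM2l//.
by rewrite -ler0c Re_normE.
Qed.

HB.instance Definition _ :=
  GRing.isSubmodClosed.Build R[i] (E -> E) adjointable_op adjointable_submod.

Record bop := Bop {
  bop_fun :> E -> E ;
  bop_adjointable : bop_fun \in adjointable_op }.

HB.instance Definition _ := [isSub for bop_fun].
HB.instance Definition _ := [Choice of bop by <:].
HB.instance Definition _ := [SubChoice_isSubLmodule of bop by <:].

Implicit Types a b c : bop.

Lemma bopP a b : (forall x, a x = b x) -> a = b.
Proof. by move=> ab; apply: val_inj; apply: funext. Qed.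

Lemma bop_adj a : adjointable a.
Proof. by apply/adjointable_opP; case: a. Qed.

Definition mkbop f (fa : adjointable f) : bop := Bop (introT (adjointable_opP f) fa).

(** Meant for [u = f* z], before [f*] is known to be bounded: the square of [u] is the inner product
    of [f u] with [z], and one factor [rnorm u] cancels. *)
Lemma adjoint_bound f (C : R) u z : 0 <= C ->
  (forall x, rnorm (f x) <= C * rnorm x) ->
  kinner (f u) z = kinner u u :> compop H -> rnorm u <= C * rnorm z.
Proof.
move=> C0 fC fuz; have [r0|r0] := eqVneq (rnorm u) 0.
  by rewrite r0 mulr_ge0 ?rnorm_ge0.
have rp : 0 < rnorm u by rewrite lt0r r0 rnorm_ge0.
have p0 : 0 <= C * rnorm u * rnorm z by rewrite !mulr_ge0 ?rnorm_ge0.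
have : rnorm u <= Num.sqrt (C * rnorm u * rnorm z).
  apply: rnorm_le_sn => [|h h1]; first exact: sqrtr_ge0.
  apply: sn_le; rewrite ?sqrtr_ge0// sqr_sqrtr//.
  rewrite /qf /form -fuz -/(form h _ _) (le_trans (Re_form_cs _ _ _))//.
  by rewrite ler_pM ?sn_ge0 ?sn_le_rnorm1// (le_trans (sn_le_rnorm1 _ h1)).
rewrite -(@ler_pXn2r _ 2)// ?nnegrE ?sqrtr_ge0 ?rnorm_ge0// sqr_sqrtr// expr2.
by rewrite mulrAC ler_pM2r.
Qed.

Lemma bop_exists_adj a : exists b : bop, is_adjoint a b.
Proof.
have [_ [g ag]] := bop_adj a; have [C C0 aC] := adjointable_bound (bop_adj a).
suff ga : adjointable g by exists (mkbop ga).
apply: (@adjointableI _ a C) => [|x]; first exact: is_adjointC.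
by apply: (adjoint_bound C0 aC); rewrite ag.
Qed.

Definition adj a : bop := projT1 (cid (bop_exists_adj a)).

Lemma adjP a x y : kinner (a x) y = kinner x (adj a y) :> compop H.
Proof. by rewrite /adj; case: cid => b /= ab; exact: ab. Qed.

Lemma adjPr a x y : kinner (adj a x) y = kinner x (a y) :> compop H.
Proof. by apply: is_adjointC => *; exact: adjP. Qed.

Lemma adj_uniq a b : is_adjoint a b -> adj a = b.
Proof.
move=> ab; apply: bopP => x; apply: kinner_ext => z.
by rewrite adjPr (is_adjointC ab).
Qed.

Lemma adjK : involutive adj.
Proof. by move=> a; apply: adj_uniq => x y; rewrite adjPr. Qed.

Lemma form_adj h a x y : form h (a x) y = form h x (adj a y).
Proof. by rewrite /form adjP. Qed.

Lemma form_adjr h a x y : form h (adj a x) y = form h x (a y).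
Proof. by rewrite /form adjPr. Qed.

Lemma bop_adjoint a : is_adjoint a (adj a). Proof. exact: adjP. Qed.

Lemma bopD a x y : a (x + y) = a x + a y.
Proof. exact: is_adjointD (@bop_adjoint a) x y. Qed.

Lemma bopZ a (c : R[i]) x : a (c *: x) = c *: a x.
Proof. exact: is_adjointZ (@bop_adjoint a) c x. Qed.

Lemma bopK a (c : compop H) x : a (kact c x) = kact c (a x).
Proof. exact: is_adjointK (@bop_adjoint a) c x. Qed.

Lemma bop0 a : a 0 = 0.
Proof. by rewrite -(scale0r (0 : E)) bopZ !scale0r. Qed.

Lemma bopN a x : a (- x) = - a x.
Proof. by rewrite -scaleN1r bopZ scaleN1r. Qed.

Lemma bopB a x y : a (x - y) = a x - a y.
Proof. by rewrite bopD bopN. Qed.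

Lemma bop_bound a : exists2 C : R, 0 <= C & forall x, rnorm (a x) <= C * rnorm x.
Proof. exact/adjointable_bound/bop_adj. Qed.

Lemma adjointable_id : adjointable (fun x : E => x).
Proof. by apply: (@adjointableI _ id 1) => // x; rewrite mul1r. Qed.

Lemma adjointable_comp a b : adjointable (a \o b).
Proof.
have [C C0 aC] := bop_bound a; have [D D0 bD] := bop_bound b.
apply: (@adjointableI _ (adj b \o adj a) (C * D)) => [x y|x] /=.
  by rewrite !adjP.
by rewrite (le_trans (aC _))// -mulrA ler_wpM2l.
Qed.

Definition bone : bop := mkbop adjointable_id.
Definition bmul a b : bop := mkbop (adjointable_comp a b).

Lemma bmulA : associative bmul. Proof. by move=> a b c; exact: bopP. Qed.
Lemma bmul1r : left_id bone bmul. Proof. by move=> a; exact: bopP. Qed.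
Lemma bmulr1 : right_id bone bmul. Proof. by move=> a; exact: bopP. Qed.
Lemma bmulDl : left_distributive bmul +%R.
Proof. by move=> a b c; exact: bopP. Qed.
Lemma bmulDr : right_distributive bmul +%R.
Proof. by move=> a b c; apply: bopP => x /=; rewrite bopD. Qed.

HB.instance Definition _ := GRing.Zmodule_isPzRing.Build bop
  bmulA bmul1r bmulr1 bmulDl bmulDr.

Lemma opD a b x : (a + b) x = a x + b x. Proof. by []. Qed.
Lemma opN a x : (- a) x = - a x. Proof. by []. Qed.
Lemma opM a b x : (a * b) x = a (b x). Proof. by []. Qed.
Lemma op1 x : (1 : bop) x = x. Proof. by []. Qed.
Lemma op0 x : (0 : bop) x = 0. Proof. by []. Qed.
Lemma opZ (c : R[i]) a x : (c *: a) x = c *: a x. Proof. by []. Qed.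
Definition opE := (opD, opN, opM, op1, op0, opZ).

Lemma op_scalerAl (c : R[i]) a b : c *: (a * b) = (c *: a) * b.
Proof. by apply: bopP. Qed.

Lemma op_scalerAr (c : R[i]) a b : c *: (a * b) = a * (c *: b).
Proof. by apply: bopP => x; rewrite !opE bopZ. Qed.

Lemma adjD a b : adj (a + b) = adj a + adj b.
Proof.
by apply: adj_uniq => x y; rewrite !opE kinnerDl kinnerDr !adjP.
Qed.

Lemma adjM a b : adj (a * b) = adj b * adj a.
Proof. by apply: adj_uniq => x y; rewrite !opE !adjP. Qed.

Lemma adjN a : adj (- a) = - adj a.
Proof. by apply: adj_uniq => x y; rewrite !opE kinnerNl kinnerNr adjP. Qed.

Lemma adjB a b : adj (a - b) = adj a - adj b.
Proof. by rewrite adjD adjN. Qed.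

Lemma adj1 : adj 1 = 1. Proof. exact: adj_uniq. Qed.

Lemma adj0 : adj 0 = 0. Proof. by rewrite -(subrr 1) adjB adj1. Qed.

Lemma adjZ (c : R[i]) a : adj (c *: a) = c^*%R *: adj a.
Proof.
by apply: adj_uniq => x y; rewrite !opE kinnerZl kinnerZr conjCK adjP.
Qed.

Lemma adjZr (c : R) a : adj (c%:C *: a) = c%:C *: adj a.
Proof. by rewrite adjZ conj_Creal// complex_real. Qed.

Lemma lim_bop a (u : nat -> E) x : lim_to u x -> lim_to (a \o u) (a x).
Proof.
have [C _ aC] := bop_bound a; apply: (@lim_to_bounded _ _ _ _ C) => y z.
by rewrite -bopB.
Qed.

End BoundedAdjointable.

(** * Invertible operators, projections and strong limits *)

Section OperatorTheory.
Context (R : realType) (H : hilbertType R) (E : hilbertModType H).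
Context (e : H) (e1 : rnorm e = 1).
Implicit Types (x y z : E) (h : H) (a b c d : bop E) (N : set E).

Lemma snE h x : sn h x = rnorm (kact (theta e h) x).
Proof. by rewrite (rnorm_ran_e e1 (ran_e_theta e1 h x)) /sn (qf_theta e1). Qed.

(** Adjointable operators commute with the action of [theta e h], so a bound for the norm is
    inherited by every seminorm. *)
Lemma sn_bound a (C : R) : (forall x, rnorm (a x) <= C * rnorm x) ->
  forall h x, sn h (a x) <= C * sn h x.
Proof. by move=> aC h x; rewrite !snE -bopK. Qed.

Lemma adj_bound a (C : R) : 0 <= C -> (forall x, rnorm (a x) <= C * rnorm x) ->
  forall x, rnorm (adj a x) <= C * rnorm x.
Proof.
move=> C0 /sn_bound aC x; apply: rnorm_le_sn_mul => // h.
have [->|p0] := eqVneq (sn h (adj a x)) 0; first by rewrite mulr_ge0 ?sn_ge0.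
have pp : 0 < sn h (adj a x) by rewrite lt0r p0 sn_ge0.
rewrite -(ler_pM2r pp) -expr2 sn_sqr /qf form_adjr (le_trans (Re_form_cs _ _ _))//.
by rewrite mulrC mulrAC ler_wpM2r ?sn_ge0.
Qed.

(** With [w = kact c y], the inner square of [w] is [c] composed with the inner product of [y] and
    [w], so the bound of [c] on [H] gives [rnorm w ^+ 2 <= M * rnorm y * rnorm w]. *)
Lemma kact_bound (c : compop H) :
  exists2 C : R, 0 <= C & forall y : E, rnorm (kact c y) <= C * rnorm y.
Proof.
have [M M0 cM] :=
  precompact_bounded (proj2 (elimT (compact_operatorP _) (compop_compact c))).
have {}cM k : rnorm (c k) <= M * rnorm k.
  have [k0|k0] := eqVneq (rnorm k) 0.
    by rewrite (rnorm_eq0 k0) compop_0 !rnorm0 mulr0.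
  have kp : 0 < rnorm k by rewrite lt0r k0 rnorm_ge0.
  rewrite -ler_pdivrMr// mulrC -rnormZ ?invr_ge0 ?(ltW kp)// -compop_Zr.
  apply: cM; exists ((rnorm k)^-1%:C *: k) => //=.
  by rewrite -rnorm_le1 rnormZ ?invr_ge0 ?(ltW kp)// mulVf.
exists M => [|y]; first exact: ltW.
set w := kact c y.
have ww : rnorm w <= Num.sqrt (M * rnorm y * rnorm w).
  apply: rnorm_le_sn => [|h h1]; first exact: sqrtr_ge0.
  apply: sn_le; rewrite ?sqrtr_ge0// sqr_sqrtr ?mulr_ge0 ?rnorm_ge0 ?(ltW M0)//.
  rewrite /qf /form (le_trans (Re_le_norm _))// -lecR Re_normE.
  rewrite (le_trans (hdot_cs _ _))// -!rnormE -rmorphM lecR.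
  rewrite (@le_trans _ _ (rnorm ((kinner w w : compop H) h)))//.
    by rewrite ler_piMr ?rnorm_ge0.
  rewrite {1}/w kinner_act kcompE (le_trans (cM _))// -mulrA ler_wpM2l ?(ltW M0)//.
  rewrite (le_trans (kinner_le e1 _ _ _))// ler_wpM2l ?rnorm_ge0//.
  by rewrite ler_piMr ?rnorm_ge0.
have [r0|r0] := eqVneq (rnorm w) 0.
  by rewrite r0 mulr_ge0 ?rnorm_ge0 ?(ltW M0).
have rp : 0 < rnorm w by rewrite lt0r r0 rnorm_ge0.
rewrite -(ler_pM2r rp) -expr2.
rewrite -[leRHS]sqr_sqrtr ?mulr_ge0 ?rnorm_ge0 ?(ltW M0)//.
by rewrite ler_pXn2r ?nnegrE ?sqrtr_ge0 ?rnorm_ge0.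
Qed.

Lemma lim_kact (c : compop H) (u : nat -> E) x :
  lim_to u x -> lim_to (fun n => kact c (u n)) (kact c x).
Proof.
have [C _ hC] := kact_bound c.
apply: (@lim_to_bounded _ _ _ (kact c) C) => y z.
by rewrite -kactBr.
Qed.

Lemma ksubmod_closure N : ksubmod N -> ksubmod (closure N).
Proof.
move=> [N0 ND NZ NK]; split.
- exact: subset_closure.
- move=> x y /closure_lim[u [Nu ux]] /closure_lim[v [Nv vy]].
  apply: (lim_to_closed (@closed_closure _ N) (lim_toD ux vy)) => n.
  exact/subset_closure/ND.
- move=> c x /closure_lim[u [Nu ux]].
  apply: (lim_to_closed (@closed_closure _ N) (lim_toZ c ux)) => n.
  exact/subset_closure/NZ.
- move=> c x /closure_lim[u [Nu ux]].
  apply: (lim_to_closed (@closed_closure _ N) (lim_kact c ux)) => n.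
  exact/subset_closure/NK.
Qed.

Lemma ksubmod_range a : ksubmod (range a).
Proof.
split; first by exists 0; rewrite ?bop0.
- by move=> _ _ [x _ <-] [y _ <-]; exists (x + y) => //; rewrite bopD.
- by move=> c _ [x _ <-]; exists (c *: x) => //; rewrite bopZ.
- by move=> c _ [x _ <-]; exists (kact c x) => //; rewrite bopK.
Qed.

Lemma perp_range a x : (forall y, kinner x (a y) = 0 :> compop H) -> adj a x = 0.
Proof.
by move=> xa; apply: kinner_eq0; rewrite adjPr xa.
Qed.

Lemma perp_perp0 N x : perp N x -> closure N x -> x = 0.
Proof.
move=> px /closure_lim[u [Nu ux]]; apply: kinner_eq0; apply: compopP => h.
apply: lim_to_uniq (lim_kinnerr e1 x h ux) _; rewrite compop0.
by move=> d d0; exists 0%N => n _; rewrite px// compop0 subrr rnorm0.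
Qed.

Lemma closed_ksubmod_eqT N : ksubmod N -> closed N ->
  (forall x, perp N x -> N x) -> forall x, N x.
Proof.
move=> sN cN pN x; have [n Nn pn] := complement e1 x sN cN.
by rewrite -(subrK n x); have [_ ND _ _] := sN; apply: ND => //; exact: pN.
Qed.

Lemma dense_range a : (forall x, adj a x = 0 -> x = 0) -> dense (range a).
Proof.
move=> a0; apply/dense_rnorm => x; apply/closure_rnorm.
apply: (closed_ksubmod_eqT (ksubmod_closure (ksubmod_range a))).
  exact: closed_closure.
move=> y py; rewrite (a0 y); first by apply: subset_closure; exists 0; rewrite ?bop0.
by apply: perp_range => z; apply: py; apply: subset_closure; exists z.
Qed.

Lemma bop_ext_dense N a b : dense N -> (forall x, N x -> a x = b x) -> a = b.
Proof.
move=> /dense_rnorm dN ab; apply: bopP => x.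
have /closure_lim[u [Nu ux]] : closure N x by apply/closure_rnorm; exact: dN.
apply: lim_to_uniq (lim_bop a ux) _ => d d0.
have [M hM] := lim_bop b ux d0; exists M => n /hM; rewrite /= ab//.
Qed.

(** The lower bound on [a] makes its range closed, the one on [adj a] makes the complement of the
    range trivial; complementability then gives surjectivity. *)
Lemma bop_invertible a (m : R) : 0 < m ->
  (forall x, m * rnorm x <= rnorm (a x)) ->
  (forall x, m * rnorm x <= rnorm (adj a x)) ->
  exists2 b, a * b = 1 & b * a = 1.
Proof.
have surj c : 0 < m -> (forall x, m * rnorm x <= rnorm (c x)) ->
    (forall x, m * rnorm x <= rnorm (adj c x)) -> forall y, exists x, c x = y.
  move=> m0 cm acm y.
  have cl : closed (range c).
    move=> x /closure_lim[u [cu ux]].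
    have /choice[v hv] n : exists v, c v = u n by have [v _ <-] := cu n; exists v.
    have [l vl] : exists l, lim_to v l.
      apply: complete_rnorm => d d0.
      have md : 0 < m * d / 2 by rewrite divr_gt0// mulr_gt0.
      have [M hM] := ux _ md; exists M => i j /hM hi /hM hj.
      rewrite -(ltr_pM2l m0) (le_lt_trans (cm _))// bopB !hv.
      rewrite (le_lt_trans (rnorm_tri _ x _))// [m * d]splitr ltrD//.
      by rewrite rnormBC.
    exists l => //; apply: lim_to_uniq (lim_bop c vl) _ => d d0.
    by have [M hM] := ux _ d0; exists M => n /hM /=; rewrite hv.
  have [_ [x _ <-] <-] : exists2 x, range c x & x = y; last by exists x.
  exists y => //; apply: (closed_ksubmod_eqT (ksubmod_range c) cl) => x px.
  rewrite (_ : x = 0); first by have [] := ksubmod_range c.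
  apply: rnorm_eq0; apply/eqP; rewrite eq_le rnorm_ge0 andbT.
  rewrite -(ler_pM2l m0) mulr0 (le_trans (acm _))//.
  by rewrite perp_range ?rnorm0// => z; apply: px; exists z.
move=> m0 am aam; have /choice[b hb] := surj a m0 am aam.
have /choice[b' hb'] : forall y, exists x, adj a x = y.
  by apply: surj => //; rewrite adjK.
have bE : is_adjoint b b'.
  by move=> x y; rewrite -{1}(hb' y) -adjP hb.
have ba : adjointable b.
  apply: (@adjointableI _ _ _ _ b' m^-1) => // x.
  by rewrite ler_pdivlMl// (le_trans (am _))// hb.
exists (mkbop ba); apply: bopP => x; rewrite !opE /=; first exact: hb.
apply/eqP; rewrite -subr_eq0; apply/eqP/rnorm_eq0/eqP.
rewrite eq_le rnorm_ge0 andbT -(ler_pM2l m0) mulr0 (le_trans (am _))//.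
by rewrite bopB hb subrr rnorm0.
Qed.

Lemma bop_invertible_sn a (m : R) : 0 < m -> adj a = a ->
  (forall h x, m * qf h x <= complex.Re (form h (a x) x)) ->
  exists2 b, a * b = 1 & b * a = 1.
Proof.
move=> m0 sa am; suff : forall x, m * rnorm x <= rnorm (a x).
  by move=> am'; apply: (bop_invertible m0); rewrite ?sa.
move=> x; apply: rnorm_ge_sn_mul => [|h]; first exact: ltW.
have [->|p0] := eqVneq (sn h x) 0; first by rewrite mulr0 sn_ge0.
have pp : 0 < sn h x by rewrite lt0r p0 sn_ge0.
rewrite -(ler_pM2r pp) -mulrA -expr2 sn_sqr (le_trans (am h x))//.
exact: Re_form_cs.
Qed.

Definition is_proj (a : bop E) := adj a = a /\ a * a = a.

Lemma exists_proj N : ksubmod N -> closed N ->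
  exists2 q, is_proj q & forall x, N (q x) /\ (N x -> q x = x).
Proof.
move=> sN cN; have [N0 ND NZ NK] := sN.
have NB x y : N x -> N y -> N (x - y).
  by move=> Nx Ny; apply: ND => //; rewrite -scaleN1r; exact: NZ.
have /choice[q hq] x : exists n, N n /\ perp N (x - n).
  by have [n ? ?] := complement e1 x sN cN; exists n.
have qN x : N (q x) by have [] := hq x.
have qp x m : N m -> kinner x m = kinner (q x) m :> compop H.
  move=> Nm; have [_ /(_ m Nm)] := hq x.
  by rewrite kinnerBl => /eqP; rewrite subr_eq0 => /eqP.
have qq : is_adjoint q q.
  move=> x y; rewrite [RHS]qp//.
  apply: compopP => h; apply: hdot_ext => k.
  by rewrite kinnerC [in RHS]kinnerC (qp y).
have qb x : rnorm (q x) <= 1 * rnorm x.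
  rewrite mul1r -[x in leRHS](subrK (q x)) addrC; apply: rnorm_perp.
  by apply: kinner_swap0; have [_] := hq x; apply.
have qid x : N x -> q x = x.
  move=> Nx; apply/eqP; rewrite eq_sym -subr_eq0; apply/eqP.
  by apply: kinner_eq0; have [_] := hq x; apply; exact: NB.
exists (mkbop (adjointableI qq qb)); last by move=> x; split=> // /qid.
split; first exact: adj_uniq.
by apply: bopP => x; rewrite opM /= qid.
Qed.

Lemma proj_sn q : is_proj q -> forall h x, sn h (q x) <= sn h x.
Proof.
move=> [sq qq] h x; apply: sn_le; rewrite ?sn_ge0// sn_sqr.
have -> : x = q x + (1 - q) x by rewrite !opE addrC subrK.
rewrite bopD -[q (q x)]opM -[q ((1 - q) x)]opM mulrBr mulr1 !qq subrr addr0.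
rewrite qf_perp ?lerDl ?qf_ge0// adjP sq -opM mulrBr mulr1 qq subrr.
by rewrite kinner0r.
Qed.

(** The strong limit of the adjoints supplies the adjoint of the strong limit, which is why both
    sequences are required to converge. *)
Lemma op_lim (u : nat -> bop E) (C : R) :
  (forall n x, rnorm (u n x) <= C * rnorm x) ->
  (forall x, exists l, lim_to (fun n => u n x) l) ->
  (forall x, exists l, lim_to (fun n => adj (u n) x) l) ->
  exists y : bop E, (forall x, lim_to (fun n => u n x) (y x)) /\
    (forall x, lim_to (fun n => adj (u n) x) (adj y x)).
Proof.
move=> uC /choice[y hy] /choice[y' hy'].
have ya : is_adjoint y y'.
  move=> x z; apply: compopP => h.
  apply: lim_to_uniq (lim_kinnerl e1 z h (hy x)) _ => d d0.
  have [M hM] := lim_kinnerr e1 x h (hy' z) d0.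
  by exists M => n /hM; rewrite adjP.
have yb x : rnorm (y x) <= C * rnorm x by apply: lim_to_norm_le (hy x) _.
exists (mkbop (adjointableI ya yb)); split=> // x.
suff -> : adj (mkbop (adjointableI ya yb)) x = y' x by exact: hy'.
by apply: kinner_ext => z; rewrite adjPr (is_adjointC ya).
Qed.

End OperatorTheory.

(** * Square roots of positive operators *)

Section SquareRoot.
Context (R : realType) (H : hilbertType R) (E : hilbertModType H).
Context (e : H) (e1 : rnorm e = 1).
Implicit Types (x y z : E) (h : H) (a b c d : bop E).

Definition half : R[i] := (2^-1 : R)%:C.

Lemma half2 (V : lmodType R[i]) (v : V) : half *: (v + v) = v.
Proof.
rewrite scalerDr -scalerDl /half -rmorphD /=.
by rewrite (_ : 2^-1 + 2^-1 = 1 :> R) ?scale1r//; field.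
Qed.

Fixpoint sqrt_scal n : R := if n is m.+1 then (1 + sqrt_scal m ^+ 2) / 2 else 0.

Lemma sqrt_scal_bound n : 0 <= sqrt_scal n <= 1.
Proof.
elim: n => [|n /andP[r0 r1]] /=; first by rewrite lexx ler01.
have : sqrt_scal n ^+ 2 <= 1 by rewrite expr_le1.
by have := sqr_ge0 (sqrt_scal n); lra.
Qed.

Lemma sqrt_scal_incr n : sqrt_scal n <= sqrt_scal n.+1.
Proof.
by have := sqr_ge0 (sqrt_scal n - 1); rewrite sqrrB /=; lra.
Qed.

Lemma sqrt_scal_mono m n : (n <= m)%N -> sqrt_scal n <= sqrt_scal m.
Proof.
move=> /subnK <-; elim: (m - n)%N => [|k IH]; first by rewrite add0n.
by rewrite addSn (le_trans IH)// sqrt_scal_incr.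
Qed.

Lemma sqrt_scal_cauchy (d : R) : 0 < d -> exists N, forall m n,
  (N <= n)%N -> (n <= m)%N -> sqrt_scal m - sqrt_scal n < d.
Proof.
move=> d0; have hs : has_sup (range sqrt_scal).
  split; first by exists 0, 0%N.
  by exists 1 => _ [n _ <-]; have /andP[] := sqrt_scal_bound n.
have [_ [N _ <-] hN] := sup_adherent d0 hs.
exists N => m n /sqrt_scal_mono Nn _.
have : sqrt_scal m <= sup (range sqrt_scal) by apply: ub_le_sup; [case: hs|exists m].
by move: hN Nn; lra.
Qed.

Context (d : bop E) (sd : adj d = d) (hd : forall h x, sn h (d x) <= sn h x).

(* Iterates for the fixed point [y = (d + y^2) / 2], so that [1 - y] is a
   square root of [1 - d]; [sqrt_scal] is the same iteration for [d = 1], and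
   dominates it since all coefficients are nonnegative. *)
Fixpoint sqrt_iter n : bop E :=
  if n is m.+1 then half *: (d + sqrt_iter m * sqrt_iter m) else 0.

Lemma sn_half h x : sn h (half *: x) = sn h x / 2.
Proof. by rewrite snZ ger0_norm ?invr_ge0// mulrC. Qed.

Lemma sqrt_iter_sn n h x : sn h (sqrt_iter n x) <= sqrt_scal n * sn h x.
Proof.
elim: n x => [|n IH] x; first by rewrite op0 sn0 mul0r.
have /andP[r0 _] := sqrt_scal_bound n.
rewrite [sqrt_iter _]/= [sqrt_scal _]/= !opE sn_half mulrAC ler_wpM2r ?invr_ge0//.
rewrite (le_trans (snD _ _ _))// mulrDl mul1r lerD// (le_trans (IH _))//.
by rewrite expr2 -mulrA ler_wpM2l.
Qed.

Lemma sqrt_iter_adj n : adj (sqrt_iter n) = sqrt_iter n.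
Proof.
by elim: n => [|n IH] /=; rewrite ?adj0// adjZr adjD sd adjM IH.
Qed.

Lemma sqrt_iter_comm n b : b * d = d * b -> b * sqrt_iter n = sqrt_iter n * b.
Proof.
move=> bd; elim: n => [|n IH] /=; first by rewrite mulr0 mul0r.
rewrite -op_scalerAr -op_scalerAl mulrDr mulrDl bd; congr (_ *: (_ + _)).
by rewrite mulrA IH -!mulrA IH.
Qed.

Lemma sqrt_iter_comm2 m n :
  sqrt_iter m * sqrt_iter n = sqrt_iter n * sqrt_iter m.
Proof. by apply: sqrt_iter_comm; rewrite [RHS]sqrt_iter_comm. Qed.

(** For commuting iterates [a], [b] one has [a^2 - b^2 = (a + b) (a - b)], so the differences obey
    the same recursion as those of the scalar iteration. *)
Lemma sqrt_iter_diff n m h x : (n <= m)%N ->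
  sn h (sqrt_iter m x - sqrt_iter n x) <= (sqrt_scal m - sqrt_scal n) * sn h x.
Proof.
elim: n m x => [|n IH] [|m] x nm //.
- by rewrite !subrr mul0r sn0.
- by rewrite [sqrt_iter 0]/= op0 !subr0 sqrt_iter_sn.
have -> : sqrt_iter m.+1 x - sqrt_iter n.+1 x =
    half *: (sqrt_iter m (sqrt_iter m x - sqrt_iter n x) +
             sqrt_iter n (sqrt_iter m x - sqrt_iter n x)).
  rewrite [sqrt_iter m.+1]/= [sqrt_iter n.+1]/= !opE -scalerBr; congr (_ *: _).
  rewrite [d x + _]addrC addrKA !bopB.
  have := congr1 (fun a : bop E => a x) (sqrt_iter_comm2 m n); rewrite !opE => ->.
  by rewrite subrKA.
rewrite sn_half /= -mulrBl mulrAC ler_wpM2r ?invr_ge0//.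
have /andP[m0 _] := sqrt_scal_bound m; have /andP[n0 _] := sqrt_scal_bound n.
have mn := IH m x nm.
rewrite (le_trans (snD _ _ _))// (le_trans (lerD (sqrt_iter_sn _ _ _) (sqrt_iter_sn _ _ _)))//.
rewrite -mulrDl [leRHS](_ : _ = (sqrt_scal m + sqrt_scal n) *
  ((sqrt_scal m - sqrt_scal n) * sn h x)); last by ring.
by rewrite ler_wpM2l// addr_ge0.
Qed.

Lemma exists_one_sub_sqrt : exists y : bop E,
  [/\ adj y = y, half *: (d + y * y) = y, forall h x, sn h (y x) <= sn h x &
      forall b, b * d = d * b -> b * y = y * b].
Proof.
have iter1 n x : rnorm (sqrt_iter n x) <= 1 * rnorm x.
  apply: rnorm_le_sn_mul => // h; rewrite (le_trans (sqrt_iter_sn _ _ _))//.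
  by rewrite ler_wpM2r ?sn_ge0//; have /andP[] := sqrt_scal_bound n.
have conv x : exists l, lim_to (fun n => sqrt_iter n x) l.
  apply: complete_rnorm => r r0.
  have x0 : 0 < rnorm x + 1 by rewrite ltr_wpDl// rnorm_ge0.
  have [N hN] := sqrt_scal_cauchy (divr_gt0 r0 x0).
  suff hh m n : (N <= n)%N -> (n <= m)%N ->
      rnorm (sqrt_iter m x - sqrt_iter n x) < r.
    exists N => m n Nm Nn; have [nm|mn] := leqP n m; first exact: hh.
    by rewrite rnormBC hh// ltnW.
  move=> Nn nm; have mn0 : 0 <= sqrt_scal m - sqrt_scal n.
    by rewrite subr_ge0 sqrt_scal_mono.
  rewrite (@le_lt_trans _ _ ((sqrt_scal m - sqrt_scal n) * rnorm x))//.
    by apply: rnorm_le_sn_mul => // h; exact: sqrt_iter_diff.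
  rewrite (@le_lt_trans _ _ ((sqrt_scal m - sqrt_scal n) * (rnorm x + 1)))//.
    by rewrite ler_wpM2l// lerDl.
  by rewrite -ltr_pdivlMr// hN.
have [|y [hy hy']] := op_lim e1 iter1 conv.
  by move=> x; have [l hl] := conv x; exists l => r /hl[N hN]; exists N => n;
    rewrite sqrt_iter_adj; exact: hN.
have y1 x : rnorm (y x) <= 1 * rnorm x by apply: lim_to_norm_le (hy x) _.
have ysq x : lim_to (fun n => sqrt_iter n (sqrt_iter n x)) (y (y x)).
  move=> r r0; have r2 := divr_gt0 r0 (ltr0n R 2).
  have [N hN] := hy x _ r2; have [M hM] := hy (y x) _ r2.
  exists (maxn N M) => n; rewrite geq_max => /andP[/hN h1 /hM h2].
  rewrite (le_lt_trans (rnorm_tri _ (sqrt_iter n (y x)) _))// [r]splitr.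
  by rewrite ltrD// -bopB (le_lt_trans (iter1 _ _))// mul1r.
exists y; split.
- apply: bopP => x; apply: lim_to_uniq (hy' x) _ => r /(hy x)[N hN].
  by exists N => n; rewrite sqrt_iter_adj; exact: hN.
- apply: bopP => x; rewrite !opE.
  have hl : lim_to (fun n => sqrt_iter n.+1 x) (half *: (d x + y (y x))).
    exact: (lim_toZ half (lim_toD (lim_to_cst (d x)) (ysq x))).
  apply: (lim_to_uniq hl) => r /(hy x)[N hN]; exists N => n Nn.
  by apply: hN; rewrite ltnW.
- by move=> h x; have := sn_bound e1 y1 h x; rewrite mul1r.
- move=> b bd; apply: bopP => x; rewrite !opM.
  apply: lim_to_uniq (lim_bop b (hy x)) _ => r /(hy (b x))[N hN].
  by exists N => n /hN; rewrite /= -[b (sqrt_iter n x)]opM (sqrt_iter_comm _ bd).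
Qed.

End SquareRoot.

Section SquareRootTheorem.
Context (R : realType) (H : hilbertType R) (E : hilbertModType H).
Context (e : H) (e1 : rnorm e = 1).
Implicit Types (x y z : E) (h : H) (a b c d : bop E).

Lemma bop_sqrt a : adj a = a -> (forall h x, sn h ((1 - a) x) <= sn h x) ->
  exists s : bop E, [/\ adj s = s, s * s = a,
    forall h x, 0 <= complex.Re (form h (s x) x) &
    forall b, b * a = a * b -> b * s = s * b].
Proof.
move=> sa ha; have sd : adj (1 - a) = 1 - a by rewrite adjB adj1 sa.
have [y [sy yy y1 yc]] := exists_one_sub_sqrt e1 sd ha.
exists (1 - y); split.
- by rewrite adjB adj1 sy.
- have yE : y + y = 1 - a + y * y.
    by rewrite -{1 2}yy -scalerDr half2.
  have -> : a = 1 - (y + y) + y * y.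
    by rewrite yE [- (_ + _)]opprD addrA addrNK opprB addrC subrK.
  by rewrite mulrBl mul1r mulrBr mulr1 opprB opprD !addrA addrAC.
- move=> h x; rewrite !opE formDl formNl ReD ReN subr_ge0.
  rewrite (le_trans (Re_form_cs _ _ _))// -/(qf h x) -sn_sqr expr2.
  by rewrite ler_wpM2r ?sn_ge0.
- move=> b ba; rewrite mulrBl mulrBr mul1r mulr1 yc//.
  by rewrite mulrBl mulrBr mul1r mulr1 ba.
Qed.

End SquareRootTheorem.

(** * Graphs of regular operators *)

Section DirectSumNorm.
Context (R : realType) (H : hilbertType R) (E : hilbertModType H).
Implicit Types (u v w : (E * E)%type) (h : H).

Lemma opnorm_ge0 (a : compop H) : (0 <= opnorm (@rnorm R H) (@rnorm R H) a)%E.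
Proof.
apply: (@le_trans _ _ (rnorm (a 0))%:E); first by rewrite lee_fin rnorm_ge0.
by apply: ereal_sup_ubound; exists 0 => //=; rewrite rnorm0.
Qed.

Lemma kinner2_Re u h : complex.Re (hdot ((kinner2 u u : compop H) h) h) =
  qf h u.1 + qf h u.2.
Proof. by rewrite /kinner2 compopD hdotDl ReD. Qed.

Lemma norm2_opnorm_le u (M : R) : 0 <= M ->
  (forall h, rnorm h <= 1 -> qf h u.1 + qf h u.2 <= M) ->
  (opnorm (@rnorm R H) (@rnorm R H) (kinner2 u u : compop H) <= M%:E)%E.
Proof.
move=> M0 hM; apply: opnorm_psd_le => //.
- by move=> h k; rewrite /kinner2 !compopD hdotDl hdotDr !kinnerC.
- by move=> h; rewrite /kinner2 compopD hdotDl addr_ge0// kinner_ge0.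
- by move=> h /hM; rewrite kinner2_Re.
Qed.

Lemma norm2_le u (M : R) : 0 <= M ->
  (forall h, rnorm h <= 1 -> qf h u.1 + qf h u.2 <= M ^+ 2) -> norm2 u <= M.
Proof.
move=> M0 hM; have h1 := norm2_opnorm_le (exprn_ge0 2 M0) hM.
have := opnorm_ge0 (kinner2 u u : compop H); rewrite /norm2.
case: opnorm h1 => [r|//|//]; rewrite !lee_fin => rM r0 /=.
by rewrite -(ger0_norm M0) -sqrtr_sqr ler_wsqrtr.
Qed.

Lemma qf2_le_norm2 u h : rnorm h <= 1 -> qf h u.1 + qf h u.2 <= norm2 u ^+ 2.
Proof.
move=> h1; have : (opnorm (@rnorm R H) (@rnorm R H) (kinner2 u u : compop H)
    <= (rnorm u.1 ^+ 2 + rnorm u.2 ^+ 2)%:E)%E.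
  apply: norm2_opnorm_le => [|k k1]; first by rewrite addr_ge0 ?sqr_ge0.
  by rewrite lerD// -sn_sqr ler_pXn2r// ?nnegrE ?sn_ge0 ?rnorm_ge0// sn_le_rnorm1.
have := opnorm_ge0 (kinner2 u u : compop H); rewrite /norm2.
have := @compop_form_le_opnorm _ _ (kinner2 u u : compop H) _ h.
case: opnorm => [r|//|//] /(_ r (lexx _)); rewrite !lee_fin => hr r0 _ /=.
rewrite sqr_sqrtr// -kinner2_Re (le_trans hr)// ler_piMr//.
by rewrite expr_le1// rnorm_ge0.
Qed.

Lemma norm2_ge0 u : 0 <= norm2 u. Proof. exact: sqrtr_ge0. Qed.

Lemma rnorm_le_norm2 u : rnorm u.1 <= norm2 u /\ rnorm u.2 <= norm2 u.
Proof.
split; apply: rnorm_le_sn (norm2_ge0 u) _ => h /(qf2_le_norm2 u) hu.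
  by apply: sn_le (norm2_ge0 u) _; rewrite (le_trans _ hu)// lerDl qf_ge0.
by apply: sn_le (norm2_ge0 u) _; rewrite (le_trans _ hu)// lerDr qf_ge0.
Qed.

Lemma norm2Z (c : R) u : 0 <= c -> norm2 (c%:C *: u) = c * norm2 u.
Proof.
have le_Z (d : R) v : 0 <= d -> norm2 (d%:C *: v) <= d * norm2 v.
  move=> d0; apply: norm2_le => [|h h1]; first by rewrite mulr_ge0// norm2_ge0.
  by rewrite /= !qfZ -mulrDr exprMn ler_wpM2l ?sqr_ge0// qf2_le_norm2.
move=> c0; apply/eqP; rewrite eq_le le_Z//=.
have [->|cn] := eqVneq c 0; first by rewrite mul0r norm2_ge0.
have cp : 0 < c by rewrite lt0r cn.
rewrite -ler_pdivlMl// (le_trans _ (le_Z _ _ _)) ?invr_ge0//.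
by rewrite scalerA -rmorphM /= mulVf// scale1r.
Qed.

Lemma kinner2_eq0 u : kinner2 u u = 0 :> compop H -> u = 0.
Proof.
move=> u0; have u00 h : qf h u.1 + qf h u.2 = 0.
  by rewrite -kinner2_Re u0 compop0 hdot0l.
have [u1 u2] : u.1 = 0 /\ u.2 = 0.
  split; apply: sn_eq0 => h; apply/eqP; rewrite sqrtr_eq0 -(u00 h).
    by rewrite lerDl qf_ge0.
  by rewrite lerDr qf_ge0.
by case: u u1 u2 {u0 u00} => x y /= -> ->.
Qed.

Lemma kinner2B u v w : kinner2 (u - v) w = kinner2 u w - kinner2 v w :> compop H.
Proof. by rewrite /kinner2 !kinnerBl opprD addrACA. Qed.

Lemma orthoproj_uniq (S : set (E * E)) (P : E * E -> E * E) :
  is_orthoproj S P -> orthoproj S = P.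
Proof.
move=> hP; rewrite /orthoproj; case: xgetP => [Q _ hQ|nP]; last by have := nP P.
apply: funext => u; apply/eqP; rewrite -subr_eq0; apply/eqP/kinner2_eq0.
have [SP oP] := hP u; have [SQ oQ] := hQ u.
have key v : S v -> kinner2 (Q u - P u) v = 0 :> compop H.
  move=> Sv; have -> : Q u - P u = (u - P u) - (u - Q u).
    by rewrite opprB [RHS]addrC subrKA.
  by rewrite kinner2B oP// oQ// subrr.
have swap w v : kinner2 w v = 0 :> compop H -> kinner2 v w = 0 :> compop H.
  move=> wv; apply: compopP => h; apply: hdot_ext => k.
  have : hdot h ((kinner2 w v : compop H) k) = 0 by rewrite wv hdot0r.
  by rewrite compop0 hdot0l /kinner2 !compopD hdotDl hdotDr !kinnerC.
rewrite kinner2B; apply/eqP; rewrite subr_eq0; apply/eqP.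
by rewrite (swap _ _ (key _ SQ)) (swap _ _ (key _ SP)).
Qed.

End DirectSumNorm.

(** * Resolvent and bounded transform of a regular operator *)

Section Regular.
Context (R : realType) (H : hilbertType R) (E : hilbertModType H).
Context (e : H) (e1 : rnorm e = 1).
Implicit Types (x y z : E) (h : H) (f g c : bop E) (T : set (E * E)).

Lemma kinner_swap x y z w : kinner x y = kinner z w :> compop H ->
  kinner y x = kinner w z :> compop H.
Proof.
move=> xy; apply: compopP => h; apply: hdot_ext => k.
by rewrite kinnerC xy -kinnerC.
Qed.

(** For injective [g] this is the graph of the unbounded operator [f g^(-1)]. *)
Definition pgraph g f : set (E * E) := [set u | exists x, u = (g x, f x)].

Lemma adjoint_closed T : closed (adjoint T).
Proof.
move=> [y z] /closure_lim2[u [v [Tuv uy vz]]] x tx Txtx /=.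
apply: compopP => h; apply: lim_to_uniq (lim_kinnerr e1 tx h uy) _ => d d0.
have [N hN] := lim_kinnerr e1 x h vz d0; exists N => n /hN.
by have /= -> := Tuv n x tx Txtx.
Qed.

Lemma adjointB T u v : adjoint T u -> adjoint T v -> adjoint T (u - v).
Proof. by move=> Tu Tv x tx Tx /=; rewrite !kinnerBr (Tu _ _ Tx) (Tv _ _ Tx). Qed.

Lemma klinearB T u v : klinear_operator T -> T u -> T v -> T (u - v).
Proof.
by move=> [_ TD TZ _ _] Tu Tv; apply: TD => //; rewrite -scaleN1r; exact: TZ.
Qed.

(** With [y = T x] and [z = T* y], both cross terms of the square of [x + z] equal the square of
    [y]. This makes the resolvent of [T* T] at -1 contractive. *)
Lemma adjoint_qf T x y z h : T (x, y) -> adjoint T (y, z) ->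
  qf h (x + z) = qf h x + qf h z + 2 * qf h y.
Proof. by move=> Txy Tyz; rewrite qfD /qf (form_kinner h (Tyz _ _ Txy)). Qed.

(** Surjectivity of [1 + T* T]: its range is dense, the solution [x] and [y = T x] are bounded by
    the right-hand side, and [T] and its adjoint are closed. *)
Lemma regular_onto T : regular T -> forall w, exists x y,
  T (x, y) /\ adjoint T (y, w - x).
Proof.
move=> [kT cT _ _ dT] w0.
pose D w x y := T (x, y) /\ adjoint T (y, w - x).
have DB x y z x' y' z' : D x y z -> D x' y' z' -> D (x - x') (y - y') (z - z').
  move=> [T1 T2] [T1' T2']; split; first exact: (klinearB kT T1 T1').
  rewrite [- (_ - _)]opprD addrACA -opprD.
  exact: (adjointB T2 T2').
have Dn x y z : D x y z -> rnorm y <= 1 * rnorm x /\ rnorm z <= 1 * rnorm x.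
  move=> [T1 T2]; have q h := adjoint_qf h T1 T2.
  have {}q h : qf h x = qf h y + qf h (x - y) + 2 * qf h z.
    by rewrite -q addrC subrK.
  split; apply: rnorm_le_sn_mul => // h; rewrite mul1r; apply: sn_le (sn_ge0 _ _) _;
    rewrite sn_sqr q; have := qf_ge0 h y; have := qf_ge0 h z;
    have := qf_ge0 h (x - y); lra.
have dD : dense [set x | exists y z, D x y z].
  move: dT; congr dense; apply/seteqP; split=> w /= [x [y]].
    by move=> [z [T1 T2 ->]]; exists x, y; split=> //; rewrite addrC addKr.
  by move=> [T1 T2]; exists x, y, (w - x); split=> //; rewrite addrC subrK.
have [x [y [u [v [w [ux vy wz hD]]]]]] := total_of_dense DB Dn dD w0.
exists x, y; split.
  by apply: (lim_to_closed2 cT vy wz) => n; have [] := hD n.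
apply: (lim_to_closed2 (@adjoint_closed T) wz (lim_toB ux vy)) => n.
by have [] := hD n.
Qed.

Section Representation.
Context (T : set (E * E)) (rT : regular T).

Let kT : klinear_operator T. Proof. by case: rT. Qed.

Lemma regular_fun0 y : T (0, y) -> y = 0.
Proof. by have [_ _ _ _] := kT; apply. Qed.

Lemma adjoint_fun0 z : adjoint T (0, z) -> z = 0.
Proof.
have [_ _ dT _ _] := rT; move=> Tz; apply: kinner_eq0.
have /closure_lim[u [Tu uz]] : closure (dom T) z.
  by apply/closure_rnorm; have /dense_rnorm := dT; apply.
apply: compopP => h; apply: lim_to_uniq (lim_kinnerl e1 z h uz) _ => d d0.
exists 0%N => n _; have [y Ty] := Tu n.
by rewrite -(Tz _ _ Ty) kinner0r compop0 subrr rnorm0.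
Qed.

(** In other words, -1 is not an eigenvalue of [T* T]. *)
Lemma regular_inj x y : T (x, y) -> adjoint T (y, - x) -> x = 0.
Proof.
move=> Txy Ty; apply: sn_eq0 => h; have := adjoint_qf h Txy Ty.
rewrite subrr qfN {1}/qf form0l => hq; apply/eqP; rewrite sqrtr_eq0.
by have := qf_ge0 h y; have := qf_ge0 h x; move: hq => /=; lra.
Qed.

(** Here [c] is [(1 + T* T)^(-1)], and [y] stands for [T (c w)]. *)
Lemma regular_resolvent : exists c : bop E, [/\ adj c = c,
  forall w, exists2 y, T (c w, y) & adjoint T (y, w - c w),
  forall h x, sn h ((1 - c) x) <= sn h x & dense (range c)].
Proof.
have /choice[c hc] w : exists x, exists2 y, T (x, y) & adjoint T (y, w - x).
  by have [x [y [? ?]]] := regular_onto rT w; exists x, y.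
have cc : is_adjoint c c.
  move=> w w'; have [y T1 T2] := hc w; have [y' T1' T2'] := hc w'.
  rewrite -[w' in LHS](subrK (c w')) -[w in RHS](subrK (c w)).
  by rewrite kinnerDl kinnerDr -(T2' _ _ T1) (kinner_swap (T2 _ _ T1')).
have q w h : exists2 y, qf h w = qf h (c w) + qf h (w - c w) + 2 * qf h y &
    T (c w, y).
  by have [y T1 T2] := hc w; exists y => //; rewrite -(adjoint_qf h T1 T2) addrC subrK.
have cb w : rnorm (c w) <= 1 * rnorm w.
  apply: rnorm_le_sn_mul => // h; rewrite mul1r; apply: sn_le (sn_ge0 _ _) _.
  have [y qE _] := q w h; rewrite sn_sqr qE.
  by have := qf_ge0 h y; have := qf_ge0 h (w - c w); lra.
pose c' := mkbop (adjointableI cc cb).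
have sc : adj c' = c' by apply: adj_uniq.
exists c'; split=> //.
  move=> h x; apply: sn_le (sn_ge0 _ _) _; rewrite sn_sqr !opE /=.
  have [y -> _] := q x h.
  by have := qf_ge0 h y; have := qf_ge0 h (c x); lra.
apply: (dense_range e1); rewrite sc => w /= w0.
have [y] := hc w; rewrite w0 subr0 => /regular_fun0 ->; exact: adjoint_fun0.
Qed.

Definition rep g f := [/\ T = pgraph g f, adj g = g, g * g + adj f * f = 1 &
  dense (range g)].

(* [g = (1 + T^* T)^(-1/2)] and [f = T g] is the bounded transform. *)
Lemma regular_rep : exists g f, rep g f /\
  (adjoint T = T -> adj f = f /\ f * g = g * f).
Proof.
have [c [sc hc c1 dc]] := regular_resolvent.
have [g [sg gg _ gc]] := bop_sqrt e1 sc c1.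
have ggE w : g (g w) = c w by rewrite -gg.
have dg : dense (range g).
  apply/dense_rnorm => x d d0; have /dense_rnorm dc' := dc.
  have [_ [w _ <-] xw] := dc' x d d0; exists (c w) => //.
  by exists (g w) => //; rewrite ggE.
have cgq h w : complex.Re (form h w (c w)) = qf h (g w).
  by rewrite /qf form_adj sg ggE.
have [_ cT _ daT _] := rT.
(* Since [c = g^2], the bounded transform must send [g w] to [T (c w)]; this is contractive on the
   dense range of [g] and extends to [E]. *)
pose D x y (z : E) := exists2 w, x = g w & [/\ T (c w, y), adjoint T (y, w - c w) & z = 0].
have DB x y z x' y' z' : D x y z -> D x' y' z' -> D (x - x') (y - y') (z - z').
  move=> [w -> [T1 T2 ->]] [w' -> [T1' T2' ->]]; exists (w - w').
    by rewrite bopB.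
  split; last by rewrite subrr.
    by rewrite bopB; exact: (klinearB kT T1 T1').
  by rewrite bopB [- (_ - _)]opprD addrACA -opprD; exact: (adjointB T2 T2').
have Dq x y z : D x y z -> forall h, qf h y <= qf h x.
  move=> [w -> [T1 T2 _]] h; have := adjoint_qf h T1 T2.
  rewrite addrC subrK => qw; rewrite -cgq.
  have : qf h (w - c w) = qf h w + qf h (c w) - 2 * complex.Re (form h w (c w)).
    exact: qfB.
  by have := qf_ge0 h (c w); lra.
have Dn x y z : D x y z -> rnorm y <= 1 * rnorm x /\ rnorm z <= 1 * rnorm x.
  move=> Dxyz; have q := Dq _ _ _ Dxyz; have [_ _ [_ _ ->]] := Dxyz.
  rewrite rnorm0 mul1r rnorm_ge0; split=> //; rewrite -[leRHS]mul1r.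
  apply: rnorm_le_sn_mul => // h; rewrite mul1r.
  by apply: sn_le (sn_ge0 _ _) _; rewrite sn_sqr.
have dD : dense [set x | exists y z, D x y z].
  apply/dense_rnorm => x d d0; have /dense_rnorm dg' := dg.
  have [_ [w _ <-] xw] := dg' x d d0; exists (g w) => //.
  by have [y T1 T2] := hc w; exists y, 0, w.
have /choice[f hf] x : exists y, T (g x, y) /\ rnorm y <= 1 * rnorm x.
  have [y [z [u [v [w [ux vy wz hD]]]]]] := total_of_dense DB Dn dD x.
  exists y; split; last by apply: (lim_to_norm_le2 _ ux vy) => // n; have [] := Dn _ _ _ (hD n).
  apply: (lim_to_closed2 cT (lim_bop g ux) vy) => n.
  by have [w' uw [T1 _ _]] := hD n; rewrite /= uw ggE.
have fT x : T (g x, f x) by have [] := hf x.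
have fb x : rnorm (f x) <= 1 * rnorm x by have [] := hf x.
have funiq x y : T (g x, y) -> y = f x.
  move=> Ty; apply/eqP; rewrite -subr_eq0; apply/eqP/regular_fun0.
  have : T (g x - g x, y - f x) by exact: (klinearB kT Ty (fT x)).
  by rewrite subrr.
(* On the dense domain of [T*] the adjoint of [f] is [g T*]. *)
pose D' z u (s : E) := (forall x, kinner (f x) z = kinner x u :> compop H) /\ s = 0.
have /choice[f' hf'] z0 : exists u, forall x, kinner (f x) z0 = kinner x u :> compop H.
  have [|z u s [Dz ->]||u [s [v [w [t [vz wu _ hD]]]]]] := @total_of_dense _ _ _ _ D' 1 _ _ _ z0.
  - move=> x y z x' y' z' [h1 ->] [h2 ->]; split; last by rewrite subrr.
    by move=> w; rewrite !kinnerBr h1 h2.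
  - by rewrite rnorm0 mul1r rnorm_ge0; split=> //; rewrite -[leRHS]mul1r;
      apply: (adjoint_bound ler01 fb); exact: Dz.
  - apply/dense_rnorm => z d d0; have /dense_rnorm daT' := daT.
    have [y [s Tys] zy] := daT' z d d0; exists y => //.
    exists (g s), 0; split=> // x.
    by rewrite (Tys _ _ (fT x)) adjP sg.
  exists u => x; apply: compopP => h.
  apply: lim_to_uniq (lim_kinnerr e1 (f x) h vz) _ => d d0.
  have [N hN] := lim_kinnerr e1 x h wu d0; exists N => n /hN.
  by have [-> _] := hD n.
have ff : is_adjoint f f' by move=> x z; exact: hf'.
pose F := mkbop (adjointableI ff fb).
have FT x : T (g x, F x) by exact: fT.
have Funiq x y : T (g x, y) -> y = F x by exact: funiq.
have norm1 : g * g + adj F * F = 1.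
  apply: (bop_ext_dense dg) => _ [w _ <-]; apply: kinner_ext => x'.
  have [y T1 T2] := hc w.
  have Fg : F (g w) = y by apply/esym/Funiq; rewrite ggE.
  rewrite !opE kinnerDl adjPr Fg (kinner_swap (T2 _ _ (FT x'))).
  rewrite adjP sg ggE.
  by rewrite -kinnerDl addrC subrK adjP sg.
have TE : T = pgraph g F.
  apply/seteqP; split=> [[x' y'] Txy|_ [x ->]]; last exact: FT.
  (* The parameter of the orthogonal projection of [(x', y')] onto the parametrized graph. The
     remainder [(u, v)] belongs to [T] and is orthogonal to that graph, which forces it to
     vanish. *)
  pose x := g x' + adj F y'; exists x.
  pose u := x' - g x; pose v := y' - F x.
  have Tuv : T (u, v) by exact: (klinearB kT Txy (FT x)).
  have uv0 : g u + adj F v = 0.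
    rewrite !bopB addrACA -/x -opprD -[g (g x)]opM -[adj F (F x)]opM -opD.
    by rewrite norm1 subrr.
  have u0 : u = 0.
    apply: kinner_eq0; have [y T1 T2] := hc u; have := T2 _ _ Tuv => /= vy.
    have yE : y = F (g u) by apply: Funiq; rewrite ggE.
    have : kinner (g (g u)) u + kinner (F (g u)) v = 0 :> compop H.
      by rewrite [kinner (F _) v]adjP (adjP g) sg -kinnerDr uv0 kinner0r.
    by rewrite ggE -yE (kinner_swap vy) kinnerBl addrC subrK.
  have v0 : v = 0 by apply: regular_fun0; rewrite -u0.
  by move: u0 v0 => /eqP; rewrite subr_eq0 => /eqP -> /eqP; rewrite subr_eq0 => /eqP ->.
exists g, F; split=> // aT.
have FgT w : T (c w, F (g w)) /\ T (F (g w), w - c w).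
  have [y T1 T2] := hc w; have yE : y = F (g w) by apply: Funiq; rewrite ggE.
  by rewrite -{2}aT -yE.
(* The difference [v] of the two sides at [w] satisfies [T (T v) = - v], and for a selfadjoint [T]
   this implies [v = 0]. *)
have cF : F * g * c = c * (F * g).
  apply: bopP => w; rewrite !opM.
  have [T1 T2] := FgT w; have [T3 T4] := FgT (c w); have [T5] := FgT (F (g w)).
  rewrite -{1}aT => T6.
  have T7 : adjoint T (c w - c (c w), F (g w) - F (g (c w))).
    by rewrite aT; exact: (klinearB kT T1 T3).
  apply/eqP; rewrite -subr_eq0; apply/eqP.
  apply: (@regular_inj _ (c w - c (c w) - F (g (F (g w))))).
    exact: (klinearB kT T4 T5).
  have T8 : adjoint T (c w - c (c w) - F (g (F (g w))),
      F (g w) - F (g (c w)) - (F (g w) - c (F (g w)))) by exact: (adjointB T7 T6).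
  by move: T8; rewrite !opprB [_ - _ + (_ - F (g w))]addrC subrKA.
have Fg : F * g = g * F.
  have h1 := gc _ cF; apply: (bop_ext_dense dg) => _ [w _ <-].
  by have := congr1 (fun a : bop E => a w) h1; rewrite !opM.
split=> //; apply: (bop_ext_dense dg) => _ [w _ <-].
apply: kinner_ext => x; rewrite adjPr.
have -> : kinner (g w) (F x) = kinner (F w) (g x) :> compop H.
  by apply: kinner_swap; have := FT w; rewrite -{1}aT; apply; exact: FT.
by rewrite -[F (g w)]opM Fg opM (adjP g) sg.
Qed.

End Representation.

End Regular.

(** * Selfadjoint operators as quotients of bounded operators *)

Section SelfadjointPairs.
Context (R : realType) (H : hilbertType R) (E : hilbertModType H).
Context (e : H) (e1 : rnorm e = 1).
Implicit Types (x y z : E) (h : H) (f g c : bop E) (T : set (E * E)).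

(** With [A x = (g x, f x)] and [c = (A* A)^(-1)], this is the projection [A (A* A)^(-1) A*] onto
    the range of [A]. *)
Lemma pgraph_orthoproj g f c : (adj g * g + adj f * f) * c = 1 ->
  is_orthoproj (pgraph g f)
    (fun u => (g (c (adj g u.1 + adj f u.2)), f (c (adj g u.1 + adj f u.2)))).
Proof.
move=> c1 u; split; first by exists (c (adj g u.1 + adj f u.2)).
set x := c _; move=> _ [y ->]; rewrite /kinner2 /=.
rewrite -[adj g]adjK -[adj f]adjK -[g y]/(g y) in x *.
rewrite (kinner_swap (adjP g y _)) (kinner_swap (adjP f y _)) -kinnerDl.
rewrite !bopB addrACA -opprD -[adj g (g x)]opM -[adj f (f x)]opM -opD.
by rewrite -opM c1 !adjK subrr kinner0l.
Qed.

(* A selfadjoint unbounded operator written as a quotient [f / g] of commuting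
   bounded selfadjoint operators. *)
Definition sa_pair g f := [/\ adj g = g, adj f = f, f * g = g * f,
  forall h x, qf h x <= qf h (g x) + qf h (f x) & dense (range g)].

Lemma dense_perp (N : set E) x : dense N ->
  (forall y, N y -> kinner x y = 0 :> compop H) -> x = 0.
Proof.
move=> /dense_rnorm dN xN; apply: (perp_perp0 e1 xN).
by apply/closure_rnorm; exact: dN.
Qed.

Lemma dense_range_inj g x : adj g = g -> dense (range g) -> g x = 0 -> x = 0.
Proof.
move=> sg dg gx; apply: (dense_perp dg) => _ [y _ <-].
by rewrite -{1}sg -adjPr adjK gx kinner0l.
Qed.

Section Pair.
Context (g f : bop E) (gf : sa_pair g f).

Lemma sa_pair_inverse : exists c : bop E, [/\ (g * g + f * f) * c = 1,
  c * (g * g + f * f) = 1, c * g = g * c & c * f = f * c].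
Proof.
have [sg sf fg gf1 _] := gf; set d := g * g + f * f.
have sd : adj d = d by rewrite adjD !adjM sg sf.
have [|c dc cd] := bop_invertible_sn e1 (@ltr01 R) sd.
  move=> h x; rewrite mul1r (le_trans (gf1 h x))// /d !opE formDl ReD.
  by rewrite (form_adj h g) (form_adj h f) sg sf.
have comm a : a * d = d * a -> c * a = a * c.
  move=> ad; rewrite -[LHS]mulr1 -dc -!mulrA [a * (d * _)]mulrA ad.
  by rewrite -[d * a * c]mulrA mulrA cd mul1r.
exists c; split=> //; apply: comm; rewrite /d mulrDr mulrDl.
  by rewrite !mulrA; congr (_ + _); rewrite -!mulrA fg !mulrA fg.
by rewrite !mulrA; congr (_ + _); rewrite fg -!mulrA fg.
Qed.

Lemma sa_pair_adjoint : adjoint (pgraph g f) = pgraph g f.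
Proof.
have [sg sf fg _ _] := gf; have [c [dc cd cg cf]] := sa_pair_inverse.
have fgE x : f (g x) = g (f x) by rewrite -!opM fg.
have cgE x : c (g x) = g (c x) by rewrite -!opM cg.
have cfE x : c (f x) = f (c x) by rewrite -!opM cf.
have cdE x : c (g (g x)) + c (f (f x)) = x.
  by rewrite -bopD -!opM -opD -opM cd.
apply/seteqP; split=> [[y z] hyz|_ [x ->] _ _ [x' [-> ->]]] /=; last first.
  by rewrite !adjP sf sg fgE.
have fy : f y = g z.
  apply: kinner_ext => x; rewrite -{1}sf -{1}sg !adjPr.
  by apply: kinner_swap; apply: hyz; exists x.
exists (c (g y + f z)); congr (_, _).
  by rewrite -cgE !bopD -fgE -fy cdE.
by rewrite -cfE !bopD fgE fy cdE.
Qed.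

Lemma sa_pair_regular : regular (pgraph g f).
Proof.
have [sg sf fg _ dg] := gf; have [c [dc cd cg cf]] := sa_pair_inverse.
have dd : dense (dom (pgraph g f)).
  apply/dense_rnorm => x d d0; have /dense_rnorm dg' := dg.
  have [_ [w _ <-] xw] := dg' x d d0; exists (g w) => //.
  by exists (f w), w.
split; rewrite ?sa_pair_adjoint //.
- split.
  + by exists 0; rewrite !bop0.
  + by move=> _ _ [x ->] [y ->]; exists (x + y); rewrite !bopD.
  + by move=> k _ [x ->]; exists (k *: x); rewrite !bopZ.
  + by move=> k _ [x ->]; exists (kact k x); rewrite !bopK.
  + by move=> y [x [/esym/(dense_range_inj sg dg) -> ->]]; rewrite bop0.
- by rewrite -sa_pair_adjoint; exact: (adjoint_closed e1).
apply/dense_rnorm => w d d0; exists w; last by rewrite subrr rnorm0.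
have fgE x : f (g x) = g (f x) by rewrite -!opM fg.
(* The quotient [f / g] sends [g g c w] to [f g c w] and this to [f f c w]; the sum of the outer
   terms is [(g^2 + f^2) c w = w]. *)
exists (g (g (c w))), (f (g (c w))), (f (f (c w))); split.
- by exists (g (c w)).
- by exists (f (c w)); rewrite fgE.
- by rewrite -!opM -opD -mulrDl dc.
Qed.

End Pair.

(* With [r = u - P u] and [r' = u - P' u], the square of [P u - P' u] is
   [<P u, r'> + <P' u, r>], where [P u] can be replaced by its difference with
   any vector of the other graph. *)
Lemma qf2_gap g f g' f' (d : R) (P P' : E * E -> E * E) h : 0 <= d ->
  is_orthoproj (pgraph g f) P -> is_orthoproj (pgraph g' f') P' ->
  (forall x, qf h x <= qf h (g x) + qf h (f x)) ->
  (forall x, qf h x <= qf h (g' x) + qf h (f' x)) ->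
  (forall x, sn h ((g - g') x) <= d * sn h x) ->
  (forall x, sn h ((f - f') x) <= d * sn h x) ->
  forall u, qf h (P u - P' u).1 + qf h (P u - P' u).2 <=
    4 * d * (qf h u.1 + qf h u.2).
Proof.
move=> d0; pose B (u v : E * E) : R :=
  complex.Re (form h u.1 v.1 + form h u.2 v.2).
have BB u : B u u = qf h u.1 + qf h u.2 by rewrite /B ReD.
have BDl u v w : B (u + v) w = B u w + B v w.
  by rewrite /B !formDl !ReD; ring.
have BNl u w : B (- u) w = - B u w by rewrite /B !formNl !ReD !ReN opprD.
have BC u v : B u v = B v u by rewrite /B !ReD; congr (_ + _); exact: Re_formC.
have BDr u v w : B u (v + w) = B u v + B u w.
  by rewrite ![B u _]BC BDl.
have B0 u v : kinner2 u v = 0 :> compop H -> B u v = 0.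
  move=> uv; have := congr1 (fun a : compop H => hdot (a h) h) uv.
  by rewrite /kinner2 compopD compop0 hdotDl hdot0l /B /form => ->.
have B_ge0 u : 0 <= B u u by rewrite BB addr_ge0 ?qf_ge0.
have BE u v : B u v = complex.Re (form h u.1 v.1) + complex.Re (form h u.2 v.2).
  by rewrite /B ReD.
clearbody B.
have key (g0 f0 g1 f1 : bop E) (P0 P1 : E * E -> E * E) u :
    is_orthoproj (pgraph g0 f0) P0 -> is_orthoproj (pgraph g1 f1) P1 ->
    (forall x, qf h x <= qf h (g0 x) + qf h (f0 x)) ->
    (forall x, sn h ((g0 - g1) x) <= d * sn h x) ->
    (forall x, sn h ((f0 - f1) x) <= d * sn h x) ->
    B (P0 u) (u - P1 u) <= 2 * d * B u u.
  move=> oP0 oP1 low hg hf; have [[x Px] pP0] := oP0 u; have [P1u pP1] := oP1 u.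
  have pyth P2 g2 f2 v : is_orthoproj (pgraph g2 f2) P2 ->
      B v v = B (P2 v) (P2 v) + B (v - P2 v) (v - P2 v).
    move=> oP2; have [S2 p2] := oP2 v.
    have ab0 := B0 _ _ (p2 _ S2); rewrite -{1 2}(subrK (P2 v) v).
    move: (P2 v) (v - P2 v) ab0 => b a ab0.
    by rewrite BDl !BDr [B b a]BC ab0 addr0 add0r addrC.
  have U0 := B_ge0 u; set U := B u u in U0 *.
  have xU : sn h x <= Num.sqrt U.
    apply: sn_le (sqrtr_ge0 _) _; rewrite sqr_sqrtr// (le_trans (low x))//.
    have := pyth _ _ _ u oP0; rewrite Px (BB (_, _)) /= -/U => ->.
    by rewrite lerDl B_ge0.
  have rU : B (u - P1 u) (u - P1 u) <= U.
    by rewrite /U (pyth _ _ _ u oP1) lerDr B_ge0.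
  set r := u - P1 u in rU pP1 *.
  have r1 : sn h r.1 <= Num.sqrt U.
    apply: sn_le (sqrtr_ge0 _) _; rewrite sqr_sqrtr// (le_trans _ rU)//.
    by rewrite BB lerDl qf_ge0.
  have r2 : sn h r.2 <= Num.sqrt U.
    apply: sn_le (sqrtr_ge0 _) _; rewrite sqr_sqrtr// (le_trans _ rU)//.
    by rewrite BB lerDr qf_ge0.
  have -> : B (P0 u) r = B ((g0 - g1) x, (f0 - f1) x) r.
    have -> : P0 u = ((g0 - g1) x, (f0 - f1) x) + (g1 x, f1 x).
      by rewrite Px; congr (_, _); rewrite !opE subrK.
    by rewrite BDl [B (g1 x, f1 x) r]BC (B0 r) ?addr0// pP1//; exists x.
  have UU : U = Num.sqrt U * Num.sqrt U by rewrite -expr2 sqr_sqrtr.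
  rewrite BE [2 * d]mulr_natl mulr2n mulrDl UU mulrA.
  have bd a v : sn h a <= d * sn h x -> sn h v <= Num.sqrt U ->
      complex.Re (form h a v) <= d * Num.sqrt U * Num.sqrt U.
    move=> ha hv; rewrite (le_trans (Re_form_cs _ _ _))// ler_pM ?sn_ge0//.
    by rewrite (le_trans ha)// ler_wpM2l.
  by apply: lerD; apply: bd; rewrite /= ?hg ?hf.
move=> oP oP' low low' hg hf u.
have [SP pP] := oP u; have [SP' pP'] := oP' u.
have DE : P u - P' u = (u - P' u) - (u - P u) by rewrite opprB [RHS]addrC subrKA.
have -> : qf h (P u - P' u).1 + qf h (P u - P' u).2 =
    B (P u) (u - P' u) + B (P' u) (u - P u).
  have := B0 _ _ (pP _ SP); have := B0 _ _ (pP' _ SP').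
  rewrite -BB {2}DE; move: (P u) (P' u) (u - P u) (u - P' u) => v w a b.
  move=> bw av; rewrite BDl BNl !BDr [B v (- a)]BC [B w (- a)]BC !BNl av.
  by rewrite [B w b]BC bw [B a w]BC; ring.
rewrite -BB (_ : 4 * d * B u u = 2 * d * B u u + 2 * d * B u u); last by ring.
rewrite lerD//; first exact: (key g f g' f').
apply: (key g' f' g f) => // x.
  by have := hg x; rewrite -snN !opE opprB.
by have := hf x; rewrite -snN !opE opprB.
Qed.

(** The square of the difference of the projections is bounded by [4 d], hence the square root. *)
Lemma gap_le (t s : regop E) g f g' f' (d : R) (P P' : E * E -> E * E) :
  0 <= d -> graph t = pgraph g f -> graph s = pgraph g' f' ->
  is_orthoproj (pgraph g f) P -> is_orthoproj (pgraph g' f') P' ->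
  (forall h x, qf h x <= qf h (g x) + qf h (f x)) ->
  (forall h x, qf h x <= qf h (g' x) + qf h (f' x)) ->
  (forall x, rnorm ((g - g') x) <= d * rnorm x) ->
  (forall x, rnorm ((f - f') x) <= d * rnorm x) ->
  (gap t s <= (2 * Num.sqrt d)%:E)%E.
Proof.
move=> d0 tE sE oP oP' low low' /(sn_bound e1) hg /(sn_bound e1) hf.
apply: ge_ereal_sup => _ [u /= u1 <-]; rewrite lee_fin tE sE.
rewrite (orthoproj_uniq oP) (orthoproj_uniq oP').
apply: norm2_le => [|h h1]; first by rewrite mulr_ge0 ?sqrtr_ge0.
rewrite exprMn sqr_sqrtr//.
rewrite (le_trans (qf2_gap d0 oP oP' (low h) (low' h) (hg h) (hf h) u))//.
rewrite -natrX ler_piMr ?mulr_ge0//.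
by rewrite (le_trans (qf2_le_norm2 _ h1))// expr_le1// norm2_ge0.
Qed.

Lemma regop_eq (t s : regop E) : graph t = graph s -> t = s.
Proof.
by case: t s => [T hT] [S hS] /= TS; rewrite -{}TS in hS *; congr Regop; exact: Prop_irrelevance.
Qed.

(** Paths that are Hoelder continuous of exponent 1/2 for the gap, the modulus that [gap_le] gives
    for Lipschitz families of pairs. A numerical modulus makes reversal and concatenation
    elementary. *)
Definition linked (A : set (regop E)) (t s : regop E) :=
  exists (p : R -> regop E) (C : R), [/\ 0 <= C, p 0 = t, p 1 = s,
    forall r : R, 0 <= r <= 1 -> A (p r) &
    forall r r' : R, 0 <= r <= 1 -> 0 <= r' <= 1 ->
      (gap (p r) (p r') <= (C * Num.sqrt `|r - r'|)%:E)%E].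

Lemma linked_sym A t s : linked A t s -> linked A s t.
Proof.
move=> [p [C [C0 p0 p1 Ap pC]]]; exists (fun r => p (1 - r)), C; split=> //.
- by rewrite subr0.
- by rewrite subrr.
- by move=> r r01; apply: Ap; lra.
- move=> r r' r01 r01'; have := pC (1 - r) (1 - r').
  rewrite (_ : 1 - r - (1 - r') = r' - r); last by ring.
  by rewrite distrC; apply; lra.
Qed.

Lemma linked_trans A t s r : linked A t s -> linked A s r -> linked A t r.
Proof.
move=> [p [C [C0 p0 p1 Ap pC]]] [q [D [D0 q0 q1 Aq qD]]].
pose w (x : R) := if x <= 2^-1 then p (2 * x) else q (2 * x - 1).
have w0 : w 0 = t by rewrite /w invr_ge0 ler0n mulr0.
have w1 : w 1 = r by rewrite /w lt_geF ?invf_lt1 ?ltr1n// mulr1 -[2]/(1 + 1) addrK.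
have wh : w 2^-1 = s by rewrite /w lexx mulfV ?pnatr_eq0.
have sq (x : R) : 0 <= x -> Num.sqrt (2 * x) = Num.sqrt 2 * Num.sqrt x.
  by move=> x0; rewrite sqrtrM.
have lo (x y : R) : 0 <= x -> x <= y -> y <= 2^-1 ->
    (gap (w x) (w y) <= (C * (Num.sqrt 2 * Num.sqrt (y - x)))%:E)%E.
  move=> x0 xy y2; rewrite /w y2 (le_trans xy y2); have := pC (2 * x) (2 * y).
  rewrite distrC -mulrBr ger0_norm; last by rewrite mulr_ge0 ?subr_ge0.
  by rewrite (sq (y - x)) ?subr_ge0//; apply; lra.
have hi (x y : R) : 2^-1 <= x -> x <= y -> y <= 1 ->
    (gap (w x) (w y) <= (D * (Num.sqrt 2 * Num.sqrt (y - x)))%:E)%E.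
  have [->|x2] := eqVneq x 2^-1; last first.
    move=> hx xy y1; have xl : 2^-1 < x by rewrite lt_neqAle eq_sym x2.
    rewrite /w (lt_geF xl) (lt_geF (lt_le_trans xl xy)); have := qD (2 * x - 1) (2 * y - 1).
    rewrite distrC (_ : 2 * y - 1 - (2 * x - 1) = 2 * (y - x)); last by ring.
    rewrite ger0_norm; last by rewrite mulr_ge0 ?subr_ge0.
    by rewrite (sq (y - x)) ?subr_ge0//; apply; lra.
  move=> _ hy y1; have [->|y2] := eqVneq y 2^-1.
    by rewrite gapxx lee_fin !mulr_ge0 ?sqrtr_ge0.
  have yl : 2^-1 < y by rewrite lt_neqAle eq_sym y2.
  rewrite wh -q0 /w (lt_geF yl).
  have := qD 0 (2 * y - 1).
  rewrite sub0r normrN ger0_norm; last by lra.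
  rewrite (_ : 2 * y - 1 = 2 * (y - 2^-1)); last by field.
  by rewrite (sq (y - 2^-1)) ?subr_ge0//; apply; lra.
have key (x y : R) : 0 <= x -> x <= y -> y <= 1 ->
    (gap (w x) (w y) <= ((C + D) * (Num.sqrt 2 * Num.sqrt (y - x)))%:E)%E.
  move=> x0 xy y1; have [y2|y2] := leP y 2^-1.
    rewrite (le_trans (lo _ _ _ _ _))// lee_fin ler_wpM2r ?lerDl//.
  have [x2|x2] := leP 2^-1 x.
    rewrite (le_trans (hi _ _ _ _ _))// lee_fin ler_wpM2r ?lerDr//.
  rewrite (le_trans (gap_triangle (w 2^-1) _ _))//.
  rewrite (le_trans (leeD (lo _ _ x0 (ltW x2) (lexx _)) (hi _ _ (lexx _) (ltW y2) y1)))//.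
  rewrite -EFinD lee_fin mulrDl lerD// !ler_wpM2l ?sqrtr_ge0//.
    by rewrite ler_wsqrtr// lerD2r ltW.
  by rewrite ler_wsqrtr// lerD2l lerN2 ltW.
(* Each half is traversed at double speed, whence the factor [Num.sqrt 2]. *)
exists w, ((C + D) * Num.sqrt 2); split=> //.
- by rewrite mulr_ge0 ?sqrtr_ge0// addr_ge0.
- move=> x x01; rewrite /w; case: leP => x2; [apply: Ap|apply: Aq]; lra.
move=> x y x01 y01; have [xy|yx] := leP x y.
  by rewrite distrC ger0_norm ?subr_ge0// -mulrA key//; lra.
by rewrite ger0_norm ?subr_ge0 ?(ltW yx)// gapC -mulrA key//; lra.
Qed.

Lemma linked_path (A : set (regop E)) t s : linked A t s -> exists p : R -> regop E,
  [/\ {within `[0, 1], continuous p}, p 0 = t, p 1 = s & p @` `[0, 1] `<=` A].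
Proof.
move=> [p [C [C0 p0 p1 Ap pC]]].
(* Nothing is known about [p] outside [[0, 1]]; composing with the 1-Lipschitz retraction gives a
   map continuous on the whole line. *)
pose clamp (r : R) := Num.max 0 (Num.min r 1).
have c01 r : 0 <= clamp r <= 1.
  by rewrite /clamp le_max lexx/= ge_max ler01/= ge_min lexx orbT.
have cid r : 0 <= r <= 1 -> clamp r = r.
  by move=> /andP[r0 r1]; rewrite /clamp min_l// max_r.
have clip r r' : `|clamp r - clamp r'| <= `|r - r'|.
  have := ler_norm (r - r'); have := ler_norm (r' - r); rewrite distrC.
  move: `|r - r'| => d d1 d2; rewrite ler_norml /clamp /Num.max /Num.min.
  case: (ltP r 1) => ?; case: (ltP r' 1) => ?; case: ltP => ?; case: ltP => ?;
    by apply/andP; split; lra.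
exists (fun r => p (clamp r)); split; rewrite ?cid ?lexx ?ler01//; last first.
  by move=> _ [r _ <-]; exact: Ap.
apply: continuous_subspaceT => r B /nbhs_ballP[d /= d0 dB].
have C1 : 0 < C + 1 by rewrite ltr_wpDl.
have d2 : 0 < (d / (C + 1)) ^+ 2 by rewrite exprn_gt0// divr_gt0.
apply/nbhs_ballP; exists ((d / (C + 1)) ^+ 2) => //= r' /=.
rewrite -ball_normE /= => rr'; apply: dB; rewrite gap_ballE /=.
rewrite (le_lt_trans (pC _ _ (c01 r) (c01 r')))// lte_fin.
rewrite (@le_lt_trans _ _ (C * (d / (C + 1))))//.
  have dC : 0 < d / (C + 1) by rewrite divr_gt0.
  rewrite ler_wpM2l// -(gtr0_norm dC) -[leRHS]sqrtr_sqr ler_wsqrtr//.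
  by rewrite (le_trans (clip r r'))// ltW.
by rewrite mulrA ltr_pdivrMr// mulrC ltr_pM2l// ltrDl.
Qed.

Lemma affine_linked (A : set (regop E)) (t s : regop E) (g0 g1 f0 f1 : bop E) :
  (forall r : R, 0 <= r <= 1 -> sa_pair (g0 + r%:C *: g1) (f0 + r%:C *: f1)) ->
  (forall (r : R) (q : regop E), 0 <= r <= 1 ->
     graph q = pgraph (g0 + r%:C *: g1) (f0 + r%:C *: f1) -> A q) ->
  graph t = pgraph g0 f0 -> graph s = pgraph (g0 + g1) (f0 + f1) ->
  linked A t s.
Proof.
move=> gf Agf tE sE.
(* Outside [[0, 1]] the value is the arbitrary default [t]. *)
have /choice[p hp] (r : R) : exists q : regop E, 0 <= r <= 1 ->
    graph q = pgraph (g0 + r%:C *: g1) (f0 + r%:C *: f1).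
  have [r01|nr] := boolP (0 <= r <= 1); last by exists t.
  by exists (Regop (sa_pair_regular (gf r r01))).
have [C1 C10 hC1] := bop_bound g1; have [C2 C20 hC2] := bop_bound f1.
pose C := C1 + C2; have C0 : 0 <= C by rewrite addr_ge0.
exists p, (2 * Num.sqrt C); split.
- by rewrite mulr_ge0 ?sqrtr_ge0.
- by apply: regop_eq; rewrite hp ?lexx ?ler01// tE !scale0r !addr0.
- by apply: regop_eq; rewrite hp ?lexx ?ler01// sE !scale1r.
- by move=> r r01; apply: (Agf r) => //; exact: hp.
move=> r r' r01 r01'; rewrite -mulrA -sqrtrM//.
have proj (x : R) : 0 <= x <= 1 -> exists P,
    is_orthoproj (pgraph (g0 + x%:C *: g1) (f0 + x%:C *: f1)) P.
  move=> /gf gfx; have [c [dc _ _ _]] := sa_pair_inverse gfx.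
  have [sg sf _ _ _] := gfx.
  by eexists; apply: pgraph_orthoproj; rewrite sg sf; exact: dc.
have [P oP] := proj r r01; have [P' oP'] := proj r' r01'.
have [_ _ _ low _] := gf r r01; have [_ _ _ low' _] := gf r' r01'.
have lip (a b : bop E) (K : R) : (forall x, rnorm (b x) <= K * rnorm x) -> K <= C ->
    forall x, rnorm ((a + r%:C *: b - (a + r'%:C *: b)) x) <= C * `|r - r'| * rnorm x.
  move=> hK KC x; rewrite opprD addrACA subrr add0r -scalerBl opZ rnormZC.
  rewrite (_ : complex.Re `|r%:C - r'%:C| = `|r - r'|); last first.
    by rewrite -rmorphB normc_def /= expr0n addr0 sqrtr_sqr.
  rewrite mulrAC [leRHS]mulrC ler_wpM2l// (le_trans (hK x))//.
  by rewrite ler_wpM2r ?rnorm_ge0.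
apply: (gap_le _ (hp r r01) (hp r' r01') oP oP' low low').
- by rewrite mulr_ge0.
- by apply: (lip _ _ C1) => //; rewrite lerDl.
- by apply: (lip _ _ C2) => //; rewrite lerDr.
Qed.

End SelfadjointPairs.

(** * Compact and Fredholm operators *)

Section CompactFredholm.
Context (R : realType) (H : hilbertType R) (E : hilbertModType H).
Implicit Types (x y z : E) (h : H) (a b c f g k : bop E) (s : seq (E * E)).

Lemma kinner_rank1 x y z w :
  kinner (rank1 x y z) w = kinner z (rank1 y x w) :> compop H.
Proof.
apply: compopP => h; apply: hdot_ext => l.
by rewrite /rank1 kinner_act kcompE !kinnerC kinner_act kcompE.
Qed.

Context (e : H) (e1 : rnorm e = 1).

Lemma rank1_bound x y z : rnorm (rank1 x y z) <= rnorm x * rnorm y * rnorm z.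
Proof.
have snr h : rnorm h <= 1 -> sn h (rank1 x y z) <=
    Num.sqrt (rnorm z * (rnorm x * (rnorm y * rnorm (rank1 x y z)))).
  move=> h1; have p0 : 0 <= rnorm z * (rnorm x * (rnorm y * rnorm (rank1 x y z))).
    by rewrite !mulr_ge0 ?rnorm_ge0.
  apply: sn_le (sqrtr_ge0 _) _; rewrite sqr_sqrtr// /qf /form.
  rewrite {1}/rank1 kinner_act kcompE (le_trans (Re_le_norm _))//.
  rewrite -lecR Re_normE (le_trans (hdot_cs _ _))// -!rnormE -rmorphM lecR.
  set w := rank1 x y z.
  rewrite (@le_trans _ _ (rnorm ((kinner z x : compop H) ((kinner y w : compop H) h))))//.
    by rewrite ler_piMr ?rnorm_ge0.
  rewrite (le_trans (kinner_le e1 _ _ _))// !ler_wpM2l ?rnorm_ge0//.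
  rewrite (le_trans (kinner_le e1 _ _ _))// ler_wpM2l ?rnorm_ge0//.
  by rewrite ler_piMr ?rnorm_ge0.
set w := rank1 x y z in snr *.
have [r0|r0] := eqVneq (rnorm w) 0; first by rewrite r0 !mulr_ge0 ?rnorm_ge0.
have rp : 0 < rnorm w by rewrite lt0r r0 rnorm_ge0.
have := rnorm_le_sn (sqrtr_ge0 _) snr.
rewrite -(@ler_pXn2r _ 2)// ?nnegrE ?sqrtr_ge0 ?rnorm_ge0//.
rewrite sqr_sqrtr ?mulr_ge0 ?rnorm_ge0// expr2 !mulrA ler_pM2r//.
by move=> /le_trans; apply; rewrite [leRHS]mulrC mulrA.
Qed.

Definition brank1 x y : bop E :=
  mkbop (adjointableI (fun z w => kinner_rank1 x y z w) (rank1_bound x y)).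

Lemma adj_brank1 x y : adj (brank1 x y) = brank1 y x.
Proof. by apply: adj_uniq => z w; exact: kinner_rank1. Qed.

Lemma brank1Ml a x y : a * brank1 x y = brank1 x (a y).
Proof. by apply: bopP => z; rewrite opM /= /rank1 bopK. Qed.

Lemma brank1Mr a x y : brank1 x y * a = brank1 (adj a x) y.
Proof. by apply: bopP => z; rewrite opM /= /rank1 adjP. Qed.

(** The scalar coefficients of [finite_rank] are absorbed into the second vectors. *)
Definition frank s : bop E := \sum_(u <- s) brank1 u.1 u.2.

Lemma frank_cat s s' : frank (s ++ s') = frank s + frank s'.
Proof. by rewrite /frank big_cat. Qed.

Lemma frankMl a s : a * frank s = frank [seq (u.1, a u.2) | u <- s].
Proof.
rewrite /frank big_map mulr_sumr; apply: eq_bigr => u _.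
by rewrite brank1Ml.
Qed.

Lemma frankMr a s : frank s * a = frank [seq (adj a u.1, u.2) | u <- s].
Proof.
rewrite /frank big_map mulr_suml; apply: eq_bigr => u _.
by rewrite brank1Mr.
Qed.

Lemma frankE s z : frank s z = \sum_(u <- s) rank1 u.1 u.2 z.
Proof.
elim: s => [|u s IH]; first by rewrite /frank !big_nil.
by rewrite /frank !big_cons opE -IH.
Qed.

Lemma frank_finite s : finite_rank (frank s).
Proof.
exists (size s), (fun=> 1), (fun i => (tnth (in_tuple s) i).1),
  (fun i => (tnth (in_tuple s) i).2) => z.
by rewrite frankE big_tnth; apply: eq_bigr => i _; rewrite scale1r.
Qed.

Lemma finite_rank_frank (f : E -> E) : finite_rank f ->
  exists s, forall z, f z = frank s z.
Proof.
move=> [n [c [x [y fE]]]]; exists [seq (x i, c i *: y i) | i <- enum 'I_n] => z.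
rewrite fE frankE big_map big_enum /=; apply: eq_bigr => i _.
by rewrite /rank1 kactZr.
Qed.

Definition cpt a := compact_adjointable a.

Lemma cptP a : cpt a <-> forall d : R, 0 < d ->
  exists s, forall x, rnorm ((a - frank s) x) <= d * rnorm x.
Proof.
split=> [[_ h] d d0|h]; last first.
  split; first exact: bop_adj.
  move=> d d0; have [s hs] := h _ (divr_gt0 d0 (ltr0n R 2)).
  exists (frank s); first exact: frank_finite.
  apply: (@le_lt_trans _ _ (d / 2)%:E).
    by apply: opnorm_le => // ; rewrite divr_ge0// ltW.
  by rewrite lte_fin ltr_pdivrMr// mulr_natr mulr2n ltrDr.
have [g /finite_rank_frank[s gs] ag] := h d d0; exists s.
have gE : (fun x => a x - g x) = (a - frank s : bop E).
  by apply: funext => x; rewrite gs.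
apply: opnorm_ub => [c x c0|]; first by rewrite bopZ rnormZ.
by rewrite -gE ltW.
Qed.

Lemma cptD a b : cpt a -> cpt b -> cpt (a + b).
Proof.
move=> /cptP ca /cptP cb; apply/cptP => d d0.
have [s hs] := ca _ (divr_gt0 d0 (ltr0n R 2)).
have [s' hs'] := cb _ (divr_gt0 d0 (ltr0n R 2)).
exists (s ++ s') => x; rewrite frank_cat opprD addrACA opE.
rewrite (le_trans (rnormD _ _))// [d in leRHS]splitr mulrDl.
by apply: lerD; [exact: hs|exact: hs'].
Qed.

Lemma cptMl a k : cpt k -> cpt (a * k).
Proof.
move=> /cptP ck; apply/cptP => d d0; have [C C0 aC] := bop_bound a.
have C1 : 0 < C + 1 by rewrite ltr_wpDl.
have [s hs] := ck _ (divr_gt0 d0 C1).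
exists [seq (u.1, a u.2) | u <- s] => x.
rewrite -frankMl -mulrBr opM (le_trans (aC _))//.
rewrite (@le_trans _ _ ((C + 1) * (d / (C + 1) * rnorm x)))//.
  by rewrite ler_pM ?rnorm_ge0// lerDl.
by rewrite mulrA mulrCA mulfV ?mulr1// gt_eqF.
Qed.

Lemma cptMr a k : cpt k -> cpt (k * a).
Proof.
move=> /cptP ck; apply/cptP => d d0; have [C C0 aC] := bop_bound a.
have C1 : 0 < C + 1 by rewrite ltr_wpDl.
have [s hs] := ck _ (divr_gt0 d0 C1).
exists [seq (adj a u.1, u.2) | u <- s] => x.
rewrite -frankMr -mulrBl opM (le_trans (hs _))//.
rewrite (@le_trans _ _ (d / (C + 1) * ((C + 1) * rnorm x)))//.
  apply: ler_wpM2l; first by rewrite divr_ge0// ltW.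
  by rewrite (le_trans (aC _))// ler_wpM2r ?rnorm_ge0// lerDl.
by rewrite mulrA divfK// gt_eqF.
Qed.

Lemma cptN k : cpt k -> cpt (- k).
Proof. by rewrite -[- k]mulN1r; exact: cptMl. Qed.

Lemma cptB a b : cpt a -> cpt b -> cpt (a - b).
Proof. by move=> ca cb; apply: cptD => //; exact: cptN. Qed.

Lemma cptZ (t : R[i]) k : cpt k -> cpt (t *: k).
Proof. by move=> ck; rewrite -[k]mul1r op_scalerAl; exact: cptMl. Qed.

Lemma cpt_frank s : cpt (frank s).
Proof.
apply/cptP => d d0; exists s => x.
by rewrite subrr op0 rnorm0 mulr_ge0 ?rnorm_ge0 ?ltW.
Qed.

Lemma cpt0 : cpt 0.
Proof. by have := cpt_frank [::]; rewrite /frank big_nil. Qed.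

Lemma cpt_id_sub a : cpt (a - 1) -> compact_adjointable (fun x => a x - x).
Proof. by []. Qed.

Lemma closed_graph_of b : closed (graph_of b).
Proof.
move=> [x y] /closure_lim2[u [v [uv ux vy]]]; rewrite /graph_of /=.
apply: lim_to_uniq vy _ => d d0; have [N hN] := lim_bop b ux d0.
by exists N => n /hN; rewrite (_ : v n = b (u n))//; exact: uv.
Qed.

(** The unbounded operator [f g^(-1)] has the bounded inverse [g b], which serves as parametrix on
    both sides: one product is the identity, the other the identity on the dense range of [g]. *)
Lemma fredholm_invertible g f b : dense (range g) -> (forall x, g x = 0 -> x = 0) ->
  f * b = 1 -> b * f = 1 -> fredholm (pgraph g f).
Proof.
move=> dg ig fb bf; have fbE x : f (b x) = x by rewrite -opM fb.
have bfE x : b (f x) = x by rewrite -opM bf.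
have c0 : compact_adjointable (fun x => (1 : bop E) x - x).
  by apply: cpt_id_sub; rewrite subrr; exact: cpt0.
split; exists (g * b : bop E); try exact: bop_adj.
  exists (1 : bop E); last by split; first exact: bop_adj.
  apply/seteqP; split.
    have := @closed_graph_of 1; rewrite closure_id => ->; apply: closure_subset.
    by move=> [x y] /= [_ [w [-> ->]] ->]; rewrite /graph_of /= bfE.
  move=> [x y] xy; apply/closure_rnorm2 => d d0.
  have /dense_rnorm dg' := dg; have [_ [w _ <-] xw] := dg' x d d0.
  exists (g w), (g w); split=> //; last by rewrite (_ : y = x).
  by exists (f w) => /=; [exists w|rewrite bfE].
exists (1 : bop E); last by split; first exact: bop_adj.
rewrite (_ : [set xy | _] = graph_of (1 : bop E)).
  by apply/esym/closure_id; exact: closed_graph_of.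
apply/seteqP; split=> [[x y] /= [w [gw ->]]|[x y] xy] /=; last first.
  by rewrite (_ : y = x)//; exists (b x); rewrite fbE.
rewrite /graph_of /=.
have /ig/eqP : g (b x - w) = 0 by rewrite bopB -gw subrr.
by rewrite subr_eq0 => /eqP <-; rewrite fbE.
Qed.

Lemma fredholm_bounded f b : cpt (f * b - 1) -> cpt (b * f - 1) ->
  fredholm (pgraph 1 f).
Proof.
move=> cfb cbf; split; exists (b : bop E); try exact: bop_adj.
  exists (b * f : bop E); last by split; [exact: bop_adj|exact: (cpt_id_sub cbf)].
  rewrite (_ : [set xy | _] = graph_of (b * f : bop E)).
    by apply/esym/closure_id; exact: closed_graph_of.
  apply/seteqP; split=> [[x y] /= [_ [w [-> ->]] ->]|[x y] xy] //=.
  by exists (f x) => //; exists x.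
exists (f * b : bop E); last by split; [exact: bop_adj|exact: (cpt_id_sub cfb)].
rewrite (_ : [set xy | _] = graph_of (f * b : bop E)).
  by apply/esym/closure_id; exact: closed_graph_of.
apply/seteqP; split=> [[x y] /= [w [bx ->]]|[x y] xy] /=.
  by rewrite /graph_of /= bx.
by exists (b x); congr (_, _).
Qed.

(* With [g g* + f* f = 1], any right parametrix [G'] of the unbounded operator
   [f g^(-1)] turns into the right parametrix [g* G' + f* (T G')] of [f]. *)
Lemma fredholm_right (g f : bop E) : adj g * g + adj f * f = 1 ->
  closed (pgraph g f) -> fredholm (pgraph g f) ->
  exists b : bop E, cpt (f * b - 1).
Proof.
move=> gf1 cT [_ [G' /adjointable_opP aG [B cG [/adjointable_opP aB cB]]]].
pose G := Bop aG; pose b := Bop aB.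
exists (adj g * G + adj f * b).
suff -> : f * (adj g * G + adj f * b) = b by exact: cB.
apply: bopP => x; rewrite !opM opD !opM.
have [w Gx bx] : exists2 w, G x = g w & b x = f w.
  have : closure [set xy | pgraph g f (G' xy.1, xy.2)] (x, B x) by rewrite cG.
  move=> /closure_lim2[u [v [uv ux vy]]].
  have : pgraph g f (G x, B x).
    by apply: (lim_to_closed2 cT (lim_bop G ux) vy) => n; exact: uv.
  by move=> [w [Gx bx]]; exists w.
by rewrite Gx bx -[adj g (g w)]opM -[adj f (f w)]opM -opD gf1.
Qed.

End CompactFredholm.

(** * Deformation to a symmetry *)

Section Symmetry.
Context (R : realType) (H : hilbertType R) (E : hilbertModType H).
Context (e : H) (e1 : rnorm e = 1).
Implicit Types (x y z : E) (h : H) (a b c d f g k q r : bop E).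

Lemma commrZ (t : R[i]) a b : GRing.comm a b -> GRing.comm a (t *: b).
Proof. by rewrite /GRing.comm -op_scalerAr -op_scalerAl => ->. Qed.

(** An operator commuting with [d] preserves the closure of its range; being selfadjoint, it
    preserves the complement too. *)
Lemma proj_range_comm q d a : is_proj q ->
  (forall x, closure (range d) (q x) /\ (closure (range d) x -> q x = x)) ->
  adj a = a -> GRing.comm a d -> GRing.comm a q.
Proof.
move=> [sq qq] hq sa ad; have inv x : closure (range d) x -> closure (range d) (a x).
  move=> /closure_lim[u [du ux]].
  apply: (lim_to_closed (@closed_closure _ _) (lim_bop a ux)) => n.
  apply: subset_closure; have [y _ dy] := du n; exists (a y) => //=.
  by rewrite -dy -!opM ad.
have aq : q * a * q = a * q.
  by apply: bopP => x; rewrite !opM; apply: (proj2 (hq _)); apply: inv; case: (hq x).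
have qaq : adj (q * a * q) = q * a * q by rewrite !adjM sq sa mulrA.
by rewrite /GRing.comm -{1}aq -qaq aq adjM sq sa.
Qed.

(* [q + q - 1] is the sign of [a], with value [-1] on the kernel. *)
Lemma exists_sign a : adj a = a -> (forall h x, sn h (a x) <= sn h x) ->
  exists q, [/\ is_proj q,
    forall h x, 0 <= complex.Re (form h ((q + q - 1) (a x)) x) &
    forall b, adj b = b -> GRing.comm b a -> GRing.comm b q].
Proof.
move=> sa a1; have saa : adj (a * a) = a * a by rewrite adjM sa.
have aa1 h x : sn h ((1 - a * a) x) <= sn h x.
  apply: sn_le (sn_ge0 _ _) _; rewrite sn_sqr opD op1 opN qfB opM.
  have -> : complex.Re (form h x (a (a x))) = qf h (a x).
    by rewrite -{1}sa -form_adj.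
  have : qf h (a (a x)) <= qf h (a x).
    by rewrite -!sn_sqr ler_pXn2r// ?nnegrE ?sn_ge0.
  by have := qf_ge0 h (a x); lra.
have [r [sr rr r0 rc]] := bop_sqrt e1 saa aa1.
have ra : GRing.comm a r by apply: rc; rewrite mulrA.
(* Since [r] is the modulus of [a], [a d = r d]: on the closed range of [d] the operators [a] and
   [r] agree, and on its complement, the kernel of [d], they are opposite. *)
pose d := a + r; have sd : adj d = d by rewrite adjD sa sr.
have [q pq hq] := exists_proj e1 (ksubmod_closure e1 (ksubmod_range d))
  (@closed_closure _ (range d)).
have qc b : adj b = b -> GRing.comm b a -> GRing.comm b q.
  move=> sb ba; apply: (proj_range_comm pq hq sb); apply: commrD => //.
  by apply: rc; rewrite mulrA ba -mulrA ba mulrA.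
have [sq qq] := pq.
have rq : GRing.comm r q by apply: qc => //; exact: commr_sym.
have aq : GRing.comm a q by apply: qc.
exists q; split=> // h x.
have qpos y : closure (range d) y -> a y = r y.
  move=> /closure_lim[u [du uy]]; apply: (lim_to_uniq (lim_bop a uy)) => t t0.
  have [N hN] := lim_bop r uy t0; exists N => n /hN /=; have [w _ dw] := du n.
  by rewrite -dw -!opM /d !mulrDr rr (ra : a * r = r * a) [r * a + _]addrC.
have aqE : a * q = r * q.
  by apply: bopP => y; rewrite !opM; apply: qpos; case: (hq y).
have qd0 y : q y = 0 -> a y = - r y.
  move=> qy; apply/eqP; rewrite -addr_eq0 -opD -/d; apply/eqP.
  rewrite -{1}sd; apply: perp_range => w.
  have dw : q (d w) = d w by apply: (proj2 (hq _)); apply: subset_closure; exists w.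
  by rewrite -dw -{1}sq -adjPr adjK qy kinner0l.
have aqE' : a * (1 - q) = - (r * (1 - q)).
  apply: bopP => y; rewrite opN !opM; apply: qd0.
  by rewrite -opM mulrBr mulr1 qq subrr.
have -> : (q + q - 1) (a x) = r x; last exact: r0.
rewrite -opM; congr (bop_fun _ x).
have -> : q + q - 1 = q - (1 - q) by rewrite opprB addrA.
have aq2 : (1 - q) * a = a * (1 - q).
  by rewrite mulrBl mulrBr mul1r mulr1 (aq : a * q = q * a).
rewrite mulrBl aq2 aqE' opprK -(aq : a * q = q * a) aqE -mulrDr.
by rewrite addrC subrK mulr1.
Qed.

End Symmetry.

Section StraightenToSymmetry.
Context (R : realType) (H : hilbertType R) (E : hilbertModType H).
Context (e : H) (e1 : rnorm e = 1).
Implicit Types (x y z : E) (h : H) (a b c d f g k q r : bop E).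

Lemma bop_invertible_qf a (m : R) : 0 < m -> adj a = a ->
  (forall h x, m ^+ 2 * qf h x <= qf h (a x)) ->
  exists2 b, a * b = 1 & b * a = 1.
Proof.
move=> m0 sa am; suff am' x : m * rnorm x <= rnorm (a x).
  by apply: (bop_invertible e1 m0); rewrite ?sa.
apply: rnorm_ge_sn_mul => [|h]; first exact: ltW.
rewrite -(@ler_pXn2r _ 2)// ?nnegrE ?mulr_ge0 ?sn_ge0 ?(ltW m0)//.
by rewrite exprMn !sn_sqr.
Qed.

Lemma proj_symmetry q : is_proj q ->
  adj (q + q - 1) = q + q - 1 /\ (q + q - 1) * (q + q - 1) = 1.
Proof.
move=> [sq qq]; rewrite adjB adjD sq adj1; split=> //.
rewrite mulrBr mulr1 mulrBl mul1r mulrDr !mulrDl qq.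
by rewrite addrK opprB addrC subrK.
Qed.

Lemma symmetry_qf a h x : adj a = a -> a * a = 1 -> qf h (a x) = qf h x.
Proof. by move=> sa aa; rewrite /qf form_adj sa -opM aa. Qed.

(* With [J] the sign of [t = f / g], the segment from [(g, f)] to
   [(g + J f, f + J g)] runs through [(t + s J) / (1 + s |t|)]. *)
Lemma linked_symmetry (t : regop E) : FredSR E t ->
  exists q (s : regop E), [/\ is_proj q, graph s = pgraph 1 (q + q - 1) &
    linked (FredSR E) t s].
Proof.
move=> ft; have [ft1 ft2] := ft.
have [g [f [[tE sg gf1 dg] /(_ ft2) [sf fg]]]] := regular_rep e1 (graph_regular t).
rewrite sf in gf1.
have sfg : adj (f * g) = f * g by rewrite adjM sf sg.
have qfgf h x : qf h x = qf h (g x) + qf h (f x).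
  rewrite /qf -{1}[x]op1 -gf1 opD formDl ReD !opM.
  by rewrite (form_adj h g) (form_adj h f) sg sf.
have f1 h x : sn h (f x) <= sn h x.
  by apply: sn_le (sn_ge0 _ _) _; rewrite sn_sqr (qfgf h x) lerDr qf_ge0.
have g1 h x : sn h (g x) <= sn h x.
  by apply: sn_le (sn_ge0 _ _) _; rewrite sn_sqr (qfgf h x) lerDl qf_ge0.
have fg1 h x : sn h ((f * g) x) <= sn h x by rewrite opM (le_trans (f1 _ _)).
have [q [pq J0 qc]] := exists_sign e1 sfg fg1.
pose J : bop E := q + q - 1; rewrite -/J in J0.
have [sJ JJ] : adj J = J /\ J * J = 1 := proj_symmetry pq.
have cfg : GRing.comm f g by exact: fg.
have cgf : GRing.comm g f by exact: commr_sym.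
have cfq : GRing.comm f q by apply: qc => //; apply: commrM.
have cgq : GRing.comm g q by apply: qc => //; apply: commrM.
have cJ a : GRing.comm a q -> GRing.comm a J.
  by move=> aq; apply: commrB; [exact: commrD|exact: commr1].
have cfJ := cJ f cfq; have cgJ := cJ g cgq.
have cJf := commr_sym cfJ; have cJg := commr_sym cgJ.
pose gs (r : R) : bop E := g + r%:C *: (J * f).
pose fs (r : R) : bop E := f + r%:C *: (J * g).
have sgs (r : R) : adj (gs r) = gs r by rewrite adjD adjZr adjM sg sf sJ cfJ.
have sfs (r : R) : adj (fs r) = fs r by rewrite adjD adjZr adjM sg sf sJ cgJ.
(* [J f g] is the modulus of [f g], hence positive. The cross terms in the squares of [gs r x] and
   [fs r x] both reduce to it, so they can only increase these squares. *)
have crossJ h x : 0 <= complex.Re (form h x (J (f (g x)))).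
  by rewrite Re_formC -opM; exact: J0.
have crossg h x : 0 <= complex.Re (form h (g x) (J (f x))).
  rewrite form_adj sg -[g (J _)]opM (cgJ : g * J = J * g) opM -[g (f x)]opM -fg.
  by rewrite opM; exact: crossJ.
have crossf h x : 0 <= complex.Re (form h (f x) (J (g x))).
  rewrite form_adj sf -[f (J _)]opM (cfJ : f * J = J * f) opM.
  exact: crossJ.
have qgs (r : R) h x : 0 <= r ->
    qf h (g x) + r ^+ 2 * qf h (f x) <= qf h (gs r x).
  move=> r0; rewrite /gs !opE qfD qfZ (symmetry_qf h _ sJ JJ) formZr lerDl.
  by rewrite conj_Creal ?complex_real// ReZ !mulr_ge0.
have qfs (r : R) h x : 0 <= r ->
    qf h (f x) + r ^+ 2 * qf h (g x) <= qf h (fs r x).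
  move=> r0; rewrite /fs !opE qfD qfZ (symmetry_qf h _ sJ JJ) formZr lerDl.
  by rewrite conj_Creal ?complex_real// ReZ !mulr_ge0.
have low (r : R) h x : 0 <= r -> qf h x <= qf h (gs r x) + qf h (fs r x).
  move=> r0; have := qgs r h x r0; have := qfs r h x r0; rewrite (qfgf h x).
  have := mulr_ge0 (sqr_ge0 r) (qf_ge0 h (g x)).
  by have := mulr_ge0 (sqr_ge0 r) (qf_ge0 h (f x)); lra.
have pos (r u v : R) : 0 < r <= 1 -> 0 <= u ->
    r ^+ 2 * (u + v) <= u + r ^+ 2 * v.
  move=> /andP[r0 r1] u0; rewrite mulrDr lerD2r ler_piMl//.
  by rewrite expr_le1// ltW.
have igs (r : R) : 0 < r <= 1 -> exists2 b, gs r * b = 1 & b * gs r = 1.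
  move=> r01; have /andP[r0 _] := r01; apply: (bop_invertible_qf r0) => // h x.
  by rewrite (qfgf h x) (le_trans (pos _ _ _ r01 _))// ?qf_ge0// qgs// ltW.
have ifs (r : R) : 0 < r <= 1 -> exists2 b, fs r * b = 1 & b * fs r = 1.
  move=> r01; have /andP[r0 _] := r01; apply: (bop_invertible_qf r0) => // h x.
  rewrite (qfgf h x) [qf h (g x) + _]addrC.
  by rewrite (le_trans (pos _ _ _ r01 _))// ?qf_ge0// qfs// ltW.
have range_inv a b : a * b = 1 -> forall x, range a x.
  by move=> ab x; exists (b x) => //; rewrite -opM ab.
have dgs (r : R) : 0 <= r <= 1 -> dense (range (gs r)).
  move=> /andP[r0 r1]; have [->|rn] := eqVneq r 0.
    by rewrite /gs scale0r addr0.
  have [|b gb _] := igs r; first by rewrite lt0r rn r0.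
  apply/dense_rnorm => x d d0; exists x; last by rewrite subrr rnorm0.
  exact: range_inv gb x.
have cJfg : GRing.comm (J * f) (J * g).
  by apply/commr_sym/commrM; apply/commr_sym/commrM => //; exact/commr_sym.
have pairs (r : R) : 0 <= r <= 1 -> sa_pair (gs r) (fs r).
  move=> r01; have /andP[r0 _] := r01; split=> //; last 1 first.
  - exact: dgs.
  - have cff : GRing.comm f (gs r).
      by apply: commrD => //; apply/commrZ/commrM.
    have cJgg : GRing.comm (J * g) (gs r).
      apply: commrD; first by apply/commr_sym/commrM.
      by apply/commrZ/commr_sym.
    have : GRing.comm (gs r) (fs r).
      apply: commrD; first exact: commr_sym.
      by apply/commrZ/commr_sym.
    by move=> /commr_sym.
  - by move=> h x; exact: low.
have ig (r : R) x : 0 <= r <= 1 -> gs r x = 0 -> x = 0.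
  by move=> r01; apply: (dense_range_inj e1); [exact: sgs|exact: dgs].
pose s := Regop (sa_pair_regular e1 (pairs 1 (introT andP (conj ler01 (lexx 1))))).
exists q, s; split=> //=.
(* At [r = 1] the numerator is [J] times the invertible denominator, so the quotient is [J]. *)
- have [|b gb _] := igs 1; first by rewrite ltr01 lexx.
  have JgE : J * gs 1 = fs 1.
    by rewrite /gs /fs !scale1r mulrDr mulrA JJ mul1r addrC.
  apply/seteqP; split=> [_ [x ->]|_ [x ->]].
    by exists (gs 1 x); rewrite op1 -/J -opM JgE.
  exists (b x); rewrite -[gs 1 (b x)]opM gb op1; congr (_, _).
  by rewrite -JgE opM -[gs 1 (b x)]opM gb op1.
apply: (affine_linked e1 (g0 := g) (g1 := J * f) (f0 := f) (f1 := J * g)) => //=.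
- move=> r p r01 pE; have r01' := r01; split; last first.
    by rewrite pE (sa_pair_adjoint e1 (pairs r r01)).
  (* At the start the operator is [t], Fredholm by hypothesis; afterwards the numerator [fs r] is
     invertible. *)
  have [r0|rn] := eqVneq r 0.
    rewrite /FredR /= (_ : p = t)//; apply: regop_eq.
    by rewrite pE r0 !scale0r !addr0 tE.
  have rp : 0 < r <= 1 by move: r01 => /andP[r0 ->]; rewrite lt0r rn r0.
  have [b fb bf] := ifs r rp.
  rewrite /FredR /= pE; apply: (fredholm_invertible e1 _ _ fb bf).
    exact: dgs.
  by move=> x; exact: ig.
- by rewrite /gs /fs !scale1r.
Qed.

End StraightenToSymmetry.

(** * Shifts along orthonormal sequences *)

Section OrthonormalSequences.
Context (R : realType) (H : hilbertType R) (E : hilbertModType H).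
Context (e : H) (e1 : rnorm e = 1).
Implicit Types (x y z : E) (h : H) (a b q V W : bop E) (u v w : nat -> E).

Definition ons N u := forall i, (i < N)%N -> ran_e e (u i) /\
  forall j, (j < N)%N -> form e (u i) (u j) = (i == j)%:R.

Definition onseq u := forall N, ons N u.

Lemma onseq_ran u n : onseq u -> ran_e e (u n).
Proof. by move=> /(_ n.+1 n (ltnSn n))[]. Qed.

Lemma ons_kinner N u i j : ons N u -> (i < N)%N -> (j < N)%N ->
  kinner (u i) (u j) = (i == j)%:R *: theta e e :> compop H.
Proof.
move=> ou iN jN; have [ei oi] := ou i iN; have [ej _] := ou j jN.
by rewrite (kinner_ran_e ei ej) oi.
Qed.

Lemma onseq_kinner u i j : onseq u ->
  kinner (u i) (u j) = (i == j)%:R *: theta e e :> compop H.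
Proof.
move=> ou; apply: (ons_kinner (ou (maxn i j).+1)); rewrite ltnS.
  exact: leq_maxl.
exact: leq_maxr.
Qed.

(** For orthonormal sequences this is the partial isometry sending [u i] to [v i] for [i < N] and
    killing the complement of these [u i]. *)
Definition pshift u v N : bop E := \sum_(i < N) brank1 e1 (u i) (v i).

Lemma pshift0 u v : pshift u v 0 = 0.
Proof. by rewrite /pshift big_ord0. Qed.

Lemma pshiftS u v N : pshift u v N.+1 = pshift u v N + brank1 e1 (u N) (v N).
Proof. by rewrite /pshift big_ord_recr. Qed.

Lemma adj_pshift u v N : adj (pshift u v N) = pshift v u N.
Proof.
elim: N => [|N IH]; first by rewrite !pshift0 adj0.
by rewrite !pshiftS adjD IH adj_brank1.
Qed.

Lemma pshift_frank u v N : exists s, pshift u v N = frank e1 s.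
Proof.
elim: N => [|N [s sE]]; first by exists [::]; rewrite pshift0 /frank big_nil.
exists (rcons s (u N, v N)); rewrite pshiftS sE /frank -cats1 big_cat /=.
by rewrite big_seq1.
Qed.

Lemma pshift_val v w N x j : (forall i, (i < N)%N ->
    kinner x (v i) = (j == i)%:R *: theta e e :> compop H) ->
  ran_e e (w j) -> pshift v w N x = if (j < N)%N then w j else 0.
Proof.
move=> xv ew; elim: N xv => [|N IH] xv; first by rewrite pshift0 op0.
rewrite pshiftS opD IH; last by move=> i iN; apply: xv; exact: ltnW.
rewrite /= /rank1 xv// ltnS [(j <= N)%N]leq_eqVlt; have [jN|jN] := eqVneq j N.
  by rewrite -jN ltnn scale1r add0r ew.
by rewrite scale0r kact0 addr0.
Qed.

Lemma pshift_perp u v N x : (forall i, kinner x (u i) = 0 :> compop H) ->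
  pshift u v N x = 0.
Proof.
move=> xu; elim: N => [|N IH]; first by rewrite pshift0 op0.
by rewrite pshiftS opD IH /= /rank1 xu kact0 addr0.
Qed.

Lemma pshift_comp u v w M N : onseq v -> onseq w ->
  pshift v w M * pshift u v N = pshift u w (minn M N).
Proof.
move=> ov ow; elim: N => [|N IH]; first by rewrite minn0 !pshift0 mulr0.
rewrite pshiftS mulrDr IH brank1Ml.
rewrite (@pshift_val _ _ _ _ N); last 2 first.
- by move=> i _; exact: onseq_kinner.
- exact: onseq_ran.
have [NM|MN] := ltnP N M.
  by rewrite (minn_idPr NM) pshiftS.
rewrite (minn_idPl (leqW MN)).
rewrite (_ : brank1 e1 (u N) 0 = 0) ?addr0//.
by apply: bopP => x; rewrite /= /rank1 kactr0.
Qed.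

Lemma pshift_bound u v N : onseq u -> onseq v ->
  forall x, rnorm (pshift u v N x) <= 1 * rnorm x.
Proof.
move=> ou ov x; have pq : is_proj (pshift u u N).
  by split; rewrite ?adj_pshift// pshift_comp// minnn.
apply: rnorm_le_sn_mul => // h; rewrite mul1r.
rewrite (le_trans _ (proj_sn pq h x))//; apply: sn_le (sn_ge0 _ _) _.
rewrite sn_sqr /qf !form_adj !adj_pshift -!opM !pshift_comp// !minnn.
Qed.

(** The vectors at which the partial sums converge form a submodule, closed by the uniform bound,
    which contains every [u i]. On vectors orthogonal to all [u i] the sums vanish, so this
    submodule contains its own complement and is all of [E]. *)
Lemma pshift_cvg u v : onseq u -> onseq v ->
  forall x, exists l, lim_to (fun N => pshift u v N x) l.
Proof.
move=> ou ov; have B N x := pshift_bound N ou ov x.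
pose D := [set x | exists l, lim_to (fun N => pshift u v N x) l].
suff h : forall x, D x by [].
apply: (closed_ksubmod_eqT e1).
- split.
  + by exists 0 => d d0; exists 0%N => n _; rewrite bop0 subrr rnorm0.
  + move=> x y [l lx] [m my]; exists (l + m) => d /(lim_toD lx my)[N hN].
    by exists N => n /hN; rewrite bopD.
  + move=> c x [l lx]; exists (c *: l) => d /(lim_toZ c lx)[N hN].
    by exists N => n /hN; rewrite bopZ.
  + move=> c x [l lx]; exists (kact c l) => d /(lim_kact e1 c lx)[N hN].
    by exists N => n /hN; rewrite bopK.
- move=> x /closure_rnorm hx; apply: complete_rnorm => d d0.
  have [y [l ly] xy] := hx _ (divr_gt0 d0 (ltr0n R 4)).
  have [N hN] := ly _ (divr_gt0 d0 (ltr0n R 4)); exists N => m n /hN hm /hN hn.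
  rewrite (le_lt_trans (rnorm_tri _ (pshift u v m y) _))//.
  rewrite (le_lt_trans (lerD (lexx _) (rnorm_tri _ l _)))//.
  rewrite (le_lt_trans (lerD (lexx _) (lerD (lexx _) (rnorm_tri _ (pshift u v n y) _))))//.
  have := B m (x - y); have := B n (y - x); rewrite !bopB !mul1r.
  rewrite [rnorm (y - x)]rnormBC; move: hm hn xy.
  rewrite [rnorm (l - pshift u v m y)]rnormBC; lra.
- move=> x px; exists 0 => d d0; exists 0%N => n _.
  rewrite pshift_perp ?subrr ?rnorm0// => i; apply: px.
  exists (v i) => r r0; exists i.+1 => m im.
  rewrite (@pshift_val _ _ _ _ i) ?im ?subrr ?rnorm0//; last exact: onseq_ran.
  by move=> j _; exact: onseq_kinner.
Qed.

Definition is_shift u v V := forall x, lim_to (fun N => pshift u v N x) (V x).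

Lemma is_shift_uniq u v V V' : is_shift u v V -> is_shift u v V' -> V = V'.
Proof. by move=> h h'; apply: bopP => x; exact: lim_to_uniq (h x) (h' x). Qed.

Lemma exists_shift u v : onseq u -> onseq v ->
  exists V, is_shift u v V /\ is_shift v u (adj V).
Proof.
move=> ou ov; have [|V [hV hV']] := op_lim e1 (fun N => pshift_bound N ou ov) (pshift_cvg ou ov).
  by move=> x; have [l hl] := pshift_cvg ov ou x; exists l => d /hl[N hN];
    exists N => n; rewrite adj_pshift; exact: hN.
exists V; split=> // x d /(hV' x)[N hN].
by exists N => n; rewrite -adj_pshift; exact: hN.
Qed.

Lemma is_shift_comp u v w V W : onseq v -> onseq w ->
  is_shift u v V -> is_shift v w W -> is_shift u w (W * V).
Proof.
move=> ov ow hV hW x d d0; have [N hN] := hW (V x) d d0; exists N => M NM.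
rewrite opM (_ : pshift u w M x = pshift v w M (V x)); first exact: hN.
apply: (lim_to_uniq _ (lim_bop (pshift v w M) (hV x))) => r r0.
exists M => K MK; rewrite /= -opM pshift_comp// (minn_idPl MK) subrr rnorm0//.
Qed.

Lemma is_shift_val u v V n : onseq u -> onseq v -> is_shift u v V ->
  V (u n) = v n.
Proof.
move=> ou ov hV; apply: lim_to_uniq (hV (u n)) _ => d d0; exists n.+1 => N nN.
rewrite (@pshift_val _ _ _ _ n) ?nN ?subrr ?rnorm0//; last exact: onseq_ran.
by move=> j _; exact: onseq_kinner.
Qed.

Lemma is_shift_sn u v V : onseq u -> onseq v -> is_shift u v V ->
  forall h x, sn h (V x) <= sn h x.
Proof.
move=> ou ov hV h x; rewrite -[leRHS]mul1r; apply: (sn_bound e1) => {}x.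
by apply: lim_to_norm_le (hV x) _ => N; exact: pshift_bound.
Qed.

Lemma onseq_tail u : onseq u -> onseq (u \o S).
Proof.
move=> ou N i iN; have [eu uo] := ou N.+1 i.+1 iN; split=> // j jN.
by rewrite /= uo.
Qed.

Lemma exists_unilateral_shift u : onseq u -> exists q S, 
  [/\ [/\ is_shift u u q, is_proj q & forall n, q (u n) = u n],
      [/\ adj S * S = q, S * q = S & q * S = S],
      S * adj S = q - brank1 e1 (u 0%N) (u 0%N),
      forall h x, sn h (S x) <= sn h x &
      [/\ forall n, S (u n) = u n.+1, forall n, adj S (u n.+1) = u n &
          adj S (u 0%N) = 0]].
Proof.
move=> ou; have ou' := onseq_tail ou; set u' := u \o succn in ou'.
have [q [hq hq']] := exists_shift ou ou; have [S [hS hS']] := exists_shift ou ou'.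
have sq : adj q = q by apply: is_shift_uniq hq' hq.
have qq : q * q = q by apply: is_shift_uniq (is_shift_comp _ _ hq hq) hq.
have qu n : q (u n) = u n by exact: is_shift_val hq.
have SS : adj S * S = q by apply: is_shift_uniq (is_shift_comp _ _ hS hS') hq.
have Sq : S * q = S by apply: is_shift_uniq (is_shift_comp _ _ hq hS) hS.
pose r := brank1 e1 (u 0%N) (u 0%N).
have SS' : S * adj S = q - r.
  apply: (@is_shift_uniq u' u'); first exact: is_shift_comp hS' hS.
  (* [n] terms along the tail are [n + 1] terms along [u] without the first one. *)
  move=> x; have hqr : lim_to (fun N => pshift u u N.+1 x - r x) (q x - r x).
    apply: lim_toB (lim_to_cst _) => d /(hq x)[N hN]; exists N => n Nn.
    by apply: hN; exact: leqW.
  move=> d /hqr[N hN]; exists N => n /hN; rewrite opD opN.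
  suff -> : pshift u u n.+1 x - r x = pshift u' u' n x by [].
  by rewrite /pshift big_ord_recl opD addrC addKr.
have rE : q * r = r by rewrite /r brank1Ml qu.
have qS : q * S = S.
  have S2 : S * adj S * S = S by rewrite -mulrA SS Sq.
  by rewrite -{1}S2 SS' mulrA mulrBr qq rE -SS' S2.
have Su n : S (u n) = u n.+1 by exact: (is_shift_val n ou ou' hS).
have Su' n : adj S (u n.+1) = u n by exact: (is_shift_val n ou' ou hS').
exists q, S; split=> //; first exact: (is_shift_sn ou ou' hS).
split=> //.
have S3 : adj S * (S * adj S) = adj S by rewrite mulrA SS -{1}sq -adjM Sq.
rewrite -S3 opM SS' opD opN qu /r /= /rank1 onseq_kinner// eqxx scale1r.
by rewrite (onseq_ran 0 ou) subrr bop0.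
Qed.

(** A finite orthonormal family in the range of [q] with projection [t] can be enlarged unless
    [q = t]: some [theta e h] moves a nonzero value of [q - t] to a nonzero vector of [ran_e e],
    which is then normalized. Dependent choice along growing lists yields the sequence. *)
Lemma dichotomy q : is_proj q ->
  (exists s, q = frank e1 s) \/ (exists2 u, onseq u & forall n, q (u n) = u n).
Proof.
move=> [sq qq]; have [[s qs]|nq] := pselect (exists s, q = frank e1 s).
  by left; exists s.
right; pose ok (s : seq E) := ons (size s) (nth 0 s) /\ (forall i, (i < size s)%N -> q (nth 0 s i) = nth 0 s i).
have step s : ok s -> exists x, ok (rcons s x).
  move=> [os qs]; pose t := pshift (nth 0 s) (nth 0 s) (size s).
  have ts i : (i < size s)%N -> t (nth 0 s i) = nth 0 s i.
    move=> iN; have [ei _] := os i iN.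
    by rewrite /t (@pshift_val _ _ _ _ i) ?iN// => j jN; apply: (ons_kinner os).
  have st : adj t = t by rewrite adj_pshift.
  have qt : q * t = t.
    have : forall N, (N <= size s)%N ->
        q * pshift (nth 0 s) (nth 0 s) N = pshift (nth 0 s) (nth 0 s) N.
      elim=> [|N IH] Ns; first by rewrite pshift0 mulr0.
      by rewrite pshiftS mulrDr IH ?(ltnW Ns)// brank1Ml qs.
    by apply.
  have [w wn0] : exists w : E, (q - t) w <> 0.
    apply: contrapT => /forallNP w0; apply: nq.
    have [s' s'E] := pshift_frank (nth 0 s) (nth 0 s) (size s).
    exists s'; rewrite -s'E; apply/eqP; rewrite -subr_eq0; apply/eqP/bopP => w.
    by have /contrapT := w0 w.
  have [h hn0] : exists h, kact (theta e h) ((q - t) w) <> 0.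
    apply: contrapT => /forallNP w0; apply: wn0; apply: (theta_eq0 e1) => h.
    by have /contrapT := w0 h.
  set x0 := kact _ _ in hn0; have ex0 : ran_e e x0 by exact: ran_e_theta.
  have r0 : 0 < rnorm x0 by rewrite lt0r rnorm_ge0 andbT; apply/eqP => /rnorm_eq0.
  pose x := (rnorm x0)^-1%:C *: x0.
  have ex : ran_e e x by rewrite /ran_e kactZr ex0.
  have xx : form e x x = 1.
    rewrite -qfE qfZ -sn_sqr -(rnorm_ran_e e1 ex0) -exprMn mulVf ?gt_eqF//.
    by rewrite expr1n.
  have qx0 : q x0 = x0 by rewrite /x0 bopK -opM mulrBr qq qt.
  have qx : q x = x by rewrite bopZ qx0.
  have xs i : (i < size s)%N -> form e x (nth 0 s i) = 0.
    move=> iN; rewrite /x /x0 -bopK formZl form_adj adjB sq st !opD !opN.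
    by rewrite qs// ts// subrr formC form0l conjC0 mulr0.
  exists x; split; last first.
    move=> i; rewrite size_rcons ltnS leq_eqVlt nth_rcons => /orP[/eqP->|iN].
      by rewrite ltnn eqxx.
    by rewrite iN qs.
  have nr i : (i < size (rcons s x))%N -> (i < size s)%N \/ i = size s.
    by rewrite size_rcons ltnS leq_eqVlt => /orP[/eqP->|]; [right|left].
  move=> i /nr[iN|->]; rewrite nth_rcons.
    rewrite iN; have [ei oi] := os i iN; split=> // j /nr[jN|->]; rewrite nth_rcons.
      by rewrite jN oi.
    by rewrite ltnn eqxx formC xs// conjC0 ltn_eqF.
  rewrite ltnn eqxx; split=> // j /nr[jN|->]; rewrite nth_rcons.
    by rewrite jN xs// gtn_eqF.
  by rewrite ltnn !eqxx.
have /choice[f hf] s : exists x, ok s -> ok (rcons s x).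
  have [os|ns] := pselect (ok s); last by exists 0.
  by have [x ox] := step s os; exists x.
pose S := fix S n := if n is m.+1 then rcons (S m) (f (S m)) else [::].
have okS n : ok (S n) by elim: n => [|n IH] //=; exact: hf.
have sS n : size (S n) = n by elim: n => //= n IH; rewrite size_rcons IH.
have nS n i : (i < n)%N -> nth 0 (S n) i = f (S i).
  elim: n => // n IH; rewrite ltnS leq_eqVlt => /orP[/eqP->|iN] /=.
    by rewrite nth_rcons sS ltnn eqxx.
  by rewrite nth_rcons sS iN IH.
exists (fun n => f (S n)).
  move=> N i iN; have [oN _] := okS N; have := oN i; rewrite sS => /(_ iN).
  rewrite nS// => -[ei oi]; split=> // j jN; have := oi j jN.
  by rewrite nS.
move=> n; have [_ /(_ n)] := okS n.+1; rewrite sS => /(_ (ltnSn n)).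
by rewrite nS.
Qed.

End OrthonormalSequences.

(** * Selfadjoint operators without eigenvalues *)

Section NoEigenvalues.
Context (R : realType) (H : hilbertType R) (E : hilbertModType H).
Context (e : H) (e1 : rnorm e = 1).
Implicit Types (x y z : E) (h : H) (a b q V W : bop E).

Definition no_eigen q b := forall (t : R) x, q x = x -> b x = t%:C *: x -> x = 0.

Lemma kinner_eq0_e x y z : ran_e e y ->
  (forall h, hdot ((kinner x y : compop H) e) h = 0) -> kact (kinner x y : compop H) z = 0.
Proof.
move=> ey xy; suff -> : (kinner x y : compop H) = 0 by rewrite kact0.
have ey' : kact (theta e e) y = y := ey.
apply: compopP => h; rewrite -ey' kinner_thetar kcompE thetaE compop_Zr.
suff -> : (kinner x y : compop H) e = 0 by rewrite scaler0.
by apply: hdot_ext => l; rewrite xy hdot0l.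
Qed.

(* The coefficients of an eigenvector of [S + S*] satisfy the recurrence of the
   Chebyshev polynomials, for which
   [c_(n+1)^2 - t c_(n+1) c_n + c_n^2] is constant, equal to [c_0^2]. *)
Lemma shift_no_eigen (u : nat -> E) q (S : bop E) : onseq e u -> is_shift e1 u u q ->
  (forall n, S (u n) = u n.+1) -> (forall n, adj S (u n.+1) = u n) ->
  adj S (u 0%N) = 0 -> no_eigen q (S + adj S).
Proof.
move=> ou hq Su Su' Su0 t x qx bx.
(* The coefficient of [x] along [u n] is an operator on [H]; it is determined by its value at [e],
   which is tested against each [h]. *)
pose c h n : R[i] := hdot ((kinner x (u n) : compop H) e) h.
have bu n : t%:C *: kinner x (u n) = kinner x (adj S (u n)) + kinner x (S (u n)) :> compop H.
  by rewrite -kinnerZl -bx opD kinnerDl adjP adjPr.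
have c1 h : c h 1%N = t%:C * c h 0%N.
  have := congr1 (fun k : compop H => hdot (k e) h) (bu 0%N).
  by rewrite Su0 Su kinner0r add0r compopZ hdotZl.
have c2 h n : c h n.+2 = t%:C * c h n.+1 - c h n.
  have := congr1 (fun k : compop H => hdot (k e) h) (bu n.+1).
  by rewrite Su Su' compopD compopZ hdotDl hdotZl => ->; rewrite addrC addKr.
have inv h n : c h n.+1 ^+ 2 - t%:C * c h n.+1 * c h n + c h n ^+ 2 = c h 0%N ^+ 2.
  elim: n => [|n <-]; first by rewrite c1; ring.
  by rewrite c2; ring.
(* The [n]-th term of the series for [q x] is a difference of consecutive partial sums, so it tends
   to 0. *)
have cvg0 h (d : R) : 0 < d -> exists N, forall n, (N <= n)%N -> complex.Re `|c h n| < d.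
  move=> d0; have h0 : 0 < rnorm h + 1 by rewrite ltr_wpDl// rnorm_ge0.
  have d2 := divr_gt0 (divr_gt0 d0 h0) (ltr0n R 2).
  have [N hN] := hq x _ d2; exists N => n Nn.
  have := hN _ Nn; have := hN _ (leqW Nn).
  rewrite pshiftS opD; set v := pshift _ _ _ _ _; set w := brank1 _ _ _ _ => h1 h2.
  have hw : rnorm w < d / (rnorm h + 1).
    have -> : w = (q x - v) - (q x - (v + w)).
      by rewrite opprB [RHS]addrC addrA subrK [v + w]addrC addrK.
    rewrite (le_lt_trans (rnormB _ _))//; move: h1 h2; rewrite -/v => h1 h2.
    by rewrite [ltRHS]splitr ltrD.
  have cE : c h n = hdot ((kinner w (u n) : compop H) e) h.
    rewrite /w /= /rank1 kinner_act (onseq_kinner n n ou) eqxx scale1r.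
    by rewrite kcompE thetaE (hdot_e e1) scale1r.
  rewrite cE (le_lt_trans (kinner_cs e1 _ _ _ _))//.
  have u1 : sn e (u n) = 1.
    rewrite /sn /qf (_ : form e (u n) (u n) = 1) ?sqrtr1//.
    by have [_ ->] := ou n.+1 n (ltnSn n); rewrite ?eqxx.
  rewrite u1 mulr1 (le_lt_trans (sn_le_rnorm _ _))//.
  rewrite (@le_lt_trans _ _ (rnorm w * (rnorm h + 1)))//.
    by rewrite ler_wpM2l ?rnorm_ge0// lerDl.
  by rewrite -ltr_pdivlMr.
have c0 h : c h 0%N = 0.
  pose rho (z : R[i]) := complex.Re `|z|.
  have [r0|r0] := eqVneq (rho (c h 0%N)) 0.
    by apply/eqP; rewrite -normr_eq0 -Re_normE -/(rho _) r0.
  have rho_ge0 (z : R[i]) : 0 <= rho z by rewrite -ler0c Re_normE.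
  have rp : 0 < rho (c h 0%N) by rewrite lt0r r0 rho_ge0.
  (* If two consecutive coefficients are below [d = r / (2 + |t|)], the invariant gives
     [r^2 <= (2 + |t|) d^2 = r d], although [d < r]. *)
  set r := rho _ in rp; have t2 : 0 < 2 + `|t| by rewrite ltr_wpDr.
  have [N hN] := cvg0 h _ (divr_gt0 rp t2).
  have d1 := hN N (leqnn N); have d2 := hN N.+1 (leqnSn N).
  rewrite -/(rho _) in d1; rewrite -/(rho _) in d2; set d := r / _ in d1 d2.
  have : r ^+ 2 <= rho (c h N.+1) ^+ 2 + `|t| * rho (c h N.+1) * rho (c h N) + rho (c h N) ^+ 2.
    have rhoM (z w : R[i]) : rho (z * w) = rho z * rho w.
      by apply: (@complexI R); rewrite rmorphM /= !Re_normE normrM.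
    have rhoD (z w : R[i]) : rho (z + w) <= rho z + rho w.
      by rewrite -lecR rmorphD /= !Re_normE ler_normD.
    have rhoN (z : R[i]) : rho (- z) = rho z by rewrite /rho normrN.
    have rhoR : rho t%:C = `|t|.
      by rewrite /rho normc_def /= expr0n addr0 sqrtr_sqr.
    rewrite !expr2 /r -!rhoM -!expr2 -(inv h N) (le_trans (rhoD _ _))// lerD2r.
    by rewrite (le_trans (rhoD _ _))// rhoN !rhoM rhoR.
  have dE : d * (2 + `|t|) = r by rewrite /d divfK// gt_eqF.
  have d0 : 0 < d by rewrite divr_gt0.
  have := rho_ge0 (c h N); have := rho_ge0 (c h N.+1).
  move: (rho (c h N)) (rho (c h N.+1)) d1 d2 => x0 y0 d1 d2 y00 x00 hr.
  exfalso; have tp : 0 <= `|t| by [].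
  have h1 : y0 ^+ 2 <= d ^+ 2 by rewrite ler_pXn2r ?nnegrE// ltW.
  have h2 : x0 ^+ 2 <= d ^+ 2 by rewrite ler_pXn2r ?nnegrE// ltW.
  have h3 : `|t| * y0 * x0 <= `|t| * d * d.
    by rewrite !ler_pM ?mulr_ge0// ltW.
  have h4 : r ^+ 2 <= d ^+ 2 * (2 + `|t|) by rewrite expr2 in h1 h2 hr *; lra.
  have : r ^+ 2 <= d * r by rewrite -[in leRHS]dE mulrA -expr2.
  rewrite expr2 ler_pM2r// leNgt => /negP; apply.
  by rewrite /d ltr_pdivrMr// ltr_pMr//; lra.
have call h n : c h n = 0.
  suff : c h n = 0 /\ c h n.+1 = 0 by case.
  elim: n => [|n [IH1 IH2]]; first by rewrite c1 c0 mulr0.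
  by rewrite c2 IH1 IH2 mulr0 subrr.
rewrite -qx; apply: lim_to_uniq (hq x) _ => d d0; exists 0%N => N _.
suff -> : pshift e1 u u N x = 0 by rewrite subrr rnorm0.
elim: N => [|N IH]; first by rewrite pshift0 op0.
rewrite pshiftS opD IH add0r /= /rank1.
by apply: kinner_eq0_e; [exact: onseq_ran|move=> h; exact: call].
Qed.

End NoEigenvalues.

(** * Maximal operators without eigenvalues *)

Section ZornExhaustion.
Context (R : realType) (H : hilbertType R) (E : hilbertModType H).
Context (e : H) (e1 : rnorm e = 1).
Implicit Types (x y z : E) (h : H) (a b q L : bop E) (G : set (E * E)).

(** Extended by the identity off the range of [q], the operator [b - t] becomes selfadjoint and
    injective on [E], so its range is dense. *)
Lemma no_eigen_dense q b : is_proj q -> adj b = b -> b * q = b -> no_eigen q b ->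
  forall (t : R) x, q x = x -> forall d : R, 0 < d ->
  exists2 y, q y = y & rnorm (b y - t%:C *: y - x) < d.
Proof.
move=> pq sb bq nb t x qx d d0; have [sq qq] := pq.
have qb : q * b = b by rewrite -{1}sb -{1}sq -adjM bq.
pose a := b - t%:C *: q + (1 - q).
have sa : adj a = a by rewrite !adjD !adjN adjZr adj1 sb sq.
have qa : q * a = b - t%:C *: q.
  by rewrite mulrDr !mulrBr qb -op_scalerAr qq mulr1 subrr addr0.
have da : dense (range a).
  apply: (dense_range e1) => y; rewrite sa => ay.
  have qy : q y = 0.
    apply: (nb t); first by rewrite -opM qq.
    have : (q * a) y = 0 by rewrite opM ay bop0.
    by rewrite qa opD opN opZ -opM bq => /eqP; rewrite subr_eq0 => /eqP.
  move: ay; rewrite /a !opD !opN opZ op1 -{1}bq opM qy bop0 scaler0.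
  by rewrite !subr0 add0r.
have /dense_rnorm da' := da; have [_ [y _ <-] xy] := da' x d d0.
exists (q y); first by rewrite -opM qq.
have -> : b (q y) - t%:C *: q y - x = q (a y - x).
  by rewrite -[b (q y)]opM bq bopB qx -[q (a y)]opM qa opD opN opZ.
rewrite rnormBC in xy; rewrite (le_lt_trans _ xy)// -[leRHS]mul1r.
by apply: rnorm_le_sn_mul => // h; rewrite mul1r proj_sn.
Qed.

(* Graphs of bounded symmetric operators without eigenvalues on a reducing
   subspace of the range of [L]; unlike the operators themselves they are
   stable under unions of chains. *)
Definition partial_no_eigen L G : Prop :=
  [/\ [/\ forall u v, G u -> G v -> G (u + v),
        forall (c : R[i]) u, G u -> G (c *: u) &
        forall (c : compop H) u, G u -> G (kact c u.1, kact c u.2)],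
      forall x y, G (x, y) -> forall h, qf h y <= 4 * qf h x,
      forall x y x' y', G (x, y) -> G (x', y') ->
        kinner y x' = kinner x y' :> compop H,
      forall x y, G (x, y) -> (exists z, G (y, z)) /\ L x = x &
      forall x y, G (x, y) -> forall (t d : R), 0 < d ->
        exists x' y', G (x', y') /\ rnorm (y' - t%:C *: x' - x) < d].

(** Each clause concerns at most two points of the graph, which lie in a common member of the chain;
    the witnesses are found in the same member. *)
Lemma partial_no_eigen_chain L (F : set (set (E * E))) :
  F `<=` partial_no_eigen L -> total_on F subset ->
  partial_no_eigen L (\bigcup_(X in F) X).
Proof.
move=> FP tF; have two u v : (\bigcup_(X in F) X) u -> (\bigcup_(X in F) X) v ->
    exists X, [/\ F X, X u & X v].
  move=> [X FX Xu] [Y FY Yv]; have [XY|YX] := tF X Y FX FY.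
    by exists Y; split=> //; exact: XY.
  by exists X; split=> //; exact: YX.
split.
- split.
  + move=> u v Gu Gv; have [X [FX Xu Xv]] := two u v Gu Gv.
    by have [[XD _ _] _ _ _ _] := FP X FX; exists X => //; exact: XD.
  + move=> c u [X FX Xu]; have [[_ XZ _] _ _ _ _] := FP X FX.
    by exists X => //; exact: XZ.
  + move=> c u [X FX Xu]; have [[_ _ XK] _ _ _ _] := FP X FX.
    by exists X => //; exact: XK.
- by move=> x y [X FX Xu]; have [_ Xb _ _ _] := FP X FX; exact: Xb.
- move=> x y x' y' Gu Gv; have [X [FX Xu Xv]] := two _ _ Gu Gv.
  by have [_ _ Xs _ _] := FP X FX; exact: Xs.
- move=> x y [X FX Xu]; have [_ _ _ Xi _] := FP X FX.
  have [[z Xyz] Lx] := Xi _ _ Xu; split=> //.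
  by exists z, X.
- move=> x y [X FX Xu] t d d0; have [_ _ _ _ Xd] := FP X FX.
  have [x' [y' [X' h']]] := Xd _ _ Xu t d d0; exists x', y'; split=> //.
  by exists X.
Qed.

Section Maximal.
Context (L : bop E) (pL : is_proj L) (G : set (E * E)).
Context (PG : partial_no_eigen L G) (G0 : G (0, 0)).

Let GB u v : G u -> G v -> G (u - v).
Proof.
have [[GD GZ _] _ _ _ _] := PG.
by move=> Gu Gv; apply: GD => //; rewrite -scaleN1r; exact: GZ.
Qed.

Lemma partial_domain : exists2 q, is_proj q & forall x,
  closure (dom G) (q x) /\ (closure (dom G) x -> q x = x).
Proof.
have [[GD GZ GK] _ _ _ _] := PG.
apply: (exists_proj e1 _ (@closed_closure _ _)); apply: (ksubmod_closure e1); split.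
- by exists 0.
- by move=> x y [x' Gx] [y' Gy]; exists (x' + y'); exact: (GD _ _ Gx Gy).
- by move=> c x [x' Gx]; exists (c *: x'); exact: (GZ c _ Gx).
- by move=> c x [x' Gx]; exists (kact c x'); exact: (GK c _ Gx).
Qed.

Context (q : bop E) (pq : is_proj q).
Context (hq : forall x, closure (dom G) (q x) /\ (closure (dom G) x -> q x = x)).

Let Gq x y : G (x, y) -> q x = x.
Proof. by move=> Gxy; apply: (proj2 (hq _)); apply: subset_closure; exists y. Qed.

Let Gq2 x y : G (x, y) -> q y = y.
Proof.
have [_ _ _ Gi _] := PG; move=> /Gi[[z Gyz] _]; exact: Gq Gyz.
Qed.

Lemma partial_proj_le : L * q = q /\ q * L = q.
Proof.
have [_ _ _ Gi _] := PG; have [sL _] := pL; have [sq _] := pq.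
have Lq : L * q = q.
  apply: bopP => x; rewrite opM; have [/closure_lim[u [Gu uq]] _] := hq x.
  apply: lim_to_uniq (lim_bop L uq) _ => d d0; have [N hN] := uq _ d0.
  exists N => n /hN /=; have [y Gy] := Gu n.
  by have [_ ->] := Gi _ _ Gy.
by split=> //; rewrite -{1}sq -{1}sL -adjM Lq.
Qed.

Lemma partial_extension : exists b : bop E,
  [/\ adj b = b, q * b = b, b * q = b & no_eigen q b].
Proof.
have [_ Gb Gs Gi Gd] := PG; have [sq qq] := pq.
pose D x y (s : E) := G (q x, y) /\ s = 0.
have DB x y z x' y' z' : D x y z -> D x' y' z' -> D (x - x') (y - y') (z - z').
  move=> [h1 ->] [h2 ->]; split; last by rewrite subrr.
  by rewrite bopB; exact: (GB h1 h2).
have qle x : rnorm (q x) <= 1 * rnorm x.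
  by apply: rnorm_le_sn_mul => // h; rewrite mul1r proj_sn.
have G2 x y : G (x, y) -> rnorm y <= 2 * rnorm x.
  move=> Gxy; apply: rnorm_le_sn_mul => // h.
  apply: sn_le; first by rewrite mulr_ge0 ?sn_ge0.
  by rewrite exprMn sn_sqr -natrX; exact: Gb.
have Dn x y z : D x y z -> rnorm y <= 2 * rnorm x /\ rnorm z <= 2 * rnorm x.
  move=> [h1 ->]; rewrite rnorm0 mulr_ge0 ?rnorm_ge0//; split=> //.
  by rewrite (le_trans (G2 _ _ h1))// ler_wpM2l// -[leRHS]mul1r.
have dD : dense [set x | exists y z, D x y z].
  apply/dense_rnorm => x d d0; have [/closure_rnorm/(_ d d0)[x0 [y Gx0] qx0] _] := hq x.
  exists (x0 + (1 - q) x).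
    exists y, 0; split=> //; rewrite bopD -opM mulrBr mulr1 qq subrr op0 addr0.
    by rewrite (Gq Gx0).
  by rewrite opD op1 opN opprD opprB addrCA [x + _]addrC subrK addrC.
have /choice[b hb] x : exists y, [/\ closure G (q x, y), q y = y & rnorm y <= 2 * rnorm x].
  have [y [z [u [v [w [ux vy wz hD]]]]]] := total_of_dense DB Dn dD x.
  have Guv n : G (q (u n), v n) by have [] := hD n.
  exists y; split.
  - apply: (lim_to_closed2 (@closed_closure _ G) (lim_bop q ux) vy) => n.
    exact/subset_closure/Guv.
  - apply: lim_to_uniq (lim_bop q vy) _ => d /vy[N hN]; exists N => n /hN.
    by rewrite /= (Gq2 (Guv n)).
  - apply: (lim_to_norm_le2 _ ux vy) => // n.
    by have [] := Dn _ _ _ (hD n).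
have hbG x x' y' : G (x', y') -> kinner (b x) x' = kinner (q x) y' :> compop H.
  move=> G'; have [/closure_lim2[u [v [Guv uq vb]]] _ _] := hb x.
  apply: compopP => h; apply: lim_to_uniq (lim_kinnerl e1 x' h vb) _ => d d0.
  have [N hN] := lim_kinnerl e1 y' h uq d0; exists N => n /hN.
  by rewrite (Gs _ _ _ _ (Guv n) G').
have bs x x' : kinner (b x) (q x') = kinner (q x) (b x') :> compop H.
  have [/closure_lim2[u [v [Guv uq vb]]] _ _] := hb x'.
  apply: compopP => h; apply: lim_to_uniq (lim_kinnerr e1 (b x) h uq) _ => d d0.
  have [N hN] := lim_kinnerr e1 (q x) h vb d0; exists N => n /hN.
  by rewrite (hbG _ _ _ (Guv n)).
have qb x : q (b x) = b x by have [] := hb x.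
have bb : is_adjoint b b.
  move=> x x'; have -> : kinner (b x) x' = kinner (b x) (q x') :> compop H.
    by rewrite -{1}(qb x) adjP sq.
  by rewrite bs adjP sq qb.
have bn x : rnorm (b x) <= 2 * rnorm x by have [] := hb x.
pose B := mkbop (adjointableI bb bn); have sB : adj B = B by exact: adj_uniq.
have qB : q * B = B by apply: bopP => x; rewrite opM; exact: qb.
have Bq : B * q = B by rewrite -{1}sB -{1}sq -adjM qB.
exists B; split=> // t x qx Bx.
(* An eigenvector for [t] is orthogonal to all values of [b - t] on the domain of [G]; the last
   clause on [G] makes these dense in that domain. *)
pose A := [set w | exists x' y', G (x', y') /\ w = y' - t%:C *: x'].
apply: (@perp_perp0 _ _ _ _ e1 A).
  move=> _ [x' [y' [G' ->]]]; rewrite kinnerBr kinnerZr conj_Creal ?complex_real//.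
  by rewrite -{1}qx -(hbG _ _ _ G') -[b x]/(B x) Bx kinnerZl subrr.
have dA : dom G `<=` closure A.
  move=> x0 [y0 G']; apply/closure_rnorm => d d0.
  have [x' [y' [G'' h]]] := Gd _ _ G' t d d0.
  by exists (y' - t%:C *: x'); [exists x', y'|rewrite rnormBC].
rewrite -qx; have [h _] := hq x; move: h => /(closure_subset dA).
by rewrite -(closure_id (closure A)).1//; exact: closed_closure.
Qed.

End Maximal.

(* Unless the complement of its domain has finite rank, a maximal partial
   operator could be enlarged by [S + S*] for a shift [S] along a new
   orthonormal sequence. *)
Lemma no_eigen_exhaustion L : is_proj L -> exists q b s,
  [/\ is_proj q, L = q + frank e1 s &
   [/\ adj b = b, q * b = b, b * q = b & no_eigen q b]].
Proof.
move=> pL; have [sL LL] := pL.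
have [G [PG maxG]] := Zorn_bigcup (@partial_no_eigen_chain L).
(* The empty graph satisfies all clauses vacuously; maximality excludes it because the graph of the
   zero space is larger. *)
have G0 : G (0, 0).
  have [[GD GZ GK] _ _ _ _] := PG.
  have [[u Gu]|nG] := pselect (exists u, G u).
    by have := GZ 0 _ Gu; rewrite scale0r.
  exfalso; apply: (maxG [set (0, 0)]).
    split; first by move=> u Gu; exfalso; apply: nG; exists u.
    by move=> /(_ (0, 0) erefl) G0; apply: nG; exists (0, 0).
  split.
  - split=> [_ _ -> ->|c _ ->|c _ ->] /=.
    + by congr (_, _); rewrite addr0.
    + by congr (_, _); rewrite scaler0.
    + by congr (_, _); rewrite kactr0.
  - by move=> x y [-> ->] h; rewrite /qf form0l mulr0.
  - by move=> x y x' y' [-> ->] [-> ->].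
  - by move=> x y [-> ->]; split; [exists 0|rewrite bop0].
  - move=> x y [-> _] t d d0; exists 0, 0; split=> //.
    by rewrite scaler0 !subrr rnorm0.
have [q pq hq] := partial_domain PG G0; have [sq qq] := pq.
have [Lq qL] := partial_proj_le pL PG pq hq.
have [b hb] := partial_extension PG pq hq.
have [z zE] : exists z : bop E, z = L - q by exists (L - q).
have pz : is_proj z.
  by split; rewrite zE ?adjB ?sL ?sq// mulrBl !mulrBr LL Lq qL qq subrr subr0.
have qz : q * z = 0 by rewrite zE mulrBr qL qq subrr.
have Lz : L * z = z by rewrite zE mulrBr LL Lq.
have [[s zs]|[u ou zu]] := dichotomy e1 pz.
  by exists q, b, s; split=> //; rewrite -zs zE addrC subrK.
exfalso; have [r [S [[hr pr ru] [SS Sr rS] _ Ssn [Su Su' Su0]]]] := exists_unilateral_shift e1 ou.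
have [sr rr] := pr.
have zr : z * r = r.
  apply: bopP => x; rewrite opM; apply: lim_to_uniq (lim_bop z (hr x)) _ => d /(hr x)[N hN].
  exists N => n /hN /=; suff -> : z (pshift e1 u u n x) = pshift e1 u u n x by [].
  elim: n => [|n IH]; first by rewrite pshift0 op0 bop0.
  by rewrite pshiftS opD bopD IH /= /rank1 bopK zu.
pose c := S + adj S; have sc : adj c = c by rewrite adjD adjK addrC.
have rS' : r * adj S = adj S by rewrite -{1}sr -adjM Sr.
have Sr' : adj S * r = adj S by rewrite -{1}sr -adjM rS.
have rc : r * c = c by rewrite mulrDr rS rS'.
have cr : c * r = c by rewrite mulrDl Sr Sr'.
have nc : no_eigen r c by exact: (shift_no_eigen ou hr Su Su' Su0).
have Ssn' h x : sn h (adj S x) <= sn h x.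
  have SB w : rnorm (S w) <= 1 * rnorm w.
    by apply: rnorm_le_sn_mul => // k; rewrite mul1r.
  by have := sn_bound e1 (adj_bound e1 ler01 SB) h x; rewrite mul1r.
have qr0 : q * r = 0 by rewrite -zr mulrA qz mul0r.
(* [S] and its adjoint are contractions; the bound 4 required of partial operators is the square of
   [1 + 1]. *)
have csn h x : qf h (c x) <= 4 * qf h x.
  rewrite -!sn_sqr (_ : 4 = 2 ^+ 2); last by rewrite -natrX.
  rewrite -exprMn ler_pXn2r ?nnegrE ?mulr_ge0 ?sn_ge0//.
  rewrite /c opD (le_trans (snD _ _ _))// mulr_natl mulr2n.
  by apply: lerD; [exact: Ssn|exact: Ssn'].
have orth x w : q x = x -> r w = w -> kinner x w = 0 :> compop H.
  by move=> qx rw; rewrite -qx -rw adjP sq -opM qr0 op0 kinner0r.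
have [[GD GZ GK] Gb Gs Gi Gd] := PG.
have Gq x y : G (x, y) -> q x = x /\ q y = y.
  move=> Gxy; have [[y' Gy] _] := Gi _ _ Gxy.
  by split; apply: (proj2 (hq _)); apply: subset_closure; [exists y|exists y'].
have rcE w : r (c w) = c w by rewrite -opM rc.
clearbody c.
pose G' := [set v | exists x y w, [/\ G (x, y), r w = w & v = (x + w, y + c w)]].
apply: (maxG G').
  split.
    move=> [x y] Gxy; exists x, y, 0; split=> //; first by rewrite bop0.
    by rewrite bop0 !addr0.
  move=> /(_ (u 0%N, c (u 0%N))) h.
  (* If [G'] were contained in [G], the vector [u 0] would lie in the ranges of both [q] and [r],
     which are orthogonal. *)
  have : G (u 0%N, c (u 0%N)).
    by apply: h; exists 0, 0, (u 0%N); split=> //; rewrite !add0r.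
  move=> /Gq[qu _]; have u00 : u 0%N = 0.
    by rewrite -qu -(ru 0%N) -opM qr0 op0.
  have [_ /(_ 0%N (ltnSn 0))] := ou 1%N 0%N (ltnSn 0).
  by rewrite u00 form0l eqxx => /eqP; rewrite eq_sym oner_eq0.
split.
- split.
  + move=> _ _ [x [y [w [Gxy rw ->]]]] [x' [y' [w' [Gxy' rw' ->]]]].
    exists (x + x'), (y + y'), (w + w'); split; first exact: (GD _ _ Gxy Gxy').
      by rewrite bopD rw rw'.
    by rewrite bopD; congr (_, _); rewrite addrACA.
  + move=> k _ [x [y [w [Gxy rw ->]]]]; exists (k *: x), (k *: y), (k *: w).
    split; [exact: (GZ k _ Gxy)|by rewrite bopZ rw|].
    by rewrite bopZ; congr (_, _); rewrite scalerDr.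
  + move=> k _ [x [y [w [Gxy rw ->]]]]; exists (kact k x), (kact k y), (kact k w).
    split; [exact: (GK k _ Gxy)|by rewrite bopK rw|].
    by rewrite bopK; congr (_, _); rewrite kactDr.
- move=> _ _ [x [y [w [Gxy rw [-> ->]]]]] h; have [qx qy] := Gq _ _ Gxy.
  rewrite (qf_perp h (orth y (c w) qy (rcE w))) (qf_perp h (orth x w qx rw)).
  by rewrite mulrDr lerD// ?Gb.
- move=> _ _ _ _ [x [y [w [Gxy rw [-> ->]]]]] [x' [y' [w' [Gxy' rw' [-> ->]]]]].
  have [qx qy] := Gq _ _ Gxy; have [qx' qy'] := Gq _ _ Gxy'.
  rewrite !kinnerDl !kinnerDr (Gs _ _ _ _ Gxy Gxy') (orth y w')// (orth x (c w'))//.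
  rewrite (kinner_swap0 (orth x' (c w) _ _))// (kinner_swap0 (orth y' w _ _))//.
  by rewrite adjP sc.
- move=> _ _ [x [y [w [Gxy rw [-> ->]]]]]; have [[z' Gz] Lx] := Gi _ _ Gxy.
  split; first by exists (z' + c (c w)), y, z', (c w).
  by rewrite bopD Lx -rw -[L (r w)]opM -zr mulrA Lz.
- move=> _ _ [x [y [w [Gxy rw [-> _]]]]] t d d0.
  have d2 := divr_gt0 d0 (ltr0n R 2).
  have [x' [y' [Gxy' h1]]] := Gd _ _ Gxy t _ d2.
  have [w' rw' h2] := no_eigen_dense pr sc cr nc t rw d2.
  exists (x' + w'), (y' + c w'); split; first by exists x', y', w'.
  have -> : y' + c w' - t%:C *: (x' + w') - (x + w) =
      (y' - t%:C *: x' - x) + (c w' - t%:C *: w' - w).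
    by rewrite scalerDr !opprD [RHS]addrACA; congr (_ + _); rewrite addrACA.
  by rewrite (le_lt_trans (rnormD _ _))// [d]splitr ltrD.
Qed.

End ZornExhaustion.

(** * Connectedness of the selfadjoint Fredholm operators *)

Section SelfadjointConnected.
Context (R : realType) (H : hilbertType R) (E : hilbertModType H).
Context (e : H) (e1 : rnorm e = 1).
Implicit Types (x y z : E) (h : H) (a b f g q k : bop E) (t s : regop E).

Lemma sa_pair1l f : adj f = f -> sa_pair 1 f.
Proof.
move=> sf; split; rewrite ?adj1 ?mulr1 ?mul1r//.
  by move=> h x; rewrite op1 lerDl qf_ge0.
by apply/dense_rnorm => x d d0; exists x; rewrite ?subrr ?rnorm0//; exists x.
Qed.

Lemma sa_pair1r g : adj g = g -> dense (range g) -> sa_pair g 1.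
Proof.
move=> sg dg; split; rewrite ?adj1 ?mulr1 ?mul1r//.
by move=> h x; rewrite op1 lerDr qf_ge0.
Qed.

Lemma FredSR_pair t g f : sa_pair g f -> graph t = pgraph g f ->
  fredholm (pgraph g f) -> FredSR E t.
Proof.
move=> gf tE Ft; split; first by rewrite /FredR /= tE.
by rewrite tE (sa_pair_adjoint e1 gf).
Qed.

Lemma FredSR_pair1r t g : adj g = g -> dense (range g) -> graph t = pgraph g 1 ->
  FredSR E t.
Proof.
move=> sg dg tE; apply: (FredSR_pair (sa_pair1r sg dg) tE).
apply: (fredholm_invertible e1 dg _ (mulr1 1) (mulr1 1)) => x.
exact: (dense_range_inj e1 sg dg).
Qed.

(** A vector killed by [a] has no component off the range of [q], where [a] is the identity, and its
    component in the range is an eigenvector of [b] for [- u / v]. *)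
Lemma no_eigen_dense_range q b a (u v : R) : is_proj q -> b * q = b ->
  no_eigen q b -> adj a = a -> v != 0 ->
  q * a = u%:C *: q + v%:C *: b -> (1 - q) * a = 1 - q -> dense (range a).
Proof.
move=> [sq qq] bq nb sa v0 qa qa'; apply: (dense_range e1) => x; rewrite sa => ax.
have qx : q x = 0.
  apply: (nb (- (u / v))); first by rewrite -opM qq.
  have : (q * a) x = 0 by rewrite opM ax bop0.
  rewrite qa opD !opZ -[in b x]bq opM addrC => /eqP; rewrite addr_eq0 => /eqP h.
  have := congr1 (fun w => v^-1%:C *: w) h.
  rewrite scalerA -rmorphM /= mulVf// scale1r => ->.
  by rewrite scalerN scalerA -rmorphM /= rmorphN scaleNr mulrC.
have : ((1 - q) * a) x = 0 by rewrite opM ax bop0.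
by rewrite qa' opD opN op1 qx subr0.
Qed.

Lemma linked_identity q t s : is_proj q -> graph t = pgraph 1 (q + q - 1) ->
  graph s = pgraph 1 1 -> linked (FredSR E) t s.
Proof.
move=> pq0 tE sE; pose L : bop E := 1 - q; have [sq0 qq0] := pq0.
have pL : is_proj L.
  by split; rewrite /L ?adjB ?adj1 ?sq0// mulrBl mul1r mulrBr mulr1 qq0 subrr subr0.
have [sL LL] := pL.
have [p [b [w [[sp pp] LE [sb pb bp nb]]]]] := no_eigen_exhaustion e1 pL.
have pP : is_proj p by [].
set z := frank e1 w in LE; have sz : adj z = z.
  have -> : z = L - p by rewrite LE addrC addKr.
  by rewrite adjB sL sp.
pose J : bop E := q + q - 1; have [sJ JJ] : adj J = J /\ J * J = 1 := proj_symmetry pq0.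
(* The symmetry with negative subspace the range of [p]; it differs from [J] by the finite-rank
   operator [z + z], so the segment between them stays Fredholm with parametrix [J]. *)
pose J' : bop E := 1 - p - p.
have J'E : J + (z + z) = J'.
  have zE : z = 1 - q - p by rewrite -/L LE addrC addKr.
  have qz : q + z = 1 - p by rewrite zE addrA [q + (1 - q)]addrCA subrr addr0.
  rewrite /J addrAC addrACA qz addrAC [1 - p - 1]addrAC subrr add0r addrC.
  by [].
have sJ' : adj J' = J' by rewrite !adjB adj1 sp.
have J'J' : J' * J' = 1.
  have -> : J' = - (p + p - 1) by rewrite opprB opprD addrA.
  by rewrite mulrNN; have [_] := proj_symmetry pP.
have pJ' : p * J' = - p by rewrite !mulrBr mulr1 pp subrr sub0r.
have range_inv g k : g * k = 1 -> dense (range g).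
  move=> gk; apply/dense_rnorm => x d d0; exists x; last by rewrite subrr rnorm0.
  by exists (k x) => //; rewrite -opM gk.
have pairJ' : sa_pair 1 J' by exact: sa_pair1l.
pose t1 := Regop (sa_pair_regular e1 pairJ').
have link1 : linked (FredSR E) t t1.
  apply: (affine_linked e1 (g0 := 1) (g1 := 0) (f0 := J) (f1 := z + z)).
  - move=> r r01; rewrite scaler0 addr0; apply: sa_pair1l.
    by rewrite adjD adjZr adjD sz sJ.
  - move=> r t' r01; rewrite scaler0 addr0 => t'E.
    have sf : adj (J + r%:C *: (z + z)) = J + r%:C *: (z + z).
      by rewrite adjD adjZr adjD sz sJ.
    apply: (FredSR_pair (sa_pair1l sf) t'E).
    have cz : cpt (r%:C *: (z + z)) by apply: (cptZ e1); apply: (cptD e1); exact: cpt_frank.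
    apply: (fredholm_bounded (b := J)).
      by rewrite mulrDl JJ addrC addKr; exact: (cptMr e1).
    by rewrite mulrDr JJ addrC addKr; exact: (cptMl e1).
  - exact: tE.
  - by rewrite /= addr0 J'E.
have dJ' : dense (range J') := range_inv _ _ J'J'.
pose a := 1 - p + b; have sa : adj a = a by rewrite adjD adjB adj1 sp sb.
have pa : p * a = b by rewrite mulrDr mulrBr mulr1 pp subrr add0r.
have q1 : (1 - p) * p = 0 by rewrite mulrBl mul1r pp subrr.
have q2 : (1 - p) * b = 0 by rewrite mulrBl mul1r pb subrr.
have q3 : (1 - p) * (1 - p) = 1 - p by rewrite mulrBr q1 mulr1 subr0.
have qJ' : (1 - p) * J' = 1 - p by rewrite mulrBr q3 q1 subr0.
have qa : (1 - p) * a = 1 - p by rewrite mulrDr q3 q2 addr0.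
have da : dense (range a).
  apply: (no_eigen_dense_range (u := 0) (v := 1) pP bp nb sa) => //.
  by rewrite pa scale0r scale1r add0r.
pose t2 := Regop (sa_pair_regular e1 (sa_pair1r sa da)).
(* The pairs [(g, 1)] represent inverses of bounded operators [g]. On the range of [p] the
   denominator is [(r - 1) + r b], which goes from -1 to [b]. *)
have link2 : linked (FredSR E) t1 t2.
  have sg r : adj (J' + r%:C *: (p + b)) = J' + r%:C *: (p + b).
    by rewrite adjD adjZr adjD sJ' sp sb.
  have dg r : dense (range (J' + r%:C *: (p + b))).
    have [->|r0] := eqVneq r 0; first by rewrite scale0r addr0.
    apply: (no_eigen_dense_range (u := r - 1) (v := r) pP bp nb (sg r)) => //.
      rewrite mulrDr pJ' -op_scalerAr mulrDr pp pb scalerDr addrA.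
      by rewrite rmorphB /= scalerBl scale1r [- p + _]addrC.
    by rewrite mulrDr qJ' -op_scalerAr mulrDr q1 q2 addr0 scaler0 addr0.
  apply: (affine_linked e1 (g0 := J') (g1 := p + b) (f0 := 1) (f1 := 0)).
  - by move=> r r01; rewrite scaler0 addr0; exact: sa_pair1r.
  - move=> r t' r01; rewrite scaler0 addr0; exact: FredSR_pair1r.
  (* [J'] is its own inverse, so [(1, J')] and [(J', 1)] parametrize the same graph; here the path
     passes from operators to inverses. *)
  - rewrite /=; apply/seteqP; split=> _ [x ->]; exists (J' x).
      by rewrite !op1 -opM J'J' op1.
    by rewrite !op1 -opM J'J' op1.
  - by rewrite /= addr0 /J' addrA subrK.
have link3 : linked (FredSR E) t2 s.
  have sg r : adj (a + r%:C *: (p - b)) = a + r%:C *: (p - b).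
    by rewrite adjD adjZr adjB sa sp sb.
  have dg r : dense (range (a + r%:C *: (p - b))).
    (* The coefficient [1 - r] of [b] vanishes at the end, where the denominator is the identity. *)
    have [->|r1] := eqVneq r 1.
      rewrite scale1r (_ : a + (p - b) = 1); first exact: (range_inv 1 1 (mulr1 1)).
      by rewrite /a addrACA subrr addr0 subrK.
    apply: (no_eigen_dense_range (u := r) (v := 1 - r) pP bp nb (sg r)) => //.
    - by rewrite subr_eq0 eq_sym.
    - rewrite mulrDr pa -op_scalerAr mulrBr pp pb scalerBr addrC -addrA.
      by rewrite rmorphB /= scalerBl scale1r [- _ + _]addrC.
    - by rewrite mulrDr qa -op_scalerAr mulrBr q1 q2 subrr scaler0 addr0.
  apply: (affine_linked e1 (g0 := a) (g1 := p - b) (f0 := 1) (f1 := 0)).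
  - by move=> r r01; rewrite scaler0 addr0; exact: sa_pair1r.
  - move=> r t' r01; rewrite scaler0 addr0; exact: FredSR_pair1r.
  - by [].
  - rewrite sE addr0; congr pgraph; rewrite /a addrACA subrr addr0.
    by rewrite subrK.
by apply: linked_trans link1 _; exact: linked_trans link2 link3.
Qed.

Lemma FredSR_linked t s : FredSR E t -> FredSR E s -> linked (FredSR E) t s.
Proof.
have p1 : sa_pair (1 : bop E) 1 by apply: sa_pair1l; exact: adj1.
pose i := Regop (sa_pair_regular e1 p1).
have to_id t' : FredSR E t' -> linked (FredSR E) t' i.
  move=> /(linked_symmetry e1)[q [r [pq rE tr]]].
  by apply: linked_trans tr _; exact: linked_identity pq rE _.
move=> /to_id ti /to_id si; apply: linked_trans ti _; exact: linked_sym.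
Qed.

End SelfadjointConnected.

(** * The Fredholm alternative *)

Section FredholmAlternative.
Context (R : realType) (H : hilbertType R) (E : hilbertModType H).
Context (e : H) (e1 : rnorm e = 1).
Implicit Types (x y z w : E) (h : H) (a b f g q k v : bop E) (s : seq (E * E)).

Definition ran_e_seq s := forall u, u \in s -> ran_e e u.1 /\ ran_e e u.2.

(** Each summand [theta v v] of [eproj] factors as [theta v e] times [theta e v]; moving the first
    factor into the inner product puts both vectors into [ran_e e]. *)
Lemma brank1_eproj x y (vs : seq H) : exists2 s, ran_e_seq s &
  brank1 e1 x (eproj vs y) = frank e1 s.
Proof.
exists [seq (kact (theta e l) x, kact (theta e l) y) | l <- vs].
  by move=> _ /mapP[v _ ->]; split; exact: ran_e_theta.
rewrite /frank big_map /eproj; elim: vs => [|v vs IH].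
  by rewrite !big_nil; apply: bopP => z; rewrite /= /rank1 kactr0.
rewrite !big_cons -IH; apply: bopP => z; rewrite opD /= /rank1 kactDr; congr (_ + _).
rewrite kinner_thetar kactM; congr (kact _ _).
by rewrite -kactM theta_theta (hdot_e e1) scale1r.
Qed.

(** Inner products of vectors of [ran_e e] are scalar multiples of [theta e e], so these
    approximants can be handled by scalar matrices. *)
Lemma cpt_approx k : cpt k -> forall d : R, 0 < d -> exists2 s, ran_e_seq s &
  forall x, rnorm ((k - frank e1 s) x) <= d * rnorm x.
Proof.
move=> /(cptP e1) ck d d0; have d2 := divr_gt0 d0 (ltr0n R 2).
have [s0 hs0] := ck _ d2.
suff [s es hs] : exists2 s, ran_e_seq s &
    forall x, rnorm ((frank e1 s0 - frank e1 s) x) <= d / 2 * rnorm x.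
  exists s => // x; rewrite -(subrKA (frank e1 s0)) opD (le_trans (rnormD _ _))//.
  by rewrite [d in leRHS]splitr mulrDl; apply: lerD.
elim: s0 {hs0} (d / 2) d2 => [|u s0 IH] c c0.
  exists [::] => [u|x]; first by rewrite in_nil.
  by rewrite subrr op0 rnorm0 mulr_ge0 ?rnorm_ge0 ?(ltW c0).
have c2 := divr_gt0 c0 (ltr0n R 2); have [s es hs] := IH _ c2.
have u0 : 0 < rnorm u.1 + 1 by rewrite ltr_wpDl// rnorm_ge0.
have [vs hvs] := eproj_dense u.2 (divr_gt0 c2 u0).
have [s' es' s'E] := brank1_eproj u.1 u.2 vs.
exists (s' ++ s) => [w|x].
  by rewrite mem_cat => /orP[/es'|/es].
rewrite frank_cat -s'E /frank big_cons -/(frank e1 s0) -/(frank e1 s) opprD addrACA opD.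
rewrite (le_trans (rnormD _ _))// [c in leRHS]splitr mulrDl; apply: lerD => //.
rewrite opD opN /= /rank1 -kactBr -/(rank1 u.1 _ x) (le_trans (rank1_bound e1 _ _ _))//.
rewrite ler_wpM2r ?rnorm_ge0//.
rewrite (@le_trans _ _ ((rnorm u.1 + 1) * rnorm (u.2 - eproj vs u.2)))//.
  by rewrite ler_wpM2r ?rnorm_ge0// lerDl.
by rewrite mulrC -ler_pdivlMr// ltW.
Qed.

Lemma frank_alternative s : ran_e_seq s ->
  (forall x, (1 + frank e1 s) x = 0 -> x = 0) ->
  forall w, exists x, (1 + frank e1 s) x = w.
Proof.
move=> es inj w; pose n := size s.
pose x i := (tnth (in_tuple s) i).1; pose y i := (tnth (in_tuple s) i).2.
have ex i : ran_e e (x i) by have [] := es _ (mem_tnth i (in_tuple s)).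
have ey i : ran_e e (y i) by have [] := es _ (mem_tnth i (in_tuple s)).
have FE z : frank e1 s z = \sum_(i < n) kact (kinner z (x i) : compop H) (y i).
  by rewrite frankE big_tnth.
pose M : 'M[R[i]]_n := \matrix_(i, j) form e (y i) (x j).
have yx i j : kinner (y i) (x j) = M i j *: theta e e :> compop H.
  by rewrite mxE; exact: kinner_ran_e.
have kinner_sum (z : 'I_n -> E) u :
    kinner (\sum_i z i) u = \sum_i kinner (z i) u :> compop H.
  by apply: (big_morph (fun t => kinner t u : compop H)) => [a b|]; rewrite ?kinnerDl ?kinner0l.
have kact_sum (c : 'I_n -> compop H) u :
    kact (\sum_i c i) u = \sum_i kact (c i) u.
  by apply: (big_morph (fun t => kact t u)) => [a b|]; rewrite ?kactDl ?kact0.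
have theta_n0 : theta e e != 0 :> compop H.
  apply/eqP => /(congr1 (fun k : compop H => hdot (k e) e)).
  by rewrite compop0 hdot0l thetaE hdotZl (hdot_e e1) mul1r => /eqP; rewrite oner_eq0.
(* A row [v] killed by [1 + M] gives a combination [z] of the [y i] killed by the operator, so
   [z = 0]. The [y i] may be dependent; what follows is [v M = 0], and with it [v = 0]. *)
have uA : 1%:M + M \in unitmx.
  rewrite unitmxE unitfE; apply/det0P; case=> v v0 vA.
  pose z := \sum_i v 0 i *: y i.
  have zx j : kinner z (x j) = (v *m M) 0 j *: theta e e :> compop H.
    rewrite kinner_sum mxE scaler_suml; apply: eq_bigr => i _.
    by rewrite kinnerZl yx scalerA.
  have z0 : z = 0.
    apply: inj; rewrite opD op1 FE /z -big_split /= big1// => j _.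
    rewrite zx kactZl ey -scalerDl.
    have := congr1 (fun r : 'rV_n => r 0 j) vA.
    by rewrite mulmxDr mulmx1 !mxE => ->; rewrite scale0r.
  have vM : v *m M = 0.
    apply/rowP => j; rewrite [RHS]mxE; apply/eqP.
    have := zx j; rewrite z0 kinner0l => /esym/eqP.
    by rewrite scaler_eq0 (negbTE theta_n0) orbF.
  by move: vA; rewrite mulmxDr mulmx1 vM addr0 => v00; rewrite v00 eqxx in v0.
pose B := invmx (1%:M + M).
(* Searching the solution as [w] minus a combination of the [y i] with coefficients in [K(H)] leaves
   a linear system with the scalar matrix [1 + M]. *)
pose c i : compop H := \sum_j B j i *: kinner w (x j).
exists (w - \sum_i kact (c i) (y i)).
rewrite opD op1 FE -[RHS]addr0 -addrA; congr (_ + _); rewrite addrC.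
apply/eqP; rewrite subr_eq0; apply/eqP/eq_bigr => l _.
suff -> : kact (kinner (w - \sum_i kact (c i) (y i)) (x l) : compop H) (y l) =
    kact (kinner w (x l) - \sum_i M i l *: c i) (y l).
  congr (kact _ (y l)); apply/eqP; rewrite subr_eq; apply/eqP.
  have -> : c l + \sum_i M i l *: c i = \sum_i (1%:M + M) i l *: c i.
    have AE i : (1%:M + M) i l = (i == l)%:R + M i l by rewrite !mxE.
    under [RHS]eq_bigr => i _ do rewrite AE scalerDl.
    rewrite big_split /=; congr (_ + _).
    rewrite (bigD1 l)//= eqxx scale1r big1 ?addr0// => i il.
    by rewrite (negbTE il) scale0r.
  rewrite (eq_bigr (fun i => \sum_j ((B j i * (1%:M + M) i l) *: kinner w (x j) : compop H))); last first.
    by move=> i _; rewrite scaler_sumr; apply: eq_bigr => j _; rewrite scalerA mulrC.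
  rewrite exchange_big /= (bigD1 l)//= -scaler_suml.
  have BA j : \sum_i B j i * (1%:M + M) i l = (j == l)%:R.
    have := congr1 (fun r : 'M[R[i]]_n => r j l) (mulVmx uA).
    by rewrite [LHS]mxE [RHS]mxE.
  rewrite BA eqxx scale1r big1 ?addr0// => j jl.
  by rewrite -scaler_suml BA (negbTE jl) scale0r.
have kactN (a : compop H) u : kact (- a) u = - kact a u :> E.
  by rewrite -scaleN1r kactZl scaleN1r.
rewrite kinnerBl !kactDl !kactN kinner_sum; congr (_ - _).
rewrite !kact_sum; apply: eq_bigr => i _.
by rewrite kinner_act yx kactM kactZl ey kactZr kactZl.
Qed.

(** Up to an error [d] of norm at most 1/2, [k] has finite rank. Dividing by the invertible [1 + d]
    leaves 1 plus finite rank, whose vectors stay in [ran_e e] as operators commute with [K(H)]. *)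
Lemma fredholm_alternative k : cpt k -> (forall x, (1 + k) x = 0 -> x = 0) ->
  forall w, exists x, (1 + k) x = w.
Proof.
move=> ck inj w; have h0 : (0 : R) < 2^-1 by rewrite invr_gt0.
have [s es hs] := cpt_approx ck h0.
pose d := k - frank e1 s; pose W := 1 + d.
have lowb (a : bop E) : (forall x, rnorm (a x) <= 2^-1 * rnorm x) ->
    forall x, 2^-1 * rnorm x <= rnorm ((1 + a) x).
  move=> ha x; have := rnormB ((1 + a) x) (a x); rewrite opD op1 addrK.
  by have := ha x; lra.
have [|V WV VW] := bop_invertible e1 h0 (lowb _ hs).
  by rewrite adjD adj1; apply: lowb; apply: (adj_bound e1 (ltW h0)).
rewrite -/d -/W in WV VW.
have kE : 1 + k = W * (1 + V * frank e1 s).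
  by rewrite mulrDr mulr1 mulrA WV mul1r /W /d -addrA subrK.
have es' : ran_e_seq [seq (u.1, V u.2) | u <- s].
  move=> _ /mapP[u /es[eu1 eu2] ->]; split=> //=.
  by rewrite /ran_e -bopK eu2.
have [x|x xw] := frank_alternative es' _ (V w).
  by rewrite -frankMl => hx; apply: inj; rewrite kE opM hx bop0.
by exists x; rewrite kE frankMl opM xw -opM WV op1.
Qed.

End FredholmAlternative.

(** * Invariance of the index *)

Section IndexZero.
Context (R : realType) (H : hilbertType R) (E : hilbertModType H).
Context (e : H) (e1 : rnorm e = 1).
Implicit Types (x y z w : E) (h : H) (a b f g q k v : bop E) (t s : regop E).

Definition binv a := exists2 b, a * b = 1 & b * a = 1.

Lemma binvM a b : binv a -> binv b -> binv (a * b).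
Proof.
move=> [a' aa aa'] [b' bb bb']; exists (b' * a').
  by rewrite -mulrA [b * (_ * _)]mulrA bb mul1r.
by rewrite -mulrA [a' * (_ * _)]mulrA aa' mul1r.
Qed.

(* For a Fredholm operator, this means that its index vanishes. *)
Definition inv_cpt a := exists v k, [/\ binv v, cpt k & a = v + k].

Lemma inv_cpt_binv a : binv a -> inv_cpt a.
Proof. by move=> ia; exists a, 0; split; rewrite ?addr0//; exact: (cpt0 E e1). Qed.

(** Modulo [K(E)] the operators in [inv_cpt] are images of invertible ones, so one factor can be
    divided out of a product; the next lemma treats the other factor. *)
Lemma inv_cpt_left a b : inv_cpt (a * b) -> inv_cpt b -> inv_cpt a.
Proof.
move=> [w [k1 [iw c1 abE]]] [v [k2 [[v' vv vv'] c2 bE]]].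
exists (w * v'), ((k1 - a * k2) * v'); split.
- by apply: binvM => //; exists v.
- by apply: (cptMr e1); apply: (cptB e1) => //; exact: (cptMl e1).
- by rewrite -mulrDl addrA -abE bE mulrDr addrK -mulrA vv mulr1.
Qed.

Lemma inv_cpt_right a b : inv_cpt (a * b) -> inv_cpt a -> inv_cpt b.
Proof.
move=> [w [k1 [iw c1 abE]]] [v [k2 [[v' vv vv'] c2 aE]]].
exists (v' * w), (v' * (k1 - k2 * b)); split.
- by apply: binvM => //; exists v.
- by apply: (cptMl e1); apply: (cptB e1) => //; exact: (cptMr e1).
- by rewrite -mulrDr addrA -abE aE mulrDl addrK mulrA vv' mul1r.
Qed.

Definition ind0 t := exists g f, rep (graph t) g f /\ inv_cpt f.

Lemma rep_orthoproj T g f : rep T g f ->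
  orthoproj T = (fun u => (g (g u.1 + adj f u.2), f (g u.1 + adj f u.2))).
Proof.
move=> [-> sg gf1 _]; apply: orthoproj_uniq.
have := @pgraph_orthoproj _ _ _ g f 1; rewrite sg => h; apply: h.
by rewrite gf1 mulr1.
Qed.

Lemma rep_qf T g f h x : rep T g f -> qf h (g x) + qf h (f x) = qf h x.
Proof.
move=> [_ sg gf1 _].
have -> : qf h x = complex.Re (form h ((g * g + adj f * f) x) x) by rewrite gf1.
rewrite opD formDl ReD !opM.
by rewrite (form_adj h g) (form_adj h (adj f)) adjK sg.
Qed.

Lemma rep_norm2 T g f x : rep T g f -> norm2 (g x, f x) = rnorm x.
Proof.
move=> r; apply/eqP; rewrite eq_le; apply/andP; split.
  apply: norm2_le (rnorm_ge0 _) _ => h h1 /=; rewrite (rep_qf h x r) -sn_sqr.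
  by rewrite ler_pXn2r ?nnegrE ?sn_ge0 ?rnorm_ge0// sn_le_rnorm1.
apply: rnorm_le_sn (norm2_ge0 _) _ => h h1; apply: sn_le (norm2_ge0 _) _.
by rewrite -(rep_qf h x r) (qf2_le_norm2 (g x, f x) h1).
Qed.

Lemma gap_bound t s (g f g' f' : bop E) (d : R) : rep (graph t) g f ->
  rep (graph s) g' f' -> (gap t s < d%:E)%E -> forall u,
  norm2 (orthoproj (graph t) u - orthoproj (graph s) u) <= d * norm2 u.
Proof.
move=> r r' gd u; pose P u := orthoproj (graph t) u - orthoproj (graph s) u.
have PZ (c : R) (v : E * E) : P (c%:C *: v) = c%:C *: P v.
  rewrite /P (rep_orthoproj r) (rep_orthoproj r') scalerBr.
  by congr (_ - _); congr (_, _); rewrite /= !bopZ -scalerDr bopZ.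
have [u0|u0] := eqVneq (norm2 u) 0.
  have [h1 h2] := rnorm_le_norm2 u; rewrite u0 in h1 h2.
  have z1 : u.1 = 0 by apply: rnorm_eq0; apply/eqP; rewrite eq_le h1 rnorm_ge0.
  have z2 : u.2 = 0 by apply: rnorm_eq0; apply/eqP; rewrite eq_le h2 rnorm_ge0.
  have -> : u = 0%:C *: u by case: u z1 z2 {u0 h1 h2} => x y /= -> ->; rewrite scaler0.
  by rewrite -/(P _) PZ !norm2Z ?lexx// !mul0r mulr0.
have up : 0 < norm2 u by rewrite lt0r u0 norm2_ge0.
rewrite -ler_pdivrMr// mulrC -norm2Z ?invr_ge0 ?(ltW up)// -/(P u) -PZ.
rewrite -lee_fin (le_trans _ (ltW gd))//; apply: ereal_sup_ubound.
exists ((norm2 u)^-1%:C *: u) => //=.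
by rewrite norm2Z ?invr_ge0 ?(ltW up)// mulVf.
Qed.

Section Comparison.
Context (t s : regop E) (g f g' f' : bop E) (d : R).
Context (r : rep (graph t) g f) (r' : rep (graph s) g' f').
Context (gd : (gap t s < d%:E)%E).

(** In the isometric coordinates [A x = (g x, f x)] of the two graphs, this is the projection onto
    the graph of [s] restricted to the graph of [t]. *)
Let X : bop E := g' * g + adj f' * f.

Lemma compare_diff x :
  norm2 ((g x, f x) - (g' (X x), f' (X x))) <= d * rnorm x.
Proof.
have := gap_bound r r' gd (g x, f x); rewrite (rep_norm2 x r).
rewrite (rep_orthoproj r) (rep_orthoproj r') /=.
have [_ _ gf1 _] := r.
have -> : g (g x) + adj f (f x) = x by rewrite -!opM -opD gf1.
by rewrite -[g' (g x)]opM -[adj f' (f x)]opM -opD.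
Qed.

Lemma compare_low x : (1 - d) * rnorm x <= rnorm (X x).
Proof.
have := compare_diff x; have := norm2D ((g x, f x) - (g' (X x), f' (X x))) (g' (X x), f' (X x)).
by rewrite subrK (rep_norm2 x r) (rep_norm2 (X x) r'); lra.
Qed.

Lemma compare_f x : rnorm ((f - f' * X) x) <= d * rnorm x.
Proof.
apply: le_trans (compare_diff x).
by have [_] := rnorm_le_norm2 ((g x, f x) - (g' (X x), f' (X x))).
Qed.

End Comparison.

Lemma ind0_near t : FredR E t -> exists2 d : R, 0 < d &
  forall s, (gap t s < d%:E)%E -> ind0 s <-> ind0 t.
Proof.
move=> Ft; have [g [f [r _]]] := regular_rep e1 (graph_regular t).
have [tE sg gf1 _] := r.
have [b cb] : exists b, cpt (f * b - 1).
  apply: (@fredholm_right _ _ _ g f); first by rewrite sg.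
    by rewrite -tE; have [] := graph_regular t.
  by rewrite -tE.
have [C C0 bC] := bop_bound b.
(* Small enough for [d C <= 1/2], which controls the perturbation of [f b], and for [d <= 1/2],
   which makes [X] bounded below. *)
pose d := (2 * (C + 1))^-1; have C1 : 0 < C + 1 by rewrite ltr_wpDl.
have d0 : 0 < d by rewrite invr_gt0 mulr_gt0.
have dC : d * (C + 1) = 2^-1 by rewrite /d invfM -mulrA mulVf ?mulr1// gt_eqF.
have d2 : d <= 2^-1.
  by rewrite -dC -[leLHS]mulr1 ler_wpM2l ?(ltW d0)// lerDr.
(* The parametrix [b] depends on [t] alone, so comparing it with every nearby [s], in particular
   with [t], gives the equivalence. *)
suff key s : (gap t s < d%:E)%E -> ind0 s <-> inv_cpt b.
  exists d => // s ts; rewrite (key s ts) -(key t)//.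
  by rewrite gapxx lte_fin.
move=> gd; have rep_iff g' f' : rep (graph s) g' f' -> inv_cpt f' <-> inv_cpt b.
  move=> r'; pose X : bop E := g' * g + adj f' * f.
  have [_ sg' _ _] := r'.
  have iX : binv X.
    have d1 : 0 < 1 - d by move: d2; lra.
    apply: (bop_invertible e1 d1); first exact: (compare_low r r' gd).
    (* The adjoint of [X] is the comparison operator with [t] and [s] exchanged. *)
    have gd' : (gap s t < d%:E)%E by rewrite gapC.
    by rewrite adjD !adjM adjK sg sg'; exact: (compare_low r' r gd').
  have small x : rnorm (((f - f' * X) * b) x) <= 2^-1 * rnorm x.
    rewrite opM (le_trans (compare_f r r' gd _))//.
    rewrite (@le_trans _ _ (d * ((C + 1) * rnorm x)))//; last by rewrite mulrA dC.
    rewrite ler_wpM2l ?(ltW d0)// (le_trans (bC x))// ler_wpM2r ?rnorm_ge0//.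
    by rewrite lerDl.
  have h0 : (0 : R) < 2^-1 by rewrite invr_gt0.
  have iW : binv (1 - (f - f' * X) * b).
    have lowb (a : bop E) : (forall x, rnorm (a x) <= 2^-1 * rnorm x) ->
        forall x, 2^-1 * rnorm x <= rnorm ((1 - a) x).
      move=> ha x; have := rnormD ((1 - a) x) (a x); rewrite opD op1 opN subrK.
      by have := ha x; lra.
    apply: (bop_invertible e1 h0 (lowb _ small)).
    by rewrite adjB adj1; apply: lowb; apply: (adj_bound e1 (ltW h0)).
  (* The operator equals [1 - (f - f' X) b], a small perturbation of 1, plus the compact
     [f b - 1]. *)
  have fXb : inv_cpt (f' * X * b).
    exists (1 - (f - f' * X) * b), (f * b - 1); split=> //.
    by rewrite mulrBl opprB [RHS]addrC addrA subrK addrC subrK.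
  have fX : inv_cpt (f' * X) <-> inv_cpt f'.
    split=> h; first exact: inv_cpt_left h (inv_cpt_binv iX).
    have [V XV VX] := iX; apply: (@inv_cpt_left _ V); last first.
      by apply: inv_cpt_binv; exists X.
    by rewrite -mulrA XV mulr1.
  rewrite -fX; split=> h; first exact: inv_cpt_right fXb h.
  exact: inv_cpt_left fXb h.
split=> [[g' [f' [r' h]]]|h]; first by apply/(rep_iff _ _ r').
have [g' [f' [r' _]]] := regular_rep e1 (graph_regular s).
by exists g', f'; split=> //; apply/(rep_iff _ _ r').
Qed.

Lemma regular_bounded a : regular (pgraph 1 a).
Proof.
have dT (N : set E) : (forall x, N x) -> dense N.
  by move=> hN; apply/dense_rnorm => x d d0; exists x; rewrite ?subrr ?rnorm0.
have ad x : adjoint (pgraph 1 a) (x, adj a x).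
  by move=> _ _ [y [-> ->]] /=; rewrite adjP.
split.
- split.
  + by exists 0; rewrite !bop0.
  + by move=> _ _ [x ->] [y ->]; exists (x + y); rewrite !bopD.
  + by move=> c _ [x ->]; exists (c *: x); rewrite !bopZ.
  + by move=> c _ [x ->]; exists (kact c x); rewrite !bopK.
  + by move=> y [x [x0 ->]]; have /= <- := x0; rewrite bop0.
- rewrite (_ : pgraph 1 a = graph_of a); first exact: closed_graph_of.
  apply/seteqP; split=> [_ [x ->]//|[x y] xy]; exists x.
  by congr (_, _).
- by apply: dT => x; exists (a x), x.
- by apply: dT => x; exists (adj a x); exact: ad.
apply: dT => w; have sc : adj (1 + adj a * a) = 1 + adj a * a.
  by rewrite adjD adj1 adjM adjK.
have [|c ac _] := bop_invertible_sn e1 (@ltr01 R) sc.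
  move=> h x; rewrite mul1r opD formDl ReD op1 lerDl opM form_adjr.
  exact: qf_ge0.
exists (c w), (a (c w)), (adj a (a (c w))); split; [by exists (c w)|exact: ad|].
have := congr1 (fun k : bop E => k w) ac.
by rewrite opM opD opM !op1.
Qed.

Definition bounded_regop a : regop E := Regop (regular_bounded a).

Lemma FredR_bounded a b : cpt (a * b - 1) -> cpt (b * a - 1) ->
  FredR E (bounded_regop a).
Proof. exact: fredholm_bounded. Qed.

Lemma ind0_id : ind0 (bounded_regop 1).
Proof.
have [g [f [r _]]] := regular_rep e1 (regular_bounded 1).
exists g, f; split=> //; have [gE sg gf1 _] := r.
have fg : f = g.
  apply: bopP => x; have : pgraph g f (g x, f x) by exists x.
  by rewrite -gE => -[y [-> ->]].
rewrite fg; rewrite fg sg in gf1.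
(* For the identity [f = g] and [2 g^2 = 1], so [2 g] is the inverse. *)
apply: inv_cpt_binv; exists (g + g); first by rewrite mulrDr.
by rewrite mulrDl.
Qed.

(** Here [f = a g] is injective, so index zero and the Fredholm alternative make it onto. Any [x] is
    then [a g y], and [adj a x = g y] can vanish only with [x]. *)
Lemma ind0_isometry a : adj a * a = 1 -> ind0 (bounded_regop a) ->
  forall x, adj a x = 0 -> x = 0.
Proof.
move=> aa [g [f [[gE sg gf1 _] [v [k [[v' vv vv'] ck fE]]]]]] x ax.
have aE y : adj a (a y) = y by rewrite -opM aa.
have fa y : f y = a (g y).
  have : pgraph g f (g y, f y) by exists y.
  by rewrite -gE => -[w [-> ->]].
have vf y : (1 + v' * k) y = v' (f y).
  by rewrite fE !opD op1 bopD opM -[v' (v y)]opM vv'.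
have [y|y hy] := fredholm_alternative e1 (cptMl e1 v' ck) _ (v' x).
  rewrite vf => /(congr1 v); rewrite -opM vv op1 bop0 => fy.
  have gy : g y = 0 by rewrite -(aE (g y)) -fa fy bop0.
  by rewrite -[y]op1 -gf1 opD !opM fy gy !bop0 addr0.
move: hy; rewrite vf => /(congr1 v); rewrite -!opM vv !op1 => fy.
have gy : g y = 0 by rewrite -(aE (g y)) -fa fy ax.
by rewrite -fy fa gy bop0.
Qed.

Lemma exists_shift_isometry : ~ cpt (1 : bop E) -> exists a x,
  [/\ adj a * a = 1, cpt (a * adj a - 1), adj a x = 0 & x <> 0].
Proof.
move=> nc; have p1 : is_proj (1 : bop E) by split; [exact: adj1|rewrite mulr1].
have [[s sE]|[u ou _]] := dichotomy e1 p1.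
  by exfalso; apply: nc; rewrite sE; exact: cpt_frank.
have [q [S [[_ [sq qq] qu] [SS Sq qS] SS' _ [_ _ Su0]]]] :=
  exists_unilateral_shift e1 ou.
have qS' : q * adj S = adj S by rewrite -{1}sq -adjM Sq.
have Sq' : adj S * q = adj S by rewrite -{1}sq -adjM qS.
(* The isometry [c + S] is the shift on the range of [q] and the identity on the complement. *)
have [c cE] : exists c : bop E, c = 1 - q by exists (1 - q).
have sc : adj c = c by rewrite cE adjB adj1 sq.
have cc : c * c = c by rewrite cE mulrBl mul1r mulrBr mulr1 qq subrr subr0.
have cS : c * S = 0 by rewrite cE mulrBl mul1r qS subrr.
have cS' : c * adj S = 0 by rewrite cE mulrBl mul1r qS' subrr.
have Sc : S * c = 0 by rewrite cE mulrBr mulr1 Sq subrr.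
have Sc' : adj S * c = 0 by rewrite cE mulrBr mulr1 Sq' subrr.
exists (c + S), (u 0%N); rewrite adjD sc; split.
- by rewrite mulrDl !mulrDr cc cS Sc' SS addr0 add0r cE subrK.
- rewrite mulrDl !mulrDr cc cS' Sc SS' addr0 add0r cE addrA subrK.
  rewrite addrAC subrr add0r.
  have [w wE] : exists w : seq (E * E), brank1 e1 (u 0%N) (u 0%N) = frank e1 w.
    by exists [:: (u 0%N, u 0%N)]; rewrite /frank big_seq1.
  by rewrite wE; apply: (cptN e1); exact: cpt_frank.
- by rewrite opD cE opD opN op1 qu Su0 subrr addr0.
move=> u0; have [_ /(_ 0%N (ltnSn 0))] := ou 1%N 0%N (ltnSn 0).
by rewrite u0 form0l eqxx => /eqP; rewrite eq_sym oner_eq0.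
Qed.

Lemma FredR_not_connected : ~ cpt (1 : bop E) -> ~ path_connected R (FredR E).
Proof.
move=> nc pc; have [a [x [aa ca ax x0]]] := exists_shift_isometry nc.
have F1 : FredR E (bounded_regop 1).
  have c0 : cpt ((1 : bop E) * 1 - 1) by rewrite mulr1 subrr; exact: (cpt0 E e1).
  exact: (FredR_bounded c0 c0).
have Fa : FredR E (bounded_regop a).
  have c0 : cpt (adj a * a - 1) by rewrite aa subrr; exact: (cpt0 E e1).
  exact: (FredR_bounded ca c0).
have na : ~ ind0 (bounded_regop a) by move=> /(ind0_isometry aa)/(_ x ax).
have [p [cp p0 p1 pF]] := pc _ _ F1 Fa.
pose K := p @` `[0, 1]; have cK : connected K.
  by apply: connected_continuous_connected => //; exact: segment_connected.
have K0 : K (bounded_regop 1) by exists 0 => //=; rewrite in_itv /= lexx ler01.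
have K1 : K (bounded_regop a) by exists 1 => //=; rewrite in_itv /= lexx ler01.
pose I : set (regop E) := [set t | ind0 t].
have nbI t : K t -> I t -> nbhs t I.
  move=> Kt It; have [d d0 hd] := ind0_near (pF _ Kt).
  by apply/nbhs_ballP; exists d => //= s; rewrite gap_ballE => /hd hs; apply/hs.
have nbnI t : K t -> ~ I t -> nbhs t (~` I).
  move=> Kt It; have [d d0 hd] := ind0_near (pF _ Kt).
  by apply/nbhs_ballP; exists d => //= s; rewrite gap_ballE => /hd hs Is; apply/It/hs.
have KI : K `&` I = K.
  apply: cK.
  - by exists (bounded_regop 1); split=> //; exact: ind0_id.
  - exists I^°%classic; first exact: open_interior.
    apply/seteqP; split=> [t [Kt It]|t [Kt /interior_subset It]]; split=> //.
    exact: nbI.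
  - exists (~` (~` I)^°)%classic; first by apply: open_closedC; exact: open_interior.
    apply/seteqP; split=> [t [Kt It]|t [Kt nIt]]; split=> //.
      by move=> /interior_subset; apply.
    by apply: contrapT => nI; apply: nIt; exact: nbnI.
by apply: na; have [] : (K `&` I) (bounded_regop a) by rewrite KI.
Qed.

End IndexZero.

Lemma no_unit_vector (R : realType) (H : hilbertType R) (E : hilbertModType H) :
  (forall e : H, rnorm e != 1) -> forall x : E, x = 0.
Proof.
move=> ne x; have h0 (h : H) : h = 0.
  apply: rnorm_eq0; apply/eqP; apply/negP => /negP hn.
  have hp : 0 < rnorm h by rewrite lt0r hn rnorm_ge0.
  have := ne ((rnorm h)^-1%:C *: h).
  by rewrite rnormZ ?invr_ge0 ?(ltW hp)// mulVf// eqxx.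
by apply: kinner_eq0; apply: compopP => h; rewrite [LHS]h0 [RHS]h0.
Qed.

(** The second half is stated for a noncompact identity, that is, for [E] of infinite rank: for
    [E = 0] the space of regular Fredholm operators is a single point. *)
Theorem corollary4p3 (R : realType) (H : hilbertType R) (E : hilbertModType H) :
  path_connected R (FredSR E) /\
  (~ compact_adjointable (fun x : E => x) -> ~ path_connected R (FredR E)).
Proof.
have [[e /eqP e1]|/forallNP ne] := pselect (exists e : H, rnorm e == 1).
  split; first by move=> t s Ft Fs; apply: linked_path; exact: (FredSR_linked e1 Ft Fs).
  exact: (FredR_not_connected e1).
(* Without a unit vector [E] is zero, so there is only one regular operator and the identity is
   compact. *)
have E0 : forall x : E, x = 0.
  by apply: no_unit_vector => e; apply/negP/ne.
split=> [t s Ft Fs|[]].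
  have ts : t = s.
    apply: regop_eq; have [[t0 _ _ _ _] _ _ _ _] := graph_regular t.
    have [[s0 _ _ _ _] _ _ _ _] := graph_regular s.
    by apply/seteqP; split=> -[x y] _; rewrite [x]E0 [y]E0.
  rewrite -ts; exists (fun=> t); split=> //; first by apply: continuous_subspaceT => x; exact: cst_continuous.
  by move=> _ [r _ <-].
split; first exact: (bop_adj 1).
move=> d d0; exists (fun=> 0).
  by exists 0%N, (fun=> 0), (fun=> 0), (fun=> 0) => z; rewrite big_ord0.
apply: (@le_lt_trans _ _ 0%:E); last by rewrite lte_fin.
by apply: opnorm_le => // x; rewrite [_ - _]E0 rnorm0 mul0r.
Qed.
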